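(* Let $\phi$ be a hyperbolic linear fractional map with $\phi(\mathbb{D})\subset\mathbb{D}$ which is not an automorphism of $\mathbb{D}$ and whose attractive fixed point $\eta$ lies on the unit circle $\mathbb{T}$. Let $\nu\in\mathbb{R}$ and $\lambda\in\mathbb{C}$. Then $\lambda C_\phi$ is recurrent on $\mathcal{S}_\nu$ if and only if $\nu\le 1/2$ and $|\lambda|>\phi'(\eta)^{(1-2\nu)/2}$. In particular, on the Dirichlet space ($\nu=1/2$) the operator $\lambda C_\phi$ is recurrent if and only if $|\lambda|>1$.
   Context: $\mathbb{D}$ is the open unit disk of $\mathbb{C}$ and $\mathbb{T}$ the unit circle. For $\nu\in\mathbb{R}$, the weighted Dirichlet space $\mathcal{S}_\nu$ is the Hilbert space of analytic functions $f(z)=\sum_{n\ge 0}a_nz^n$ on $\mathbb{D}$ with $\|f\|_\nu^2=\sum_{n\ge0}|a_n|^2(n+1)^{2\nu}<\infty$; $\mathcal{S}_{1/2}$ is the Dirichlet space. For a self-map $\phi$ of $\mathbb{D}$, $C_\phi f=f\circ\phi$; it is known that $C_\phi$ is bounded on every $\mathcal{S}_\nu$ when $\phi$ is a linear fractional self-map of $\mathbb{D}$. A bounded linear operator $T$ on a Hilbert space $\mathcal{H}$ is recurrent if for every non-empty open $U\subset\mathcal{H}$ there is a positive integer $n$ with $T^n(U)\cap U\neq\emptyset$. A linear fractional map ($\phi(z)=\frac{az+b}{cz+d}$, $ad-bc\ne0$) other than the identity with two distinct fixed points in $\hat{\mathbb{C}}=\mathbb{C}\cup\{\infty\}$ is conjugate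 (by a linear fractional map) to a dilation $z\mapsto\mu z$; it is hyperbolic if $\mu>0$ (with $\mu\neq1$). The attractive fixed point $\eta$ of a hyperbolic map is the one at which the derivative is less than $1$; here $0<\phi'(\eta)<1$. *)

(* Defs.v *)
From Stdlib Require Import Reals ClassicalEpsilon.
From Coquelicot Require Import Coquelicot.

Open Scope R_scope.

Definition in_disk (z : C) : Prop := Cmod z < 1.
Definition on_circle (z : C) : Prop := Cmod z = 1.

(** * Linear fractional maps of the Riemann sphere *)

(** The Riemann sphere; [None] is the point at infinity. *)
Definition Chat : Type := option C.

Record lfm : Type := Lfm {
  lfm_a : C; lfm_b : C; lfm_c : C; lfm_d : C;
  lfm_det : (lfm_a * lfm_d - lfm_b * lfm_c)%C <> RtoC 0 }.

(** The formula z |-> (az+b)/(cz+d) on [C]. At a pole it takes a junk value;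
    elsewhere it agrees with [lfm_app] (see [lfm_app_fun]). *)
Definition lfm_fun (phi : lfm) (z : C) : C :=
  ((lfm_a phi * z + lfm_b phi) / (lfm_c phi * z + lfm_d phi))%C.

Definition lfm_app (phi : lfm) (w : Chat) : Chat :=
  match w with
  | Some z =>
      if Ceq_dec (lfm_c phi * z + lfm_d phi)%C (RtoC 0) then None
      else Some (lfm_fun phi z)
  | None =>
      if Ceq_dec (lfm_c phi) (RtoC 0) then None
      else Some (lfm_a phi / lfm_c phi)%C
  end.

Lemma lfm_app_fun (phi : lfm) (z w : C) :
  lfm_app phi (Some z) = Some w -> lfm_fun phi z = w.
Proof.
  simpl. destruct (Ceq_dec _ _); intros H; [discriminate | now injection H].
Qed.

Definition dilation (mu : R) (w : Chat) : Chat :=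
  match w with
  | Some z => Some (RtoC mu * z)%C
  | None => None
  end.

(** Being conjugate to a dilation with factor [mu <> 1] already forces [phi] to
    have exactly two fixed points, hence to differ from the identity. *)
Definition hyperbolic (phi : lfm) : Prop :=
  exists (psi : lfm) (mu : R), 0 < mu /\ mu <> 1 /\
    forall w : Chat, lfm_app psi (lfm_app phi w) = dilation mu (lfm_app psi w).

Definition disk_self_map (phi : lfm) : Prop :=
  forall z : C, in_disk z ->
    exists w : C, in_disk w /\ lfm_app phi (Some z) = Some w.

(** Analyticity of [phi] and of its inverse is automatic for linear fractional
    maps, so only bijectivity onto the disk is required. *)
Definition disk_automorphism (phi : lfm) : Prop :=
  disk_self_map phi /\
  forall w : C, in_disk w ->
    exists! z : C, in_disk z /\ lfm_app phi (Some z) = Some w.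

(** [eta] is the attractive fixed point of [phi], with phi'(eta) = [s]. *)
Definition attractive_fixed_point (phi : lfm) (eta : C) (s : R) : Prop :=
  lfm_app phi (Some eta) = Some eta /\
  @is_derive C_AbsRing C_NormedModule (lfm_fun phi) eta (RtoC s) /\
  0 < s < 1.

(** * Weighted Dirichlet spaces

    Analytic functions on the disk are represented by functions [C -> C] whose
    values outside the disk are ignored: nothing below depends on them. *)

Definition taylor_on_disk (f : C -> C) (a : nat -> C) : Prop :=
  forall z : C, in_disk z -> @is_pseries C_AbsRing C_NormedModule a z (f z).

(** The coefficients in [taylor_on_disk] are unique, so for [f] analytic on the
    disk this chooses the Taylor coefficients of [f] at 0. *)
Definition taylor_coef (f : C -> C) : nat -> C :=
  epsilon (inhabits (fun _ => RtoC 0)) (taylor_on_disk f).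

Definition dirichlet_term (nu : R) (a : nat -> C) (n : nat) : R :=
  Cmod (a n) ^ 2 * Rpower (INR (n + 1)) (2 * nu).

Definition in_S (nu : R) (f : C -> C) : Prop :=
  exists a : nat -> C, taylor_on_disk f a /\ ex_series (dirichlet_term nu a).

Definition S_norm (nu : R) (f : C -> C) : R :=
  sqrt (Series (dirichlet_term nu (taylor_coef f))).

(** Open subsets of the normed space [S_nu]. Balls contain, together with [g],
    every function equal to [g] on the disk, so such a [U] is a set of
    functions on the disk. *)
Definition S_open (nu : R) (U : (C -> C) -> Prop) : Prop :=
  forall f, U f -> in_S nu f /\
    exists eps : R, 0 < eps /\
      forall g, in_S nu g -> S_norm nu (fun z => (g z - f z)%C) < eps -> U g.

(** Recurrence on [S_nu]. [T] is given on all functions; both [f] and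
    its [n]-th iterate are required to lie in [U], hence in [S_nu]. *)
Definition recurrent_on_S (nu : R) (T : (C -> C) -> (C -> C)) : Prop :=
  forall U : (C -> C) -> Prop, S_open nu U -> (exists f, U f) ->
    exists n : nat, (0 < n)%nat /\ exists f, U f /\ U (Nat.iter n T f).

Definition composition_op (phi : lfm) (f : C -> C) : C -> C :=
  fun z => f (lfm_fun phi z).

Definition scaled_composition_op (lambda : C) (phi : lfm) (f : C -> C) : C -> C :=
  fun z => (lambda * composition_op phi f z)%C.

(* Main.v *)
(** Write [k0] for the number with [phi^n z - eta = s^n h / (1 + k0 (1 - s^n) h)], [h = z - eta].
    Comparing with the unit circle, [phi] maps the disk into itself iff [Re (k0 eta) <= 1/2], with
    equality iff [phi] is an automorphism; so here the inequality is strict and the repelling fixed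
    point lies outside the closed disk.

    Necessity. Along an orbit [p_n = phi^n p] approaching [eta] radially, [1 - |p_n|] is at least a
    constant times [s^n] and [p_n - p_(n+1)] is of order [s^n]. If [nu <= 1/2] and
    [|lambda| <= s^((1-2nu)/2)], or if [nu > 1/2] and [|lambda| <= 1], the functionals
    [E_n f = lambda^n (f p_n - f p_(n+1))] are bounded on [S_nu] uniformly in [n]. As
    [E_0 (T^n f) = E_n f], recurrence would bring [E_n f] back near [E_0 f] on a neighbourhood of
    the function [z], where it is smaller by a fixed factor. Using differences instead of values
    covers the borderline case [nu = 1/2], [|lambda| = 1]. If [nu > 1/2] and [|lambda| > 1], the
    values [f p_n] themselves are uniformly bounded, and [T^n] multiplies them by [lambda^n].

    Sufficiency. It is enough to find, for all [f] and [g] in [S_nu] and all large [n], some [h]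
    close to [f] with [T^n h] close to [g]. The pairs [(f, g)] with this property form a closed
    subspace. Functions vanishing to high order at [eta] have [T^n f -> 0], which gives the pairs
    [(f, 0)], because such functions are dense when [nu <= 1/2]. For the pairs [(0, g)] put
    [v = h / (1 + k0 h)], so that [v o phi = s v]; then [(1 - v/eta)^-j] has the exact preimage
    [lambda^-n (1 - s^-n v/eta)^-j] under [T^n], whose norm is of order
    [(s^((1-2nu)/2) / |lambda|)^n] for large [j]. These powers span a dense subspace: their common
    pole can be moved step by step to infinity, after which only a factor [(1 - q0 z)^J],
    [|q0| < 1], has to be removed. *)
Require Import Defs.
From Stdlib Require Import Reals Lra Lia Psatz ClassicalEpsilon FunctionalExtensionality.
From Coquelicot Require Import Coquelicot.

Open Scope R_scope.

(** * Complex series and Taylor coefficients *)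


Lemma pow_n_C (z : C) (k : nat) : pow_n (K := C_Ring) z k = (z ^ k)%C.
Proof.
  induction k as [|k IH]; simpl; [reflexivity|].
  rewrite IH. reflexivity.
Qed.

Definition Cseries (u : nat -> C) (l : C) : Prop :=
  @is_series C_AbsRing C_NormedModule u l.

Lemma Cseries_ext (u v : nat -> C) (l : C) :
  (forall n, u n = v n) -> Cseries u l -> Cseries v l.
Proof. apply is_series_ext. Qed.

Lemma Cseries_unique (u : nat -> C) (l l' : C) :
  Cseries u l -> Cseries u l' -> l = l'.
Proof.
  intros H H'. unfold Cseries, is_series in *.
  eapply (filterlim_locally_unique (F := eventually) (sum_n u)); eassumption.
Qed.

Lemma Cseries_plus (u v : nat -> C) (l l' : C) :
  Cseries u l -> Cseries v l' -> Cseries (fun n => u n + v n)%C (l + l')%C.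
Proof. intros H H'. exact (is_series_plus _ _ _ _ H H'). Qed.

Lemma Cseries_scal (c : C) (u : nat -> C) (l : C) :
  Cseries u l -> Cseries (fun n => c * u n)%C (c * l)%C.
Proof. intros H. exact (is_series_scal c _ _ H). Qed.

Lemma Cseries_shift (u : nat -> C) (l : C) :
  Cseries u l -> Cseries (fun n => match n with O => 0%C | S m => u m end) l.
Proof.
  intros H. apply is_series_decr_1.
  replace (@plus _ l _) with l; [exact H|].
  change (l = l + - 0)%C. ring.
Qed.

Lemma ex_Cseries_le (u : nat -> C) (b : nat -> R) :
  (forall n, Cmod (u n) <= b n) -> ex_series b -> exists l, Cseries u l.
Proof.
  intros H Hb.
  assert (Hre : ex_series (fun n => fst (u n))).
  { apply (ex_series_le (V := R_CompleteNormedModule) _ b); [|exact Hb].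
    intros n. eapply Rle_trans; [|apply H]. eapply Rle_trans; [|apply Rmax_Cmod].
    apply Rmax_l. }
  assert (Him : ex_series (fun n => snd (u n))).
  { apply (ex_series_le (V := R_CompleteNormedModule) _ b); [|exact Hb].
    intros n. eapply Rle_trans; [|apply H]. eapply Rle_trans; [|apply Rmax_Cmod].
    apply Rmax_r. }
  destruct Hre as [x Hx], Him as [y Hy].
  exists (x, y). unfold Cseries, is_series in *.
  assert (E : forall n, sum_n u n = (sum_n (fun n => fst (u n)) n, sum_n (fun n => snd (u n)) n)).
  { induction n as [|n IH].
    - rewrite !sum_O. destruct (u 0%nat); reflexivity.
    - rewrite !sum_Sn, IH. destruct (u (S n)); reflexivity. }
  apply filterlim_ext with (1 := fun n => eq_sym (E n)).
  intros P [eps HP].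
  pose proof (Hx _ (locally_ball x eps)) as [N1 H1].
  pose proof (Hy _ (locally_ball y eps)) as [N2 H2].
  exists (max N1 N2). intros n Hn. apply HP. split.
  - apply H1. lia.
  - apply H2. lia.
Qed.

Lemma Cseries_dist (u : nat -> C) (l : C) :
  Cseries u l -> forall eps, 0 < eps ->
  exists N, forall n, (N <= n)%nat -> Cmod (sum_n (G := C_AbelianMonoid) u n - l)%C < eps.
Proof.
  intros H eps He.
  pose proof (proj1 (filterlim_locally_ball_norm (K := C_AbsRing) (U := C_NormedModule) (sum_n u) l) H (mkposreal eps He)) as [N HN].
  exists N. intros n Hn. exact (HN n Hn).
Qed.

Lemma Cmod_sum_n_le (u : nat -> C) (b : nat -> R) (n : nat) :
  (forall k, Cmod (u k) <= b k) -> Cmod (sum_n (G := C_AbelianMonoid) u n) <= sum_n b n.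
Proof.
  intros H. induction n as [|n IH].
  - rewrite !sum_O. apply H.
  - rewrite !sum_Sn. eapply Rle_trans; [apply Cmod_triangle|].
    apply Rplus_le_compat; auto.
Qed.

Lemma sum_n_le_Series (b : nat -> R) (n : nat) :
  (forall k, 0 <= b k) -> ex_series b -> sum_n b n <= Series b.
Proof.
  intros Hb Hex. apply (is_lim_seq_incr_compare (sum_n b)).
  - exact (Series_correct _ Hex).
  - intros m. rewrite sum_Sn. specialize (Hb (S m)). unfold plus; simpl. lra.
Qed.

Lemma Cseries_bound (u : nat -> C) (l : C) (b : nat -> R) :
  Cseries u l -> (forall n, Cmod (u n) <= b n) -> ex_series b -> Cmod l <= Series b.
Proof.
  intros H Hb Hex.
  assert (Hb0 : forall k, 0 <= b k).
  { intros k. eapply Rle_trans; [apply Cmod_ge_0|apply Hb]. }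
  apply le_epsilon. intros eps He.
  destruct (Cseries_dist u l H eps He) as [N HN].
  specialize (HN N (Nat.le_refl _)).
  replace l with (sum_n (G := C_AbelianMonoid) u N - (sum_n (G := C_AbelianMonoid) u N - l))%C by ring.
  eapply Rle_trans; [apply Cmod_triangle|]. rewrite Cmod_opp.
  pose proof (Cmod_sum_n_le u b N Hb). pose proof (sum_n_le_Series b N Hb0 Hex). lra.
Qed.

Lemma series_bounded (b : nat -> R) (M : R) :
  (forall k, 0 <= b k) -> (forall n, sum_n b n <= M) -> ex_series b /\ Series b <= M.
Proof.
  intros Hb HM.
  assert (Hinc : forall n, sum_n b n <= sum_n b (S n)).
  { intros n. rewrite sum_Sn. specialize (Hb (S n)). unfold plus; simpl. lra. }
  assert (Hf : ex_finite_lim_seq (sum_n b)) by (apply ex_finite_lim_seq_incr with M; auto).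
  destruct Hf as [l Hl].
  assert (Hs : is_series b l) by exact Hl.
  split; [exists l; exact Hs|]. rewrite (is_series_unique _ _ Hs).
  apply (is_lim_seq_le (sum_n b) (fun _ => M) l M); auto using is_lim_seq_const.
Qed.

Lemma series_le (b c : nat -> R) :
  (forall k, 0 <= b k <= c k) -> ex_series c -> ex_series b /\ Series b <= Series c.
Proof.
  intros H Hc. split.
  - apply (ex_series_le (V := R_CompleteNormedModule) _ c); [|exact Hc].
    intros n. specialize (H n). unfold norm; simpl. unfold abs; simpl. rewrite Rabs_pos_eq; lra.
  - apply Series_le; auto.
Qed.

Lemma taylor_series (f : C -> C) (a : nat -> C) :
  taylor_on_disk f a <-> forall z, in_disk z -> Cseries (fun k => a k * z ^ k)%C (f z).
Proof.
  assert (E : forall (z : C) k, @scal C_AbsRing C_NormedModule (pow_n (K := C_AbsRing) z k) (a k) = (a k * z ^ k)%C).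
  { intros z k. rewrite (pow_n_C z k : pow_n (K := C_AbsRing) z k = _). apply Cmult_comm. }
  split; intros H z Hz; specialize (H z Hz).
  - eapply Cseries_ext; [apply E|exact H].
  - eapply is_series_ext; [intros k; symmetry; apply E|exact H].
Qed.

Lemma taylor_ext (f g : C -> C) (a : nat -> C) :
  (forall z, in_disk z -> f z = g z) -> taylor_on_disk f a -> taylor_on_disk g a.
Proof. intros H Hf z Hz. rewrite <- H by exact Hz. exact (Hf z Hz). Qed.

Lemma taylor_coef_ext (f : C -> C) (a b : nat -> C) :
  (forall k, a k = b k) -> taylor_on_disk f a -> taylor_on_disk f b.
Proof. intros H Hf. rewrite <- (functional_extensionality a b H). exact Hf. Qed.

Lemma taylor_plus (f g : C -> C) (a b : nat -> C) :
  taylor_on_disk f a -> taylor_on_disk g b ->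
  taylor_on_disk (fun z => f z + g z)%C (fun k => a k + b k)%C.
Proof.
  rewrite !taylor_series. intros Hf Hg z Hz.
  eapply Cseries_ext; [|apply Cseries_plus; [apply Hf|apply Hg]; exact Hz].
  intros k; simpl. ring.
Qed.

Lemma taylor_scal (c : C) (f : C -> C) (a : nat -> C) :
  taylor_on_disk f a -> taylor_on_disk (fun z => c * f z)%C (fun k => c * a k)%C.
Proof.
  rewrite !taylor_series. intros Hf z Hz.
  eapply Cseries_ext; [|apply (Cseries_scal c); apply Hf; exact Hz].
  intros k; simpl. ring.
Qed.

Definition shift (a : nat -> C) (k : nat) : C := match k with O => 0%C | S j => a j end.

Lemma taylor_mulz (f : C -> C) (a : nat -> C) :
  taylor_on_disk f a -> taylor_on_disk (fun z => z * f z)%C (shift a).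
Proof.
  rewrite !taylor_series. intros Hf z Hz.
  eapply Cseries_ext; [|apply Cseries_shift; apply (Cseries_scal z); apply Hf; exact Hz].
  intros [|k]; simpl shift; [ring|]. rewrite Cpow_S. ring.
Qed.

Lemma taylor_0 : taylor_on_disk (fun _ => 0%C) (fun _ => 0%C).
Proof.
  apply taylor_series. intros z _.
  assert (H : Cseries (fun _ => 0%C) 0%C).
  { unfold Cseries, is_series. eapply filterlim_ext; [|apply filterlim_const].
    intros n. symmetry. simpl. induction n as [|n IH]; [apply sum_O|].
    rewrite sum_Sn, IH. unfold plus; simpl. change (0 + 0 = 0)%C. ring. }
  eapply Cseries_ext; [|exact H]. intros n; simpl; ring.
Qed.

Lemma taylor_1 : taylor_on_disk (fun _ => 1%C) (fun k => match k with O => 1%C | S _ => 0%C end).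
Proof.
  apply taylor_series. intros z Hz.
  pose proof (proj1 (taylor_series _ _) taylor_0 z Hz) as H. simpl in H.
  apply is_series_decr_1. eapply is_series_ext; [|].
  2: { replace (@plus _ _ _) with (RtoC 0); [exact H|].
       change (RtoC 0 = 1 + - (1 * z ^ 0))%C. simpl. ring. }
  intros n. simpl. ring.
Qed.


Lemma Cseries_terms_bounded (u : nat -> C) (l : C) :
  Cseries u l -> exists B, 0 < B /\ forall k, Cmod (u k) <= B.
Proof.
  intros H. destruct (filterlim_bounded (K := C_AbsRing) (V := C_NormedModule) (sum_n u)) as [M HM].
  { exists l. exact H. }
  assert (HM' : forall n, Cmod (sum_n (G := C_AbelianMonoid) u n) <= M) by exact HM.
  assert (0 <= M) by (eapply Rle_trans; [apply Cmod_ge_0|apply (HM' O)]).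
  exists (2 * M + 1). split; [lra|]. intros [|k].
  - specialize (HM' O). rewrite sum_O in HM'. lra.
  - pose proof (HM' k). pose proof (HM' (S k)) as H2.
    rewrite sum_Sn in H2. change (@plus _ ?x ?y) with (x + y)%C in H2.
    replace (u (S k)) with ((sum_n (G := C_AbelianMonoid) u k + u (S k)) - sum_n (G := C_AbelianMonoid) u k)%C by ring.
    eapply Rle_trans; [apply Cmod_triangle|]. rewrite Cmod_opp. lra.
Qed.

Lemma Cseries_decr (u : nat -> C) (l : C) :
  Cseries u l -> Cseries (fun k => u (S k)) (l - u O)%C.
Proof.
  intros H. apply is_series_incr_1.
  replace (@plus _ _ _) with l; [exact H|]. change (l = (l - u O) + u O)%C. ring.
Qed.

Lemma series_geom_scal (B q : R) :
  0 <= q < 1 -> is_series (fun n => B * q ^ n) (B * / (1 - q)).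
Proof.
  intros Hq. apply (is_series_scal (K := R_AbsRing) (V := R_NormedModule) B).
  apply is_series_geom. rewrite Rabs_pos_eq; lra.
Qed.

(** Otherwise the lowest nonzero term dominates near 0. *)
Lemma zero_series_coef (a : nat -> C) :
  (forall z, in_disk z -> z <> 0%C -> Cseries (fun k => a k * z ^ k)%C 0%C) ->
  forall k, a k = 0%C.
Proof.
  assert (H0 : forall a, (forall z, in_disk z -> z <> 0%C -> Cseries (fun k => a k * z ^ k)%C 0%C) -> a O = 0%C).
  { clear a. intros a H.
    assert (Hh : in_disk (RtoC (1/2))) by (unfold in_disk; rewrite Cmod_R, Rabs_pos_eq; lra).
    assert (Hh0 : RtoC (1/2) <> 0%C) by (intros E; apply RtoC_inj in E; lra).
    destruct (Cseries_terms_bounded _ _ (H _ Hh Hh0)) as [B [HB Hb]].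
    (* At [1/2] all terms are bounded by [B], so at [t] those of index [k >= 1] are at most
       [B (2t)^k]. They sum to at most [2Bt / (1 - 2t) <= 4Bt], and this sum is [- a 0]. *)
    assert (Ht : forall t, 0 < t <= 1/4 -> Cmod (a O) <= 4 * B * t).
    { intros t Ht.
      assert (Ht1 : in_disk (RtoC t)) by (unfold in_disk; rewrite Cmod_R, Rabs_pos_eq; lra).
      assert (Ht0 : RtoC t <> 0%C) by (intros E; apply RtoC_inj in E; lra).
      pose proof (Cseries_decr _ _ (H _ Ht1 Ht0)) as Hs. simpl in Hs.
      pose proof (series_geom_scal (B * (2 * t)) (2 * t) ltac:(lra)) as Hg.
      apply Cseries_bound with (b := fun k => B * (2 * t) * (2 * t) ^ k) in Hs.
      - rewrite (is_series_unique _ _ Hg) in Hs.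
        replace (0 - a 0%nat * 1)%C with (- a O)%C in Hs by ring. rewrite Cmod_opp in Hs.
        eapply Rle_trans; [exact Hs|].
        replace (4 * B * t) with (B * (2 * t) * 2) by ring.
        apply Rmult_le_compat_l; [nra|].
        rewrite <- (Rinv_inv 2) at 2. apply Rinv_le_contravar; lra.
      - intros n. specialize (Hb (S n)).
        rewrite Cmod_mult, Cmod_pow, Cmod_R, Rabs_pos_eq in Hb by lra.
        rewrite Cmod_mult. change (RtoC t * RtoC t ^ n)%C with (RtoC t ^ S n)%C.
        rewrite Cmod_pow, Cmod_R, (Rabs_pos_eq t) by lra.
        replace (t ^ S n) with ((1 / 2) ^ S n * (2 * t) ^ S n).
        2: { rewrite <- Rpow_mult_distr. f_equal. lra. }
        rewrite <- Rmult_assoc. replace (B * (2 * t) * (2 * t) ^ n) with (B * (2 * t) ^ S n) by (simpl; ring).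
        apply Rmult_le_compat_r; [apply pow_le; lra|exact Hb].
      - eexists. exact Hg. }
    apply Cmod_eq_0. pose proof (Cmod_ge_0 (a O)) as Hge.
    destruct (Rle_lt_or_eq_dec _ _ Hge) as [Hlt|E]; [exfalso|auto].
    pose proof (Ht (Rmin (1/4) (Cmod (a O) / (8 * B)))) as Hc.
    assert (0 < Cmod (a O) / (8 * B)) by (apply Rdiv_lt_0_compat; lra).
    assert (Hm : 0 < Rmin (1/4) (Cmod (a O) / (8 * B)) <= 1/4).
    { split; [apply Rmin_glb_lt; lra|apply Rmin_l]. }
    specialize (Hc Hm). pose proof (Rmin_r (1/4) (Cmod (a O) / (8 * B))).
    assert (4 * B * (Cmod (a O) / (8 * B)) = Cmod (a O) / 2) by (field; lra).
    assert (4 * B * Rmin (1 / 4) (Cmod (a 0%nat) / (8 * B)) <= 4 * B * (Cmod (a O) / (8 * B))).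
    { apply Rmult_le_compat_l; lra. }
    lra. }
  (* Once [a 0 = 0], dividing by [z] gives a series with shifted coefficients that again sums to 0.
     This division is why the hypothesis leaves out [z = 0]. *)
  intros H k. revert a H. induction k as [|k IH]; intros a H; [apply H0; exact H|].
  apply (IH (fun j => a (S j))). intros z Hz Hz0.
  pose proof (Cseries_decr _ _ (H z Hz Hz0)) as Hs. simpl in Hs.
  pose proof (H0 a H) as Ha0.
  apply (Cseries_scal (/ z)) in Hs.
  replace (/ z * (0 - a 0%nat * 1))%C with (RtoC 0) in Hs by (rewrite Ha0; ring).
  eapply Cseries_ext; [|exact Hs]. intros n. simpl. field. exact Hz0.
Qed.

Lemma taylor_unique (f : C -> C) (a b : nat -> C) :
  taylor_on_disk f a -> taylor_on_disk f b -> a = b.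
Proof.
  intros Ha Hb. apply functional_extensionality. intros k.
  pose proof (taylor_plus _ _ _ _ Ha (taylor_scal (-1)%C _ _ Hb)) as H.
  assert (E : forall k, (a k + -1 * b k = 0)%C).
  { apply zero_series_coef. intros z Hz _. rewrite taylor_series in H.
    specialize (H z Hz). cbv beta in H. replace (f z + -1 * f z)%C with (RtoC 0) in H by ring. exact H. }
  specialize (E k). replace (a k) with ((a k + -1 * b k) + b k)%C by ring. rewrite E. ring.
Qed.

Lemma taylor_coef_eq (f : C -> C) (a : nat -> C) :
  taylor_on_disk f a -> taylor_coef f = a.
Proof.
  intros H. apply (taylor_unique f); [|exact H].
  unfold taylor_coef. apply epsilon_spec. exists a. exact H.
Qed.

(** * The norm of the weighted Dirichlet space *)


Lemma Rpower_pos (x y : R) : 0 < Rpower x y.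
Proof. apply exp_pos. Qed.

Lemma exp_le_mono (x y : R) : x <= y -> exp x <= exp y.
Proof.
  intros [H|H]; [left; apply exp_increasing; exact H|rewrite H; apply Rle_refl].
Qed.

Lemma Rpower_base1 (y : R) : Rpower 1 y = 1.
Proof. unfold Rpower. rewrite ln_1, Rmult_0_r. apply exp_0. Qed.

Lemma Rpower_div_base (x y z : R) :
  0 < x -> 0 < y -> Rpower (x / y) z = Rpower x z / Rpower y z.
Proof.
  intros Hx Hy. unfold Rpower at 1. rewrite ln_div by assumption.
  rewrite Rmult_minus_distr_l. unfold Rminus. rewrite exp_plus, exp_Ropp. reflexivity.
Qed.

Lemma INR_S_pos (k : nat) : 0 < INR (k + 1).
Proof. apply lt_0_INR. lia. Qed.

Lemma ln_le_sub1 (y : R) : 0 < y -> ln y <= y - 1.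
Proof.
  intros Hy. pose proof (exp_ineq1_le (ln y)) as H. rewrite exp_ln in H by exact Hy. lra.
Qed.

(** The tangent bound [ln u <= u - 1] at [u = t / (p + 1)]. Taking [p + 1] rather than the maximiser
    [p] keeps [p = 0] in range. *)
Lemma Rpower_mul_exp_le (p t : R) :
  0 <= p -> 0 < t -> Rpower t p * exp (- t) <= exp (p * ln (p + 1)).
Proof.
  intros Hp Ht. unfold Rpower. rewrite <- exp_plus. apply exp_le_mono.
  pose proof (ln_le_sub1 (t / (p + 1))) as H.
  assert (Hpos : 0 < t / (p + 1)) by (apply Rdiv_lt_0_compat; lra).
  specialize (H Hpos). rewrite ln_div in H by lra.
  assert (E : p * (t / (p + 1)) <= t).
  { apply Rmult_le_reg_r with (p + 1); [lra|]. field_simplify; [nra|lra]. }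
  assert (p * (ln t - ln (p + 1)) <= p * (t / (p + 1) - 1)) by (apply Rmult_le_compat_l; lra).
  nra.
Qed.

Lemma pow_le_exp (r : R) (k : nat) : 0 <= r -> r ^ k <= exp (- (1 - r) * INR k).
Proof.
  intros Hr. induction k as [|k IH].
  - simpl. rewrite Rmult_0_r, exp_0. lra.
  - rewrite S_INR. replace (- (1 - r) * (INR k + 1)) with ((- (1 - r)) + - (1 - r) * INR k) by ring.
    rewrite exp_plus. simpl. apply Rmult_le_compat; auto using pow_le.
    pose proof (exp_ineq1_le (- (1 - r))). lra.
Qed.

(** Only one of the two factors [r^k] is kept for convergence. The other is at most [e * exp (- t)]
    with [t = (k + 1) (1 - r)], which absorbs [t^p]; the weight [(k + 1)^p] thus costs [(1 - r)^-p],
    and the remaining geometric series one more power. *)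
Lemma power_geom_series (p : R) :
  0 <= p -> exists K, 0 < K /\ forall r, 0 < r < 1 ->
    ex_series (fun k => Rpower (INR (k + 1)) p * r ^ (2 * k)) /\
    Series (fun k => Rpower (INR (k + 1)) p * r ^ (2 * k)) <= K * Rpower (1 - r) (- (p + 1)).
Proof.
  intros Hp. exists (exp (1 + p * ln (p + 1))). split; [apply exp_pos|].
  intros r Hr.
  set (K := exp (1 + p * ln (p + 1))).
  pose proof (series_geom_scal (K * Rpower (1 - r) (- p)) r ltac:(lra)) as Hg.
  replace (K * Rpower (1 - r) (- (p + 1))) with (Series (fun n => K * Rpower (1 - r) (- p) * r ^ n)).
  2: { rewrite (is_series_unique _ _ Hg). replace (- (p + 1)) with (- p + Ropp 1) by ring.
       rewrite Rpower_plus, (Rpower_Ropp (1 - r) 1), Rpower_1 by lra. ring. }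
  apply series_le; [|eexists; exact Hg].
  intros k. split.
  { apply Rmult_le_pos; [left; apply Rpower_pos|apply pow_le; lra]. }
  replace (2 * k)%nat with (k + k)%nat by lia. rewrite pow_add, <- Rmult_assoc.
  apply Rmult_le_compat_r; [apply pow_le; lra|].
  pose proof (INR_S_pos k) as Hk.
  set (t := INR (k + 1) * (1 - r)).
  assert (Ht : 0 < t) by (apply Rmult_lt_0_compat; lra).
  assert (E : Rpower (INR (k + 1)) p = Rpower t p * Rpower (1 - r) (- p)).
  { unfold t. rewrite <- Rpower_mult_distr by lra. rewrite Rmult_assoc, <- Rpower_plus.
    replace (p + - p) with 0 by ring. rewrite Rpower_O by lra. ring. }
  rewrite E.
  assert (Hrk : r ^ k <= exp 1 * exp (- t)).
  { eapply Rle_trans; [apply pow_le_exp; lra|]. rewrite <- exp_plus. apply exp_le_mono.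
    unfold t. rewrite plus_INR. simpl. nra. }
  pose proof (Rpower_mul_exp_le p t Hp Ht) as H2.
  unfold K. rewrite exp_plus.
  replace (Rpower t p * Rpower (1 - r) (- p) * r ^ k) with (Rpower t p * r ^ k * Rpower (1 - r) (- p)) by ring.
  apply Rmult_le_compat_r; [left; apply Rpower_pos|].
  eapply Rle_trans; [apply Rmult_le_compat_l; [left; apply Rpower_pos|exact Hrk]|].
  pose proof (exp_pos 1). nra.
Qed.

(** Telescoping: each term after the first is at most [1/a] times the decrease of [x^-a] over a unit
    step, by [1/y <= ln (y/x)] for [y = x + 1]. *)
Lemma p_series (a : R) : 0 < a -> ex_series (fun k => Rpower (INR (k + 1)) (- (1 + a))).
Proof.
  intros Ha.
  apply (series_bounded _ (1 + / a)); [intros k; left; apply Rpower_pos|].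
  assert (H : forall n, sum_n (fun k => Rpower (INR (k + 1)) (- (1 + a))) n <= 1 + / a * (1 - Rpower (INR (n + 1)) (- a))).
  { induction n as [|n IH].
    - rewrite sum_O. simpl. rewrite !Rpower_base1. lra.
    - rewrite sum_Sn. change (@plus _ ?x ?y) with (x + y).
      enough (Rpower (INR (S n + 1)) (- (1 + a)) <= / a * (Rpower (INR (n + 1)) (- a) - Rpower (INR (S n + 1)) (- a))) by lra.
      clear IH. set (y := INR (S n + 1)). set (x := INR (n + 1)).
      assert (Hx : 0 < x) by apply INR_S_pos.
      assert (Hy : y = x + 1) by (unfold x, y; rewrite !plus_INR, S_INR; simpl; ring).
      replace (- (1 + a)) with (- a + Ropp 1) by ring.
      rewrite Rpower_plus, (Rpower_Ropp y 1), Rpower_1 by lra.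
      assert (E : Rpower x (- a) = Rpower y (- a) * Rpower (y / x) a).
      { rewrite Rpower_div_base by lra. rewrite (Rpower_Ropp x a), (Rpower_Ropp y a).
        field. split; apply Rgt_not_eq, Rpower_pos. }
      rewrite E.
      assert (H1 : a * / y <= Rpower (y / x) a - 1).
      { unfold Rpower. pose proof (exp_ineq1_le (a * ln (y / x))).
        assert (/ y <= ln (y / x)).
        { pose proof (ln_le_sub1 (x / y) ltac:(apply Rdiv_lt_0_compat; lra)) as Hl.
          rewrite ln_div in * by lra. assert (x / y - 1 = - / y) by (rewrite Hy; field; lra). lra. }
        assert (a * / y <= a * ln (y / x)) by (apply Rmult_le_compat_l; lra). lra. }
      pose proof (Rpower_pos y (- a)).
      apply Rmult_le_reg_l with a; [exact Ha|]. rewrite <- (Rmult_assoc a (/ a)), Rinv_r by lra. nra. }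
  intros n. eapply Rle_trans; [apply H|]. pose proof (Rpower_pos (INR (n + 1)) (- a)).
  assert (0 < / a) by (apply Rinv_0_lt_compat; lra). nra.
Qed.

(** A bound on the squared norm that carries membership in the space with it and names the
    coefficients directly. Sums obey [2d + 2e] instead of the triangle inequality, which is harmless
    since only arbitrarily small bounds matter. *)
Definition S_norm2_le (nu : R) (f : C -> C) (d : R) : Prop :=
  exists a, taylor_on_disk f a /\ ex_series (dirichlet_term nu a) /\
    Series (dirichlet_term nu a) <= d.

Lemma dirichlet_term_pos (nu : R) (a : nat -> C) (k : nat) : 0 <= dirichlet_term nu a k.
Proof. apply Rmult_le_pos; [apply pow2_ge_0|left; apply Rpower_pos]. Qed.

Lemma S_norm2_le_in_S (nu : R) (f : C -> C) (d : R) : S_norm2_le nu f d -> in_S nu f.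
Proof. intros [a [H1 [H2 _]]]. exists a. auto. Qed.

Lemma in_S_norm2_le (nu : R) (f : C -> C) : in_S nu f -> exists d, S_norm2_le nu f d.
Proof.
  intros [a [H1 H2]]. exists (Series (dirichlet_term nu a)). exists a. auto using Rle_refl.
Qed.

Lemma S_norm2_le_ext (nu : R) (f g : C -> C) (d : R) :
  (forall z, in_disk z -> f z = g z) -> S_norm2_le nu f d -> S_norm2_le nu g d.
Proof. intros H [a [H1 H2]]. exists a. split; [eapply taylor_ext; eauto|exact H2]. Qed.

Lemma S_norm2_le_mono (nu : R) (f : C -> C) (d d' : R) : d <= d' -> S_norm2_le nu f d -> S_norm2_le nu f d'.
Proof. intros H [a [H1 [H2 H3]]]. exists a. repeat split; auto; lra. Qed.

Lemma S_norm2_le_of_coef_le (nu : R) (f : C -> C) (a : nat -> C) (b : nat -> R) :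
  taylor_on_disk f a -> (forall k, dirichlet_term nu a k <= b k) -> ex_series b ->
  S_norm2_le nu f (Series b).
Proof.
  intros Hf Hb Hex. exists a.
  destruct (series_le (dirichlet_term nu a) b) as [H1 H2]; auto.
  intros k. split; [apply dirichlet_term_pos|apply Hb].
Qed.

Lemma ex_series_scalR (c : R) (b : nat -> R) : ex_series b -> ex_series (fun k => c * b k).
Proof. intros H. exact (ex_series_scal (K := R_AbsRing) (V := R_NormedModule) c b H). Qed.

Lemma S_norm2_le_plus (nu : R) (f g : C -> C) (d e : R) :
  S_norm2_le nu f d -> S_norm2_le nu g e -> S_norm2_le nu (fun z => f z + g z)%C (2 * d + 2 * e).
Proof.
  intros [a [Ha [Ha1 Ha2]]] [b [Hb [Hb1 Hb2]]].
  eapply S_norm2_le_mono; [|apply (S_norm2_le_of_coef_le nu _ _ (fun k => 2 * dirichlet_term nu a k + 2 * dirichlet_term nu b k) (taylor_plus _ _ _ _ Ha Hb))].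
  - rewrite Series_plus by (apply ex_series_scalR; assumption). rewrite !Series_scal_l. lra.
  - intros k. unfold dirichlet_term. pose proof (Rpower_pos (INR (k + 1)) (2 * nu)).
    pose proof (Cmod_triangle (a k) (b k)). pose proof (Cmod_ge_0 (a k)). pose proof (Cmod_ge_0 (b k)).
    pose proof (Cmod_ge_0 (a k + b k)%C).
    assert (Cmod (a k + b k) ^ 2 <= 2 * Cmod (a k) ^ 2 + 2 * Cmod (b k) ^ 2).
    { apply Rle_trans with ((Cmod (a k) + Cmod (b k)) ^ 2); [apply pow_incr; lra|].
      pose proof (pow2_ge_0 (Cmod (a k) - Cmod (b k))). lra. }
    nra.
  - apply (ex_series_plus (K := R_AbsRing) (V := R_NormedModule)); apply ex_series_scalR; assumption.
Qed.

Lemma S_norm2_le_scal (nu : R) (c : C) (f : C -> C) (d : R) :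
  S_norm2_le nu f d -> S_norm2_le nu (fun z => c * f z)%C (Cmod c ^ 2 * d).
Proof.
  intros [a [Ha [Ha1 Ha2]]].
  eapply S_norm2_le_mono; [|apply (S_norm2_le_of_coef_le nu _ _ (fun k => Cmod c ^ 2 * dirichlet_term nu a k) (taylor_scal c _ _ Ha))].
  - rewrite Series_scal_l. apply Rmult_le_compat_l; [apply pow2_ge_0|exact Ha2].
  - intros k. unfold dirichlet_term. rewrite Cmod_mult. right. ring.
  - apply ex_series_scalR; assumption.
Qed.

(** Consecutive weights have ratio [((k + 2) / (k + 1))^(2 nu)], with base in [[1, 2]] and exponent
    at most 1. *)
Lemma S_norm2_le_mulz (nu : R) (f : C -> C) (d : R) :
  nu <= 1 / 2 -> S_norm2_le nu f d -> S_norm2_le nu (fun z => z * f z)%C (2 * d).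
Proof.
  intros Hnu [a [Ha [Ha1 Ha2]]].
  set (b := fun k => match k with O => 0 | S j => 2 * dirichlet_term nu a j end).
  assert (Hsh : is_series b (2 * Series (dirichlet_term nu a))).
  { apply is_series_decr_1. replace (@plus _ _ _) with (2 * Series (dirichlet_term nu a)).
    - apply (is_series_scal (K := R_AbsRing) (V := R_NormedModule) 2). apply Series_correct. exact Ha1.
    - change (2 * Series (dirichlet_term nu a) = 2 * Series (dirichlet_term nu a) + - 0). ring. }
  eapply S_norm2_le_mono; [|apply (S_norm2_le_of_coef_le nu _ _ b (taylor_mulz _ _ Ha))].
  - rewrite (is_series_unique _ _ Hsh). lra.
  - intros [|k]; unfold b, dirichlet_term; simpl shift.
    + rewrite Cmod_0. simpl. lra.
    + replace (2 * (Cmod (a k) ^ 2 * Rpower (INR (k + 1)) (2 * nu))) with (Cmod (a k) ^ 2 * (2 * Rpower (INR (k + 1)) (2 * nu))) by ring.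
      apply Rmult_le_compat_l; [apply pow2_ge_0|].
      pose proof (INR_S_pos k) as Hk.
      assert (Hk1 : 1 <= INR (k + 1)) by (change 1 with (INR 1); apply le_INR; lia).
      assert (Hy : INR (S k + 1) = INR (k + 1) + 1) by (rewrite !plus_INR, S_INR; simpl; ring).
      set (x := INR (k + 1)) in *. rewrite Hy.
      assert (E : Rpower (x + 1) (2 * nu) = Rpower ((x + 1) / x) (2 * nu) * Rpower x (2 * nu)).
      { rewrite Rpower_div_base by lra. field. apply Rgt_not_eq, Rpower_pos. }
      rewrite E. apply Rmult_le_compat_r; [left; apply Rpower_pos|].
      assert (H1 : 1 <= (x + 1) / x).
      { apply Rmult_le_reg_r with x; [lra|]. field_simplify; lra. }
      assert (H2 : (x + 1) / x <= 2).
      { apply Rmult_le_reg_r with x; [lra|]. field_simplify; lra. }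
      apply Rle_trans with (Rpower ((x + 1) / x) 1).
      * destruct (Rle_lt_or_eq_dec _ _ H1) as [Hlt|Heq].
        { apply Rle_Rpower; lra. }
        { rewrite <- Heq, !Rpower_base1. lra. }
      * rewrite Rpower_1; lra.
  - eexists. exact Hsh.
Qed.

Lemma S_norm2_le_affine (nu : R) (al be : C) :
  nu <= 1 / 2 -> exists K, 0 <= K /\ forall f d, S_norm2_le nu f d -> S_norm2_le nu (fun z => (al + be * z) * f z)%C (K * d).
Proof.
  intros Hnu. exists (2 * Cmod al ^ 2 + 4 * Cmod be ^ 2). split.
  { pose proof (pow2_ge_0 (Cmod al)). pose proof (pow2_ge_0 (Cmod be)). lra. }
  intros f d H.
  eapply S_norm2_le_mono; [|eapply S_norm2_le_ext; [|apply (S_norm2_le_plus nu _ _ _ _ (S_norm2_le_scal nu al _ _ H) (S_norm2_le_scal nu be _ _ (S_norm2_le_mulz nu _ _ Hnu H)))]].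
  - lra.
  - intros z _. simpl. ring.
Qed.

Lemma S_norm2_le_affine_pow (nu : R) (al be : C) (n : nat) :
  nu <= 1 / 2 -> exists K, 0 <= K /\ forall f d, S_norm2_le nu f d -> S_norm2_le nu (fun z => (al + be * z) ^ n * f z)%C (K * d).
Proof.
  intros Hnu. destruct (S_norm2_le_affine nu al be Hnu) as [K [HK H]].
  exists (K ^ n). split; [apply pow_le; exact HK|].
  induction n as [|n IH]; intros f d Hf.
  - eapply S_norm2_le_mono; [|eapply S_norm2_le_ext; [|exact Hf]]; [simpl; lra|intros z _; simpl; ring].
  - eapply S_norm2_le_mono; [|eapply S_norm2_le_ext; [|apply H; apply (IH f d Hf)]]; [simpl; lra|intros z _; simpl; ring].
Qed.

Lemma S_norm_lt (nu : R) (f : C -> C) (d eps : R) :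
  S_norm2_le nu f d -> 0 < eps -> d < eps ^ 2 -> S_norm nu f < eps.
Proof.
  intros [a [H1 [H2 H3]]] He Hd. unfold S_norm. rewrite (taylor_coef_eq _ _ H1).
  rewrite <- (sqrt_pow2 eps) by lra.
  destruct (Rle_lt_dec 0 (Series (dirichlet_term nu a))) as [Hs|Hs].
  - apply sqrt_lt_1; lra.
  - rewrite sqrt_neg_0 by lra. rewrite sqrt_pow2; lra.
Qed.

Lemma S_norm2_le_of_S_norm (nu : R) (f : C -> C) (eps : R) :
  in_S nu f -> S_norm nu f <= eps -> S_norm2_le nu f (eps ^ 2).
Proof.
  intros [a [H1 H2]] H. exists a. repeat split; auto.
  unfold S_norm in H. rewrite (taylor_coef_eq _ _ H1) in H.
  assert (Hp : 0 <= Series (dirichlet_term nu a)).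
  { eapply Rle_trans; [|apply (sum_n_le_Series _ O (dirichlet_term_pos nu a) H2)].
    rewrite sum_O. apply dirichlet_term_pos. }
  rewrite <- (sqrt_sqrt _ Hp). pose proof (sqrt_pos (Series (dirichlet_term nu a))). nra.
Qed.

(** * Dynamics near the attracting fixed point *)


Lemma Re_plus (z w : C) : Re (z + w)%C = Re z + Re w.
Proof. reflexivity. Qed.

Lemma Re_opp (z : C) : Re (- z)%C = - Re z.
Proof. reflexivity. Qed.

Lemma Re_RtoC_mult (x : R) (z : C) : Re (RtoC x * z)%C = x * Re z.
Proof. unfold Re; simpl. ring. Qed.

Lemma Cmod_plus_sqr (z w : C) :
  Cmod (z + w) ^ 2 = Cmod z ^ 2 + 2 * Re (z * Cconj w)%C + Cmod w ^ 2.
Proof. rewrite !Cmod2_alt. destruct z, w; unfold Re, Im; simpl. ring. Qed.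

Lemma Re_mult_conj (z : C) : Re (z * Cconj z)%C = Cmod z ^ 2.
Proof. rewrite Cmod2_alt. destruct z; unfold Re, Im; simpl. ring. Qed.

Lemma Cmod_one_minus_sqr (eta k : C) :
  Cmod eta = 1 -> Cmod (1 - k * eta) ^ 2 = 1 - 2 * Re (k * eta)%C + Cmod k ^ 2.
Proof.
  intros He. unfold Cminus. rewrite Cmod_plus_sqr, Cmod_opp, Cmod_mult, He, Cmod_1.
  destruct (k * eta)%C; unfold Re; simpl. ring.
Qed.

(** The difference of the squares is [1 - 2 Re (k eta)]. Geometrically, the zero of
    [1 + k (z - eta)] lies outside the closed disk. *)
Lemma Cmod_lt_one_minus (eta k : C) :
  Cmod eta = 1 -> Re (k * eta)%C < 1 / 2 -> Cmod k < Cmod (1 - k * eta).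
Proof.
  intros He Hk. pose proof (Cmod_one_minus_sqr eta k He).
  pose proof (Cmod_ge_0 k). pose proof (Cmod_ge_0 (1 - k * eta)). nra.
Qed.

Lemma den_ne0 (eta k z : C) :
  Cmod eta = 1 -> Re (k * eta)%C < 1 / 2 -> in_disk z -> (1 + k * (z - eta))%C <> 0%C.
Proof.
  intros He Hk Hz E. pose proof (Cmod_lt_one_minus eta k He Hk) as H.
  replace (1 - k * eta)%C with (- (k * z))%C in H.
  2: { replace (1 - k * eta)%C with ((1 + k * (z - eta)) - k * z)%C by ring. rewrite E. ring. }
  rewrite Cmod_opp, Cmod_mult in H. unfold in_disk in Hz.
  pose proof (Cmod_ge_0 k). pose proof (Cmod_ge_0 z). nra.
Qed.

(** For [h = z - eta] and [w = eta + t h / (1 + k h)], the left-hand side is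
    [|1 + k h|^2 (|w|^2 - 1)]. *)
Lemma disk_identity (eta k h : C) (t : R) :
  Cmod eta = 1 ->
  Cmod (eta * (1 + k * h) + t * h) ^ 2 - Cmod (1 + k * h) ^ 2 =
  t * (2 * Re (eta * Cconj h)%C + Cmod h ^ 2 * (2 * Re (k * eta)%C + t)).
Proof.
  intros He. rewrite Cmod_plus_sqr, !Cmod_mult, He, Cmod_R, !Rpow_mult_distr, pow2_abs.
  rewrite (Cmod2_alt h). destruct eta, k, h; unfold Re, Im; simpl. ring.
Qed.

(** The bound on [k0] says that the repelling fixed point [eta - 1/k0] is outside the closed
    disk. The factor [1 - s] makes the [n]-th iterate have the same form with [s^n] for [s]. *)
Definition attracting_model (eta : C) (s : R) (k0 : C) (F : C -> C) : Prop :=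
  Cmod eta = 1 /\ 0 < s < 1 /\ Re (k0 * eta)%C < 1 / 2 /\
  (forall z, in_disk z -> in_disk (F z)) /\
  (forall z, in_disk z -> F z = eta + s * (z - eta) / (1 + k0 * (1 - s) * (z - eta)))%C.

Lemma pow_s_bounds (s : R) (n : nat) : 0 < s < 1 -> 0 < s ^ n <= 1.
Proof.
  intros Hs. split; [apply pow_lt; lra|].
  rewrite <- (pow1 n). apply pow_incr. lra.
Qed.

Lemma Re_scaled_lt (k eta : C) (t : R) :
  0 <= t <= 1 -> Re (k * eta)%C < 1 / 2 -> Re (k * (RtoC t) * eta)%C < 1 / 2.
Proof.
  intros Ht H. replace (k * t * eta)%C with (t * (k * eta))%C by ring.
  rewrite Re_RtoC_mult. destruct (Rle_lt_dec (Re (k * eta)%C) 0); nra.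
Qed.

Lemma iter_in_disk (F : C -> C) (n : nat) (z : C) :
  (forall z, in_disk z -> in_disk (F z)) -> in_disk z -> in_disk (Nat.iter n F z).
Proof. intros H Hz. induction n as [|n IH]; simpl; auto. Qed.

(** With [h = z - eta], the map multiplies [1/h + k0] by [1/s], so its iterates replace [s] by [s^n]
    and keep [k0]. *)
Lemma model_iter (eta : C) (s : R) (k0 : C) (F : C -> C) (n : nat) (z : C) :
  attracting_model eta s k0 F -> in_disk z ->
  Nat.iter n F z = (eta + (s ^ n)%R * (z - eta) / (1 + k0 * (1 - s ^ n)%R * (z - eta)))%C.
Proof.
  intros [He [Hs [Hk [HF HFe]]]] Hz. induction n as [|n IH].
  - simpl. replace (1 - 1)%R with 0 by ring.
    replace (1 + k0 * 0 * (z - eta))%C with (RtoC 1) by ring. field.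
  - simpl Nat.iter. rewrite HFe by (apply iter_in_disk; auto). rewrite IH.
    assert (H1 : (1 + k0 * (1 - s ^ n)%R * (z - eta))%C <> 0%C).
    { apply den_ne0; auto. apply Re_scaled_lt; auto. pose proof (pow_s_bounds s n Hs). lra. }
    assert (H2 : (1 + k0 * (1 - s ^ S n)%R * (z - eta))%C <> 0%C).
    { apply den_ne0; auto. apply Re_scaled_lt; auto. pose proof (pow_s_bounds s (S n) Hs). lra. }
    revert H1 H2. simpl pow. rewrite !RtoC_minus, !RtoC_mult. intros H1 H2.
    field. repeat split; try assumption.
Qed.

Lemma iter_composition (phi : lfm) (lambda : C) (n : nat) (f : C -> C) (z : C) :
  Nat.iter n (scaled_composition_op lambda phi) f z = (lambda ^ n * f (Nat.iter n (lfm_fun phi) z))%C.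
Proof.
  revert z. induction n as [|n IH]; intros z.
  - simpl. ring.
  - rewrite (Nat.iter_succ_r n C (lfm_fun phi) z).
    change (lambda * Nat.iter n (scaled_composition_op lambda phi) f (lfm_fun phi z) = lambda ^ S n * f (Nat.iter n (lfm_fun phi) (lfm_fun phi z)))%C. rewrite IH, Cpow_S. ring.
Qed.

(** The orbit starts on the radius to [eta], at a distance [x] with [x (|k0| + 1) = (1 - s) / 8].
    All denominators along the orbit then stay so close to 1 that it approaches [eta] like [s^n x],
    with explicit constants. *)
Lemma orbit_near_fixed_point (eta : C) (s : R) (k0 : C) (F : C -> C) :
  attracting_model eta s k0 F ->
  exists (p : C) (c D th : R), 0 < c <= 1 / 2 /\ 0 < D /\ 0 < th < 1 /\ in_disk p /\
    F p <> p /\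
    forall n, let q := Nat.iter n F p in
      Cmod q <= 1 - c * s ^ n /\ Cmod (q - F q) <= D * s ^ n /\
      Cmod (F q - F (F q)) <= th * Cmod (q - F q).
Proof.
  intros Hm. pose proof Hm as [He [Hs [Hk [HF HFe]]]].
  set (M := Cmod k0). assert (HM : 0 <= M) by apply Cmod_ge_0.
  set (x := (1 - s) / (8 * (M + 1))).
  assert (Hx : 0 < x) by (apply Rdiv_lt_0_compat; lra).
  assert (HxM : x * (M + 1) = (1 - s) / 8) by (unfold x; field; lra).
  assert (Hx1 : x < 1 / 8) by nra. assert (HxM' : x * M <= (1 - s) / 8) by nra.
  set (p := ((1 - x)%R * eta)%C).
  assert (Hp : in_disk p).
  { unfold in_disk, p. rewrite Cmod_mult, Cmod_R, He, Rabs_pos_eq; lra. }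
  assert (Hh : (p - eta = - (x * eta))%C) by (unfold p; rewrite RtoC_minus; ring).
  assert (Hcm : Cmod (p - eta) = x).
  { rewrite Hh, Cmod_opp, Cmod_mult, Cmod_R, He, Rabs_pos_eq; lra. }
  assert (Hden : forall t, 0 <= t <= 1 -> 7 / 8 <= Cmod (1 + k0 * t * (p - eta)) <= 9 / 8).
  { intros t Ht.
    assert (Hb : Cmod (k0 * t * (p - eta)) <= 1 / 8).
    { rewrite !Cmod_mult, Cmod_R, Hcm, Rabs_pos_eq by lra. fold M.
      replace (M * t * x) with (x * M * t) by ring. nra. }
    split.
    - pose proof (Cmod_triangle (1 + k0 * t * (p - eta)) (- (k0 * t * (p - eta)))) as H.
      replace (1 + k0 * t * (p - eta) + - (k0 * t * (p - eta)))%C with (RtoC 1) in H by ring.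
      rewrite Cmod_1, Cmod_opp in H. lra.
    - eapply Rle_trans; [apply Cmod_triangle|]. rewrite Cmod_1. lra. }
  assert (Hg : forall n, Cmod (Nat.iter n F p - eta) <= 8 / 7 * x * s ^ n).
  { intros n. pose proof (pow_s_bounds s n Hs) as Hsn.
    specialize (Hden (1 - s ^ n)%R ltac:(lra)).
    rewrite (model_iter _ _ _ _ n p Hm Hp).
    replace (eta + _ - eta)%C with ((s ^ n)%R * (p - eta) / (1 + k0 * (1 - s ^ n)%R * (p - eta)))%C by ring.
    rewrite Cmod_div by (intros E; rewrite E, Cmod_0 in Hden; lra).
    rewrite Cmod_mult, Cmod_R, Hcm, Rabs_pos_eq by lra.
    unfold Rdiv. replace (8 * / 7 * x * s ^ n) with (s ^ n * x * (8 * / 7)) by ring.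
    apply Rmult_le_compat_l; [nra|]. replace (8 * / 7) with (/ (7 / 8)) by field.
    apply Rinv_le_contravar; lra. }
  (* Below, [F q - F (F q) = s (q - F q) / (a b)] where [a] and [b] have modulus at least
     [1 - (1 - s) / 4], hence [|a b| >= (1 + s) / 2]. *)
  set (th := 2 * s / (1 + s)).
  assert (Hth : 0 < th < 1).
  { split; [apply Rdiv_lt_0_compat; lra|]. apply Rmult_lt_reg_r with (1 + s); [lra|].
    unfold th. field_simplify; lra. }
  assert (Hkap : forall n, 1 - (1 - s) / 4 <= Cmod (1 + k0 * (1 - s)%R * (Nat.iter n F p - eta))).
  { intros n. specialize (Hg n). pose proof (pow_s_bounds s n Hs) as Hsn.
    assert (Hb : Cmod (k0 * (1 - s)%R * (Nat.iter n F p - eta)) <= (1 - s) / 4).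
    { rewrite !Cmod_mult, Cmod_R, Rabs_pos_eq by lra. fold M.
      assert (Cmod (Nat.iter n F p - eta) <= 2 * x) by nra.
      apply Rle_trans with (M * 1 * (2 * x)); [|lra].
      apply Rmult_le_compat; try apply Cmod_ge_0; [apply Rmult_le_pos; lra| |lra].
      apply Rmult_le_compat_l; lra. }
    pose proof (Cmod_triangle (1 + k0 * (1 - s)%R * (Nat.iter n F p - eta)) (- (k0 * (1 - s)%R * (Nat.iter n F p - eta)))) as H.
    replace (1 + k0 * (1 - s)%R * (Nat.iter n F p - eta) + - (k0 * (1 - s)%R * (Nat.iter n F p - eta)))%C with (RtoC 1) in H by ring.
    rewrite Cmod_1, Cmod_opp in H. lra. }
  exists p, (x / 4), (3 * x), th.
  split; [lra|]. split; [lra|]. split; [exact Hth|]. split; [exact Hp|]. split.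
  (* A fixed point [p] different from [eta] would force [k0 (1 - s) (p - eta) = s - 1], but the left
     side has modulus at most [(1 - s) / 8]. *)
  { rewrite HFe by exact Hp. intros E.
    pose proof (Hden (1 - s) ltac:(lra)) as Hd. rewrite RtoC_minus in Hd.
    assert (Hd0 : (1 + k0 * (1 - s) * (p - eta))%C <> 0%C).
    { intros E0. rewrite E0, Cmod_0 in Hd. lra. }
    assert (E1 : (s * (p - eta) = (p - eta) * (1 + k0 * (1 - s) * (p - eta)))%C).
    { replace (p - eta)%C with (s * (p - eta) / (1 + k0 * (1 - s) * (p - eta)))%C at 2.
      - field. exact Hd0.
      - rewrite <- E at 3. ring. }
    assert (Hpe : (p - eta)%C <> 0%C) by (intros E0; rewrite E0, Cmod_0 in Hcm; lra).
    assert (E2 : RtoC s = (1 + k0 * (1 - s) * (p - eta))%C).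
    { transitivity (s * (p - eta) / (p - eta))%C; [field; exact Hpe|]. rewrite E1. field. exact Hpe. }
    assert (E3 : Cmod (k0 * (1 - s) * (p - eta)) = 1 - s).
    { replace (k0 * (1 - s) * (p - eta))%C with (RtoC (- (1 - s))).
      - rewrite Cmod_R, Rabs_Ropp, Rabs_pos_eq; lra.
      - rewrite RtoC_opp, RtoC_minus. replace (RtoC s) with (1 + k0 * (1 - s) * (p - eta))%C at 1 by (symmetry; exact E2). ring. }
    rewrite !Cmod_mult, Hcm in E3. rewrite <- RtoC_minus, Cmod_R, Rabs_pos_eq in E3 by lra. fold M in E3.
    assert (M * (1 - s) * x <= (1 - s) / 8) by nra. lra. }
  intros n q. pose proof (pow_s_bounds s n Hs) as Hsn.
  assert (Hq : in_disk q) by (apply iter_in_disk; auto).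
  assert (Hq1 : in_disk (F q)) by auto.
  split; [|split].
  - unfold q. rewrite (model_iter _ _ _ _ n p Hm Hp).
    specialize (Hden (1 - s ^ n)%R ltac:(lra)).
    set (d := (1 + k0 * (1 - s ^ n)%R * (p - eta))%C) in *.
    assert (Hd0 : d <> 0%C) by (intros E0; rewrite E0, Cmod_0 in Hden; lra).
    replace (eta + (s ^ n)%R * (p - eta) / d)%C with ((eta * d + (s ^ n)%R * (p - eta)) / d)%C by (field; exact Hd0).
    rewrite Cmod_div by exact Hd0.
    pose proof (disk_identity eta (k0 * (1 - s ^ n)%R)%C (p - eta) (s ^ n) He) as Hid. fold d in Hid.
    rewrite Hcm in Hid.
    assert (Hre : Re (eta * Cconj (p - eta))%C = - x).
    { rewrite Hh, Copp_conj, Cmult_conj. replace (Cconj x) with (RtoC x) by (unfold Cconj, RtoC; simpl; f_equal; ring).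
      replace (eta * - (x * Cconj eta))%C with ((- x)%R * (eta * Cconj eta))%C by (rewrite RtoC_opp; ring).
      rewrite Re_RtoC_mult, Re_mult_conj, He. ring. }
    rewrite Hre in Hid.
    assert (Hk2 : 2 * Re (k0 * (1 - s ^ n)%R * eta)%C <= 1 - s ^ n).
    { replace (k0 * (1 - s ^ n)%R * eta)%C with ((1 - s ^ n)%R * (k0 * eta))%C by ring.
      rewrite Re_RtoC_mult. nra. }
    set (A := Cmod (eta * d + (s ^ n)%R * (p - eta))) in *.
    assert (HA : 0 <= A) by apply Cmod_ge_0.
    set (B := Cmod d) in *. set (t := s ^ n) in *.
    (* The bracket in [disk_identity] is at most [-2x + x^2 <= -x], by the bound on [Re (k0 eta)].
       Since [B^2 <= 2], the gain [t x] in the squares yields the factor [1 - x t / 4], which is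
       where [c = x / 4] comes from. *)
    assert (Hup : A ^ 2 <= B ^ 2 - t * x).
    { assert (t * (2 * - x + x ^ 2 * (2 * Re (k0 * (1 - t)%R * eta)%C + t)) <= t * (2 * - x + x ^ 2 * 1)).
      { apply Rmult_le_compat_l; [lra|]. apply Rplus_le_compat_l. apply Rmult_le_compat_l; [apply pow2_ge_0|lra]. }
      assert (t * x ^ 2 <= t * x) by (apply Rmult_le_compat_l; nra).
      nra. }
    apply Rmult_le_reg_r with B; [lra|]. replace (A / B * B) with A by (field; lra).
    assert (0 < t * x <= 1 / 8) by (split; [apply Rmult_lt_0_compat; lra|nra]).
    apply Rsqr_incr_0_var; [|nra]. unfold Rsqr.
    replace (A * A) with (A ^ 2) by ring. eapply Rle_trans; [exact Hup|].
    assert (Hy : (1 - x / 4 * t) * B * ((1 - x / 4 * t) * B) = B ^ 2 - B ^ 2 * (t * x / 2) + B ^ 2 * (t * x / 4) ^ 2) by field.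
    rewrite Hy. assert (B ^ 2 <= 2) by nra. assert (0 <= B ^ 2 * (t * x / 4) ^ 2) by (apply Rmult_le_pos; apply pow2_ge_0).
    nra.
  - pose proof (Hg n) as H1. pose proof (Hg (S n)) as H2. simpl Nat.iter in H2. fold q in H1, H2.
    replace (q - F q)%C with ((q - eta) + - (F q - eta))%C by ring.
    eapply Rle_trans; [apply Cmod_triangle|]. rewrite Cmod_opp. simpl pow in H2.
    assert (x * (s * s ^ n) <= x * s ^ n) by (apply Rmult_le_compat_l; nra).
    assert (0 <= x * s ^ n) by (apply Rmult_le_pos; lra). lra.
  - pose proof (Hkap n) as H1. pose proof (Hkap (S n)) as H2. simpl Nat.iter in H2. fold q in H1, H2.
    set (a := (1 + k0 * (1 - s)%R * (q - eta))%C) in *. set (b := (1 + k0 * (1 - s)%R * (F q - eta))%C) in *.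
    assert (Ha : a <> 0%C) by (intros E; rewrite E, Cmod_0 in H1; lra).
    assert (Hb : b <> 0%C) by (intros E; rewrite E, Cmod_0 in H2; lra).
    replace (F q - F (F q))%C with (s * (q - F q) / (a * b))%C.
    2: { rewrite (HFe (F q) Hq1). rewrite (HFe q Hq) at 2. rewrite <- (RtoC_minus 1 s). fold a b.
         revert Ha Hb. unfold a, b. intros. field. split; assumption. }
    rewrite Cmod_div by (apply Cmult_neq_0; assumption).
    rewrite !Cmod_mult, Cmod_R, Rabs_pos_eq by lra.
    unfold th. assert (Hab : (1 + s) / 2 <= Cmod a * Cmod b) by nra.
    apply Rmult_le_reg_r with (Cmod a * Cmod b); [lra|].
    replace (s * Cmod (q - F q) / (Cmod a * Cmod b) * (Cmod a * Cmod b)) with (s * Cmod (q - F q)) by (field; split; lra).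
    pose proof (Cmod_ge_0 (q - F q)).
    apply Rle_trans with (2 * s / (1 + s) * Cmod (q - F q) * ((1 + s) / 2)); [right; field; lra|].
    apply Rmult_le_compat_l; [|exact Hab]. apply Rmult_le_pos; [fold th; lra|lra].
Qed.

(** * Necessity *)


Lemma in_S_minus (nu : R) (f g : C -> C) :
  in_S nu f -> in_S nu g -> in_S nu (fun z => g z - f z)%C.
Proof.
  intros Hf Hg. apply in_S_norm2_le in Hf as [d Hd]. apply in_S_norm2_le in Hg as [e He].
  eapply S_norm2_le_in_S. eapply S_norm2_le_ext; [|apply (S_norm2_le_plus nu _ _ _ _ He (S_norm2_le_scal nu (-1)%C _ _ Hd))].
  intros z _. simpl. ring.
Qed.

(** Because [B] does not depend on [k], requiring all [E k f] to be close to [E k f0] defines an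
    open set; recurrence brings one of its points back into it. The margin [del] keeps the supremum
    over [k] strictly below [r]. *)
Lemma recurrent_functionals (nu : R) (T : (C -> C) -> C -> C) (E : nat -> (C -> C) -> C)
    (f0 : C -> C) (r B : R) :
  recurrent_on_S nu T -> in_S nu f0 -> 0 < r -> 0 < B ->
  (forall k f g, E k (fun z => g z - f z)%C = (E k g - E k f)%C) ->
  (forall k f eps, 0 < eps -> S_norm2_le nu f (eps ^ 2) -> Cmod (E k f) <= B * eps) ->
  exists n f, (0 < n)%nat /\
    forall k, Cmod (E k f - E k f0) < r /\ Cmod (E k (Nat.iter n T f) - E k f0) < r.
Proof.
  intros Hrec Hf0 Hr HB Hadd Hbd.
  set (U := fun f => in_S nu f /\ exists del, 0 < del /\ forall k, Cmod (E k f - E k f0) <= r - del).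
  destruct (Hrec U) as [n [Hn [f [[_ [d1 [Hd1 H1]]] [_ [d2 [Hd2 H2]]]]]]].
  - intros f [Hf [del [Hdel H]]]. split; [exact Hf|].
    exists (del / (2 * B)). assert (He : 0 < del / (2 * B)) by (apply Rdiv_lt_0_compat; lra).
    split; [exact He|]. intros g Hg Hn. split; [exact Hg|].
    exists (del / 2). split; [lra|]. intros k. specialize (H k).
    assert (Hgf : in_S nu (fun z => g z - f z)%C) by (apply in_S_minus; assumption).
    pose proof (Hbd k _ _ He (S_norm2_le_of_S_norm _ _ _ Hgf (Rlt_le _ _ Hn))) as Hb.
    rewrite Hadd in Hb. replace (B * (del / (2 * B))) with (del / 2) in Hb by (field; lra).
    replace (E k g - E k f0)%C with ((E k g - E k f) + (E k f - E k f0))%C by ring.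
    eapply Rle_trans; [apply Cmod_triangle|]. lra.
  - exists f0. split; [exact Hf0|]. exists (r / 2). split; [lra|]. intros k.
    replace (E k f0 - E k f0)%C with (RtoC 0) by ring. rewrite Cmod_0. lra.
  - exists n, f. split; [exact Hn|]. intros k. specialize (H1 k). specialize (H2 k). split; lra.
Qed.

Lemma Rpower_mult_opp (w : R) (n : R) : 0 < n -> Rpower n w * Rpower n (- w) = 1.
Proof. intros Hn. rewrite <- Rpower_plus. replace (w + - w) with 0 by ring. apply Rpower_O. exact Hn. Qed.

(** Termwise AM-GM in place of the Cauchy-Schwarz inequality. *)
Lemma functional_bound (nu : R) (a c : nat -> C) (l : C) (b : nat -> R) (B eps : R) :
  Cseries (fun k => a k * c k)%C l ->
  ex_series (dirichlet_term nu a) -> 0 < eps -> Series (dirichlet_term nu a) <= eps ^ 2 ->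
  (forall k, Cmod (c k) ^ 2 * Rpower (INR (k + 1)) (- (2 * nu)) <= b k) -> ex_series b -> Series b <= B ->
  Cmod l <= (1 + B) * eps.
Proof.
  intros Hl Ha He Hae Hb Hbx HB.
  assert (Hle : Cmod l <= Series (fun k => / eps * dirichlet_term nu a k + eps * b k)).
  { apply (Cseries_bound _ _ _ Hl).
    - intros k. rewrite Cmod_mult.
      specialize (Hb k). pose proof (Rpower_mult_opp (2 * nu) (INR (k + 1)) (INR_S_pos k)) as Hw.
      unfold dirichlet_term. set (x := Cmod (a k)) in *. set (y := Cmod (c k)) in *.
      pose proof (Rpower_pos (INR (k + 1)) (2 * nu)) as Hp. pose proof (Rpower_pos (INR (k + 1)) (- (2 * nu))) as Hq.
      set (p := Rpower (INR (k + 1)) (2 * nu)) in *. set (q := Rpower (INR (k + 1)) (- (2 * nu))) in *.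
      assert (0 <= x) by apply Cmod_ge_0. assert (0 <= y) by apply Cmod_ge_0.
      assert (Hs : 0 <= / eps * (x ^ 2 * p) + eps * (y ^ 2 * q) - 2 * (x * y)).
      { replace (/ eps * (x ^ 2 * p) + eps * (y ^ 2 * q) - 2 * (x * y)) with (p / eps * (x - eps * q * y) ^ 2).
        - apply Rmult_le_pos; [left; apply Rdiv_lt_0_compat; lra|apply pow2_ge_0].
        - transitivity (/ eps * (x ^ 2 * p) + eps * (y ^ 2 * q) * (p * q) - 2 * (x * y) * (p * q)); [field; lra|].
          rewrite Hw. ring. }
      assert (eps * (y ^ 2 * q) <= eps * b k) by (apply Rmult_le_compat_l; lra).
      assert (0 <= x * y) by (apply Rmult_le_pos; assumption). lra.
    - apply (ex_series_plus (K := R_AbsRing) (V := R_NormedModule)); apply ex_series_scalR; assumption. }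
  rewrite Series_plus in Hle by (apply ex_series_scalR; assumption). rewrite !Series_scal_l in Hle.
  assert (/ eps * Series (dirichlet_term nu a) <= / eps * eps ^ 2).
  { apply Rmult_le_compat_l; [left; apply Rinv_0_lt_compat; exact He|exact Hae]. }
  replace (/ eps * eps ^ 2) with eps in H by (field; lra).
  assert (eps * Series b <= eps * B) by (apply Rmult_le_compat_l; lra). lra.
Qed.

(** The usual bound [k |p - q| r^(k-1)], multiplied through by [r] to avoid the exponent [k - 1]. *)
Lemma pow_diff_bound (p q : C) (r : R) (k : nat) :
  Cmod p <= r -> Cmod q <= r -> r * Cmod (p ^ k - q ^ k) <= INR k * Cmod (p - q) * r ^ k.
Proof.
  intros Hp Hq. assert (Hr : 0 <= r) by (eapply Rle_trans; [apply Cmod_ge_0|exact Hp]).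
  induction k as [|k IH].
  - simpl. replace (1 - 1)%C with (RtoC 0) by ring. rewrite Cmod_0. lra.
  - rewrite !Cpow_S. replace (p * p ^ k - q * q ^ k)%C with (p * (p ^ k - q ^ k) + (p - q) * q ^ k)%C by ring.
    apply Rle_trans with (r * (Cmod (p * (p ^ k - q ^ k)) + Cmod ((p - q) * q ^ k))).
    { apply Rmult_le_compat_l; [exact Hr|apply Cmod_triangle]. }
    rewrite !Cmod_mult, Cmod_pow, S_INR. simpl pow.
    pose proof (Cmod_ge_0 (p ^ k - q ^ k)). pose proof (Cmod_ge_0 (p - q)).
    assert (Cmod q ^ k <= r ^ k) by (apply pow_incr; split; [apply Cmod_ge_0|exact Hq]).
    assert (H2 : Cmod p * Cmod (p ^ k - q ^ k) <= r * Cmod (p ^ k - q ^ k)) by (apply Rmult_le_compat_r; assumption).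
    assert (Cmod (p - q) * Cmod q ^ k <= Cmod (p - q) * r ^ k) by (apply Rmult_le_compat_l; assumption).
    assert (r * (Cmod p * Cmod (p ^ k - q ^ k)) <= r * (INR k * Cmod (p - q) * r ^ k)) by (apply Rmult_le_compat_l; lra).
    assert (r * (Cmod (p - q) * Cmod q ^ k) <= r * (Cmod (p - q) * r ^ k)) by (apply Rmult_le_compat_l; lra).
    lra.
Qed.

Lemma Rpower_pow_base (s g : R) (n : nat) : 0 < s -> Rpower s g ^ n = Rpower (s ^ n) g.
Proof.
  intros Hs. induction n as [|n IH]; simpl; [rewrite Rpower_base1; reflexivity|].
  rewrite IH, Rpower_mult_distr; auto using pow_lt.
Qed.

Lemma Rpower_2 (x : R) : 0 < x -> Rpower x 2 = x ^ 2.
Proof. intros Hx. change 2 with (INR 2) at 1. rewrite Rpower_pow; auto. Qed.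

(** The coefficients are of order [lam^n k s^n r^k] with [1 - r = c s^(n+1)], so the weighted sum of
    squares is of order [lam^(2n) (s^n)^2 (s^n)^-(3 - 2 nu)]. As [lam^(2n) <= (s^n)^(1 - 2 nu)], the
    powers of [s^n] cancel, even at the threshold. The exponent [S n] in the radius serves the later
    of two consecutive orbit points. *)
Lemma difference_coef_bound (nu s lam c D : R) :
  nu <= 1 / 2 -> 0 < s < 1 -> 0 <= lam <= Rpower s ((1 - 2 * nu) / 2) -> 0 < c <= 1 / 2 -> 0 < D ->
  exists B, 0 < B /\ forall (n : nat) (p q : C),
    Cmod p <= 1 - c * s ^ S n -> Cmod q <= 1 - c * s ^ S n -> Cmod (p - q) <= D * s ^ n ->
    exists b, (forall k, (lam ^ n * Cmod (p ^ k - q ^ k)) ^ 2 * Rpower (INR (k + 1)) (- (2 * nu)) <= b k) /\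
      ex_series b /\ Series b <= B.
Proof.
  intros Hnu Hs Hlam Hc HD.
  destruct (power_geom_series (2 - 2 * nu) ltac:(lra)) as [K [HK HKs]].
  set (e := - ((2 - 2 * nu) + 1)) in *.
  exists (4 * D ^ 2 * K * Rpower (c * s) e). split.
  { repeat apply Rmult_lt_0_compat; try lra; apply Rpower_pos. }
  intros n p q Hp Hq Hpq.
  pose proof (pow_s_bounds s n Hs) as Hsn. pose proof (pow_s_bounds s (S n) Hs) as Hsn1.
  set (r := 1 - c * s ^ S n) in *.
  assert (Hcs : 0 < c * s ^ S n <= 1 / 2) by (split; [apply Rmult_lt_0_compat; lra|nra]).
  assert (Hr : 1 / 2 <= r < 1) by (unfold r; lra).
  destruct (HKs r ltac:(lra)) as [Hex Hser].
  set (G := 4 * (lam ^ n) ^ 2 * (D * s ^ n) ^ 2).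
  exists (fun k => G * (Rpower (INR (k + 1)) (2 - 2 * nu) * r ^ (2 * k))).
  split; [|split; [apply ex_series_scalR; exact Hex|]].
  - intros k.
    (* The factor 2 comes from dividing [pow_diff_bound] by [r >= 1/2]. *)
    assert (Hd : Cmod (p ^ k - q ^ k) <= 2 * (INR (k + 1) * (D * s ^ n) * r ^ k)).
    { pose proof (pow_diff_bound p q r k Hp Hq) as Hb.
      pose proof (Cmod_ge_0 (p ^ k - q ^ k)) as H0. pose proof (Cmod_ge_0 (p - q)) as H0'.
      assert (Hrk : 0 <= r ^ k) by (apply pow_le; lra).
      assert (INR k * Cmod (p - q) * r ^ k <= INR (k + 1) * (D * s ^ n) * r ^ k).
      { apply Rmult_le_compat_r; [exact Hrk|]. apply Rmult_le_compat; auto using pos_INR.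
        apply le_INR. lia. }
      nra. }
    replace (2 - 2 * nu) with (2 + - (2 * nu)) by ring.
    rewrite Rpower_plus, Rpower_2 by apply INR_S_pos.
    replace (r ^ (2 * k)) with ((r ^ k) ^ 2) by (rewrite <- pow_mult; f_equal; lia).
    replace (G * (INR (k + 1) ^ 2 * Rpower (INR (k + 1)) (- (2 * nu)) * (r ^ k) ^ 2))
      with ((lam ^ n * (2 * (INR (k + 1) * (D * s ^ n) * r ^ k))) ^ 2 * Rpower (INR (k + 1)) (- (2 * nu))) by (unfold G; ring).
    apply Rmult_le_compat_r; [left; apply Rpower_pos|].
    apply pow_incr. split; [apply Rmult_le_pos; [apply pow_le; lra|apply Cmod_ge_0]|].
    apply Rmult_le_compat_l; [apply pow_le; lra|exact Hd].
  - rewrite Series_scal_l.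
    assert (HG : 0 <= G) by (unfold G; apply Rmult_le_pos; [|apply pow2_ge_0]; apply Rmult_le_pos; [lra|apply pow2_ge_0]).
    eapply Rle_trans; [apply Rmult_le_compat_l; [exact HG|exact Hser]|].
    replace (1 - r) with (c * s * s ^ n) by (unfold r; simpl; ring).
    rewrite <- (Rpower_mult_distr (c * s)) by nra.
    assert (Hl : (lam ^ n) ^ 2 * (s ^ n) ^ 2 * Rpower (s ^ n) e <= 1).
    { assert (H1 : (lam ^ n) ^ 2 <= Rpower (s ^ n) (1 - 2 * nu)).
      { apply Rle_trans with ((Rpower s ((1 - 2 * nu) / 2) ^ n) ^ 2).
        - apply pow_incr. split; [apply pow_le; lra|]. apply pow_incr. lra.
        - rewrite Rpower_pow_base by lra. rewrite <- Rpower_2 by apply Rpower_pos.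
          rewrite Rpower_mult. right. f_equal. field. }
      rewrite <- (Rpower_2 (s ^ n)) by lra.
      apply Rle_trans with (Rpower (s ^ n) (1 - 2 * nu) * Rpower (s ^ n) 2 * Rpower (s ^ n) e).
      - apply Rmult_le_compat_r; [left; apply Rpower_pos|]. apply Rmult_le_compat_r; [left; apply Rpower_pos|exact H1].
      - rewrite <- !Rpower_plus. unfold e. replace (1 - 2 * nu + 2 + - (2 - 2 * nu + 1)) with 0 by ring.
        rewrite Rpower_O; lra. }
    unfold G.
    replace (4 * (lam ^ n) ^ 2 * (D * s ^ n) ^ 2 * (K * (Rpower (c * s) e * Rpower (s ^ n) e)))
      with (4 * D ^ 2 * K * Rpower (c * s) e * ((lam ^ n) ^ 2 * (s ^ n) ^ 2 * Rpower (s ^ n) e)) by ring.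
    rewrite <- (Rmult_1_r (4 * D ^ 2 * K * Rpower (c * s) e)) at 2.
    apply Rmult_le_compat_l; [|exact Hl].
    left. repeat apply Rmult_lt_0_compat; try lra; apply Rpower_pos.
Qed.

Lemma Cmod_pow_le1 (z : C) (k : nat) : Cmod z <= 1 -> Cmod (z ^ k) <= 1.
Proof.
  intros H. rewrite Cmod_pow. rewrite <- (pow1 k). apply pow_incr. split; [apply Cmod_ge_0|exact H].
Qed.

Lemma in_S_of_finite (nu : R) (f : C -> C) (a : nat -> C) (N : nat) :
  taylor_on_disk f a -> (forall k, (N <= k)%nat -> a k = 0%C) -> in_S nu f.
Proof.
  intros Hf Ha. exists a. split; [exact Hf|].
  apply (ex_series_incr_n (K := R_AbsRing) (V := R_NormedModule) _ N).
  apply (ex_series_ext (fun k => 0 * (1 / 2) ^ k)).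
  - intros k. unfold dirichlet_term. rewrite Ha by lia. rewrite Cmod_0. simpl. ring.
  - eexists. apply series_geom_scal. lra.
Qed.

Lemma in_S_1 (nu : R) : in_S nu (fun _ => 1%C).
Proof. apply (in_S_of_finite nu _ _ 1 taylor_1). intros [|k] Hk; [lia|reflexivity]. Qed.

Lemma in_S_id (nu : R) : in_S nu (fun z => z).
Proof.
  apply (in_S_of_finite nu _ (shift (fun k => match k with O => 1%C | S _ => 0%C end)) 2).
  - eapply taylor_ext; [|apply (taylor_mulz _ _ taylor_1)]. intros z _. simpl. ring.
  - intros [|[|k]] Hk; try lia. reflexivity.
Qed.

Lemma eval_series (f : C -> C) (a : nat -> C) (z : C) :
  taylor_on_disk f a -> in_disk z -> Cseries (fun k => a k * z ^ k)%C (f z).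
Proof. intros H Hz. rewrite taylor_series in H. exact (H z Hz). Qed.

Section Necessity.
Variables (phi : lfm) (eta : C) (s : R) (k0 lambda : C) (nu : R).
Hypothesis Hmodel : attracting_model eta s k0 (lfm_fun phi).
Let T := scaled_composition_op lambda phi.
Let F := lfm_fun phi.

(** At the function [z], [E 0] has modulus [D], while [E n] has modulus at most [th D] for [n >= 1].
    Recurrence would give [f] with [E n f] within [(1 - th) D / 2] of [E n z] and, being
    [E 0 (T^n f)], equally close to [E 0 z]. *)
Lemma not_recurrent_of_difference_bound (p : C) (th B : R) :
  in_disk p -> F p <> p -> 0 < th < 1 -> Cmod lambda <= 1 -> 0 < B ->
  (forall n, Cmod (F (Nat.iter n F p) - F (F (Nat.iter n F p))) <= th * Cmod (Nat.iter n F p - F (Nat.iter n F p))) ->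
  (forall n, exists b,
    (forall k, (Cmod lambda ^ n * Cmod (Nat.iter n F p ^ k - F (Nat.iter n F p) ^ k)) ^ 2 * Rpower (INR (k + 1)) (- (2 * nu)) <= b k) /\
    ex_series b /\ Series b <= B) ->
  ~ recurrent_on_S nu T.
Proof.
  intros Hp Hfix Hth Hlam HB Hcontr Hbound Hrec.
  pose proof Hmodel as [_ [_ [_ [HF _]]]].
  set (E := fun (n : nat) (f : C -> C) => (lambda ^ n * (f (Nat.iter n F p) - f (F (Nat.iter n F p))))%C).
  set (D := Cmod (p - F p)).
  assert (HD : 0 < D).
  { apply Cmod_gt_0. intros E0. apply Hfix. replace (F p) with (p - (p - F p))%C by ring. rewrite E0. ring. }
  destruct (recurrent_functionals nu T E (fun z => z) ((1 - th) * D / 2) (1 + B)) as [n [f [Hn H]]]; auto.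
  - apply in_S_id.
  - assert (0 < (1 - th) * D) by (apply Rmult_lt_0_compat; lra). lra.
  - lra.
  - intros k f g. unfold E. ring.
  - intros n f eps He [a [Ha1 [Ha2 Ha3]]]. destruct (Hbound n) as [b [Hb1 [Hb2 Hb3]]].
    assert (Hq : in_disk (Nat.iter n F p)) by (apply iter_in_disk; auto).
    apply (functional_bound nu a (fun k => lambda ^ n * (Nat.iter n F p ^ k - F (Nat.iter n F p) ^ k))%C (E n f) b B); auto.
    + pose proof (Cseries_scal (lambda ^ n) _ _ (eval_series f a _ Ha1 Hq)) as S1.
      pose proof (Cseries_scal (- lambda ^ n)%C _ _ (eval_series f a _ Ha1 (HF _ Hq))) as S2.
      pose proof (Cseries_plus _ _ _ _ S1 S2) as S3.
      replace (E n f) with (lambda ^ n * f (Nat.iter n F p) + - lambda ^ n * f (lfm_fun phi (Nat.iter n F p)))%C by (unfold E, F; ring).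
      eapply Cseries_ext; [|exact S3]. intros k. simpl. unfold F. ring.
    + intros k. rewrite Cmod_mult, Cmod_pow. apply Hb1.
  - destruct (H n) as [H1 _]. destruct (H O) as [_ H2].
    assert (E1 : E O (Nat.iter n T f) = E n f).
    { unfold E, T. change (Nat.iter 0 F p) with p. rewrite !iter_composition. fold F.
      rewrite <- (Nat.iter_succ_r n C F p). change (Nat.iter (S n) F p) with (F (Nat.iter n F p)). simpl. ring. }
    rewrite E1 in H2.
    assert (Hd : Cmod (E n (fun z => z) - E O (fun z => z)) < (1 - th) * D).
    { replace (E n (fun z => z) - E O (fun z => z))%C with ((E n f - E O (fun z => z)) + - (E n f - E n (fun z => z)))%C by ring.
      eapply Rle_lt_trans; [apply Cmod_triangle|]. rewrite Cmod_opp. lra. }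
    assert (Hn1 : Cmod (E n (fun z => z)) <= th * D).
    { unfold E. rewrite Cmod_mult.
      assert (Hit : forall m, Cmod (Nat.iter (S m) F p - F (Nat.iter (S m) F p)) <= th * D).
      { induction m as [|m IH].
        - apply (Hcontr O).
        - eapply Rle_trans; [apply (Hcontr (S m))|].
          assert (0 <= th * D) by (apply Rmult_le_pos; lra).
          apply Rle_trans with (th * (th * D)); [apply Rmult_le_compat_l; [lra|exact IH]|]. nra. }
      destruct n as [|m]; [lia|]. specialize (Hit m).
      pose proof (Cmod_pow_le1 lambda (S m) Hlam). pose proof (Cmod_ge_0 (lambda ^ S m)).
      pose proof (Cmod_ge_0 (Nat.iter (S m) F p - F (Nat.iter (S m) F p))). nra. }
    assert (E0 : Cmod (E O (fun z => z)) = D).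
    { unfold E, D. simpl. f_equal. ring. }
    pose proof (Cmod_triangle (E n (fun z => z)) (- (E n (fun z => z) - E O (fun z => z)))) as Ht.
    replace (E n (fun z => z) + - (E n (fun z => z) - E O (fun z => z)))%C with (E O (fun z => z)) in Ht by ring.
    rewrite Cmod_opp, E0 in Ht. lra.
Qed.

Lemma not_recurrent_low :
  nu <= 1 / 2 -> Cmod lambda <= Rpower s ((1 - 2 * nu) / 2) -> ~ recurrent_on_S nu T.
Proof.
  intros Hnu Hlam. pose proof Hmodel as [_ [Hs [_ [HF _]]]].
  destruct (orbit_near_fixed_point _ _ _ _ Hmodel) as [p [c [D [th [Hc [HD [Hth [Hp [Hfix H]]]]]]]]].
  destruct (difference_coef_bound nu s (Cmod lambda) c D Hnu Hs) as [B [HB HBn]]; auto using Cmod_ge_0.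
  apply (not_recurrent_of_difference_bound p th B); auto.
  - eapply Rle_trans; [exact Hlam|]. apply Rle_trans with (exp 0); [|rewrite exp_0; lra]. apply exp_le_mono.
    assert (ln s < 0) by (rewrite <- ln_1; apply ln_increasing; lra). pose proof (Rmult_le_pos ((1 - 2 * nu) / 2) (- ln s) ltac:(lra) ltac:(lra)). lra.
  - intros n. apply (H n).
  - intros n. destruct (H n) as [H1 [H2 _]]. destruct (H (S n)) as [H3 _].
    apply HBn; auto.
    eapply Rle_trans; [exact H1|]. simpl. pose proof (pow_s_bounds s n Hs).
    assert (s * s ^ n <= s ^ n) by nra. assert (c * (s * s ^ n) <= c * s ^ n) by (apply Rmult_le_compat_l; lra). lra.
Qed.

(** For [nu > 1/2] the inverse weights are summable, so evaluations at points of the disk are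
    bounded uniformly. This bounds the differences when [|lambda| <= 1], and otherwise allows
    testing the values themselves near the constant 1. *)
Lemma not_recurrent_high : 1 / 2 < nu -> ~ recurrent_on_S nu T.
Proof.
  intros Hnu. pose proof Hmodel as [_ [Hs [_ [HF _]]]].
  destruct (orbit_near_fixed_point _ _ _ _ Hmodel) as [p [c [D [th [Hc [HD [Hth [Hp [Hfix H]]]]]]]]].
  pose proof (p_series (2 * nu - 1) ltac:(lra)) as Hps.
  replace (- (1 + (2 * nu - 1))) with (- (2 * nu)) in Hps by ring.
  set (b := fun k => Rpower (INR (k + 1)) (- (2 * nu))) in *.
  assert (Hb0 : 0 <= Series b).
  { eapply Rle_trans; [|apply (sum_n_le_Series b O)]; auto.
    - rewrite sum_O. left. apply Rpower_pos.
    - intros k. left. apply Rpower_pos. }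
  assert (Hin : forall n, in_disk (Nat.iter n F p)) by (intros n; apply iter_in_disk; auto).
  destruct (Rle_lt_dec (Cmod lambda) 1) as [Hlam|Hlam].
  - apply (not_recurrent_of_difference_bound p th (4 * Series b + 1)); auto; [lra|intros n; apply (H n)|].
    intros n. exists (fun k => 4 * b k). split; [|split; [apply ex_series_scalR; exact Hps|rewrite Series_scal_l; lra]].
    intros k. apply Rmult_le_compat_r; [left; apply Rpower_pos|].
    assert (Hd : Cmod (Nat.iter n F p ^ k - F (Nat.iter n F p) ^ k) <= 2).
    { eapply Rle_trans; [apply Cmod_triangle|]. rewrite Cmod_opp.
      pose proof (Cmod_pow_le1 (Nat.iter n F p) k (Rlt_le _ _ (Hin n))).
      pose proof (Cmod_pow_le1 (F (Nat.iter n F p)) k (Rlt_le _ _ (HF _ (Hin n)))). lra. }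
    pose proof (Cmod_ge_0 (Nat.iter n F p ^ k - F (Nat.iter n F p) ^ k)).
    pose proof (Cmod_pow_le1 lambda n Hlam) as Hl. rewrite Cmod_pow in Hl.
    assert (0 <= Cmod lambda ^ n) by (apply pow_le, Cmod_ge_0).
    replace 4 with (2 ^ 2) by ring. apply pow_incr. split; [apply Rmult_le_pos; assumption|nra].
  - intros Hrec. set (L := Cmod lambda) in *.
    (* The solution of [L (1 - r) = 1 + r]: then [|w| > 1 - r] and [|lambda^n w| < 1 + r] are
       incompatible for [n >= 1]. *)
    set (r := (L - 1) / (L + 1)).
    assert (Hr : 0 < r) by (apply Rdiv_lt_0_compat; lra).
    assert (Hr1 : L * (1 - r) = 1 + r) by (unfold r; field; lra).
    destruct (recurrent_functionals nu T (fun n f => f (Nat.iter n F p)) (fun _ => 1%C) r (1 + Series b)) as [n [f [Hn Hf]]]; auto.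
    + apply in_S_1.
    + lra.
    + intros n f eps He [a [Ha1 [Ha2 Ha3]]].
      apply (functional_bound nu a (fun k => Nat.iter n F p ^ k)%C _ b (Series b)); auto.
      * apply (eval_series f a _ Ha1 (Hin n)).
      * intros k. pose proof (Cmod_pow_le1 (Nat.iter n F p) k (Rlt_le _ _ (Hin n))).
        pose proof (Cmod_ge_0 (Nat.iter n F p ^ k)). rewrite <- (Rmult_1_l (b k)).
        apply Rmult_le_compat_r; [left; apply Rpower_pos|nra].
      * apply Rle_refl.
    + destruct (Hf n) as [H1 _]. destruct (Hf O) as [_ H2].
      unfold T in H2. rewrite iter_composition in H2. fold F in H2. simpl Nat.iter in H2.
      set (w := f (Nat.iter n F p)) in *.
      assert (Hw : 1 - r < Cmod w).
      { pose proof (Cmod_triangle w (- (w - 1))) as Ht. replace (w + - (w - 1))%C with (RtoC 1) in Ht by ring.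
        rewrite Cmod_opp, Cmod_1 in Ht. lra. }
      assert (Hw2 : Cmod (lambda ^ n * w) < 1 + r).
      { pose proof (Cmod_triangle (lambda ^ n * w - 1) 1) as Ht.
        replace (lambda ^ n * w - 1 + 1)%C with (lambda ^ n * w)%C in Ht by ring. rewrite Cmod_1 in Ht. lra. }
      rewrite Cmod_mult, Cmod_pow in Hw2. fold L in Hw2.
      assert (HL : L <= L ^ n).
      { destruct n as [|m]; [lia|]. simpl. pose proof (pow_R1_Rle L m ltac:(lra)). nra. }
      assert (r < 1) by (apply Rmult_lt_reg_r with (L + 1); [lra|]; unfold r; field_simplify; lra).
      nra.
Qed.

End Necessity.

(** * Closed subspaces and moving poles *)


(** Since [P] is a predicate on functions [C -> C], invariance under changes off the disk is part of
    the notion. Nonemptiness is not, so membership of 0 is always derived from some given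
    element. *)
Definition closed_subspace (nu : R) (P : (C -> C) -> Prop) : Prop :=
  (forall f g, (forall z, in_disk z -> f z = g z) -> P f -> P g) /\
  (forall f g, P f -> P g -> P (fun z => f z + g z)%C) /\
  (forall c f, P f -> P (fun z => c * f z)%C) /\
  (forall f, (forall d, 0 < d -> exists g, P g /\ S_norm2_le nu (fun z => g z - f z)%C d) -> P f).

Lemma S_norm2_le_zero (nu : R) (f : C -> C) (d : R) :
  (forall z, in_disk z -> f z = 0%C) -> 0 <= d -> S_norm2_le nu f d.
Proof.
  intros H Hd. apply (S_norm2_le_ext nu (fun _ => 0%C)); [intros z Hz; symmetry; auto|].
  exists (fun _ => 0%C). split; [exact taylor_0|].
  pose proof (series_geom_scal 0 (1 / 2) ltac:(lra)) as Hg.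
  assert (Hs : is_series (dirichlet_term nu (fun _ => 0%C)) 0).
  { replace (0 * / (1 - 1 / 2)) with 0 in Hg by ring. eapply is_series_ext; [|exact Hg].
    intros n. unfold dirichlet_term. rewrite Cmod_0. simpl. ring. }
  split; [eexists; exact Hs|]. rewrite (is_series_unique _ _ Hs). exact Hd.
Qed.

Lemma S_norm2_le_of_partial_sums (nu : R) (f : C -> C) (a : nat -> C) (b : nat -> R) (M : R) :
  taylor_on_disk f a -> (forall k, dirichlet_term nu a k <= b k) -> (forall n, sum_n b n <= M) ->
  S_norm2_le nu f M.
Proof.
  intros Hf Hb HM.
  destruct (series_bounded b M) as [H1 H2]; auto.
  { intros k. eapply Rle_trans; [apply dirichlet_term_pos|apply Hb]. }
  eapply S_norm2_le_mono; [exact H2|]. apply (S_norm2_le_of_coef_le nu f a b); auto.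
Qed.

Fixpoint polyn (a : nat -> C) (N : nat) (z : C) : C :=
  match N with O => a O | S n => polyn a n z + a (S n) * z ^ S n end%C.

Lemma taylor_monomial (j : nat) :
  taylor_on_disk (fun z => z ^ j)%C (fun k => if Nat.eqb k j then 1%C else 0%C).
Proof.
  induction j as [|j IH].
  - eapply taylor_coef_ext; [|eapply taylor_ext; [|exact taylor_1]].
    + intros [|k]; reflexivity.
    + intros z _. reflexivity.
  - eapply taylor_coef_ext; [|eapply taylor_ext; [|apply (taylor_mulz _ _ IH)]].
    + intros [|k]; reflexivity.
    + intros z _. reflexivity.
Qed.

Lemma taylor_polyn (a : nat -> C) (N : nat) :
  taylor_on_disk (polyn a N) (fun k => if Nat.leb k N then a k else 0%C).
Proof.
  induction N as [|N IH].
  - eapply taylor_coef_ext; [|eapply taylor_ext; [|apply (taylor_scal (a O) _ _ (taylor_monomial 0))]].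
    + intros [|k]; simpl; ring.
    + intros z _. simpl. ring.
  - eapply taylor_coef_ext; [|eapply taylor_ext; [|apply (taylor_plus _ _ _ _ IH (taylor_scal (a (S N)) _ _ (taylor_monomial (S N))))]].
    + intros k. cbv beta. destruct (Nat.leb_spec k N), (Nat.eqb_spec k (S N)), (Nat.leb_spec k (S N)); try lia;
        try (subst k); ring.
    + intros z _. reflexivity.
Qed.

Lemma sum_n_trunc (b : nat -> R) (N n : nat) :
  sum_n (fun k => if Nat.leb k N then b k else 0) n = sum_n b (Nat.min n N).
Proof.
  induction n as [|n IH].
  - rewrite !sum_O. reflexivity.
  - rewrite sum_Sn, IH. destruct (Nat.leb_spec (S n) N).
    + replace (Nat.min (S n) N) with (S (Nat.min n N)) by lia. rewrite sum_Sn.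
      replace (S (Nat.min n N)) with (S n) by lia. reflexivity.
    + replace (Nat.min (S n) N) with (Nat.min n N) by lia. apply Rplus_0_r.
Qed.

Lemma Rplus_minus_swap (x y u v : R) : (x - y) + (u - v) = (x + u) - (y + v).
Proof. ring. Qed.

Lemma sum_n_mono (b : nat -> R) (m n : nat) :
  (forall k, 0 <= b k) -> (m <= n)%nat -> sum_n b m <= sum_n b n.
Proof.
  intros Hb H. induction H as [|n H IH]; [apply Rle_refl|].
  rewrite sum_Sn. specialize (Hb (S n)). change (@plus _ ?x ?y) with (x + y). lra.
Qed.

Lemma S_norm2_le_polyn_approx (nu : R) (f : C -> C) (a : nat -> C) (d : R) :
  taylor_on_disk f a -> ex_series (dirichlet_term nu a) -> 0 < d ->
  exists N, S_norm2_le nu (fun z => polyn a N z - f z)%C d.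
Proof.
  intros Hf Ha Hd.
  assert (HN : exists N, Series (dirichlet_term nu a) - sum_n (dirichlet_term nu a) N <= d).
  { pose proof (Series_correct _ Ha) as Hs.
    destruct (Hs _ (locally_ball _ (mkposreal d Hd))) as [N HN]. exists N.
    specialize (HN N (Nat.le_refl _)). apply Rabs_lt_between in HN. simpl in HN.
    unfold minus, plus, opp in HN; simpl in HN. change (- d < sum_n (dirichlet_term nu a) N + - Series (dirichlet_term nu a) < d) in HN. lra. }
  destruct HN as [N HN]. exists N.
  set (b := dirichlet_term nu a) in *.
  assert (Hb : forall k, 0 <= b k) by apply dirichlet_term_pos.
  apply (S_norm2_le_of_partial_sums nu _ (fun k => if Nat.leb k N then 0%C else - a k)%C (fun k => b k - (if Nat.leb k N then b k else 0)) d).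
  - eapply taylor_coef_ext; [|eapply taylor_ext; [|apply (taylor_plus _ _ _ _ (taylor_polyn a N) (taylor_scal (-1)%C _ _ Hf))]].
    + intros k. cbv beta. destruct (Nat.leb k N); ring.
    + intros z _. cbv beta. ring.
  - intros k. unfold b, dirichlet_term. destruct (Nat.leb k N); [rewrite Cmod_0; apply Req_le; ring|].
    rewrite Cmod_opp. lra.
  - intros n.
    assert (E : sum_n (fun k => b k - (if Nat.leb k N then b k else 0)) n = sum_n b n - sum_n b (Nat.min n N)).
    { rewrite <- sum_n_trunc. induction n as [|n IH]; [rewrite !sum_O; reflexivity|].
      rewrite !sum_Sn, IH. apply (Rplus_minus_swap (sum_n b n) _ (b (S n)) _). }
    rewrite E. destruct (Nat.le_gt_cases n N).
    + rewrite Nat.min_l by assumption. lra.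
    + rewrite Nat.min_r by lia. pose proof (sum_n_le_Series b n Hb Ha). lra.
Qed.

(** Truncated Taylor series converge in norm, so polynomials are dense. *)
Lemma closed_subspace_full (nu : R) (P : (C -> C) -> Prop) :
  closed_subspace nu P -> (forall k, P (fun z => z ^ k)%C) -> forall f, in_S nu f -> P f.
Proof.
  intros [Hext [Hadd [Hsc Hcl]]] Hk f [a [Hf Ha]].
  apply Hcl. intros d Hd. destruct (S_norm2_le_polyn_approx nu f a d Hf Ha Hd) as [N HN].
  exists (polyn a N). split; [|exact HN].
  clear HN. induction N as [|N IH].
  - apply (Hext (fun z => a O * z ^ 0)%C); [intros z _; simpl; ring|]. apply Hsc, Hk.
  - simpl. apply (Hadd _ _ IH). apply (Hsc _ _ (Hk (S N))).
Qed.

Lemma closed_subspace_zero (nu : R) (P : (C -> C) -> Prop) (f : C -> C) :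
  closed_subspace nu P -> P f -> P (fun _ => 0%C).
Proof.
  intros [Hext [_ [Hsc _]]] H. apply (Hext (fun z => 0 * f z)%C); [intros z _; ring|]. apply Hsc, H.
Qed.

(** The preimage of a closed subspace under a bounded multiplication operator. *)
Lemma closed_subspace_mult (nu : R) (P : (C -> C) -> Prop) (al be : C) (N : nat) :
  nu <= 1 / 2 -> closed_subspace nu P -> closed_subspace nu (fun f => P (fun z => (al + be * z) ^ N * f z)%C).
Proof.
  intros Hnu [Hext [Hadd [Hsc Hcl]]]. split; [|split; [|split]].
  - intros f g E H. eapply Hext; [|exact H]. intros z Hz. simpl. rewrite (E z Hz). reflexivity.
  - intros f g Hf Hg. eapply Hext; [|apply (Hadd _ _ Hf Hg)]. intros z _. simpl. ring.
  - intros c f Hf. eapply Hext; [|apply (Hsc c _ Hf)]. intros z _. simpl. ring.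
  - intros f Hf. apply Hcl. intros d Hd.
    destruct (S_norm2_le_affine_pow nu al be N Hnu) as [K [HK HKf]].
    destruct (Hf (d / (K + 1))) as [g [Hg1 Hg2]]; [apply Rdiv_lt_0_compat; lra|].
    eexists. split; [exact Hg1|].
    apply S_norm2_le_mono with (K * (d / (K + 1))).
    { apply Rmult_le_reg_r with (K + 1); [lra|]. field_simplify; [nra|lra]. }
    eapply S_norm2_le_ext; [|apply (HKf _ _ Hg2)]. intros z _. simpl. ring.
Qed.

(** * Harmonic sums and the removal of factors [(1 - q z)^N] with [|q| <= 1] *)

Definition harm (k : nat) : R := match k with O => 0 | S _ => / INR k end.

Lemma harm_pos (k : nat) : 0 <= harm k.
Proof. destruct k; cbv beta iota delta [harm]; [lra|]. left. apply Rinv_0_lt_compat, lt_0_INR. lia. Qed.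

Lemma harm_sum_lower (m : nat) : ln (INR (m + 1)) <= sum_n harm m.
Proof.
  induction m as [|m IH].
  - rewrite sum_O. simpl. rewrite ln_1. lra.
  - rewrite sum_Sn. change (@plus _ ?x ?y) with (x + y).
    assert (Eh : harm (S m) = / INR (S m)) by reflexivity. rewrite Eh.
    assert (Hm : 0 < INR (S m)) by (apply lt_0_INR; lia).
    assert (E : INR (S m + 1) = INR (S m) + 1) by (rewrite plus_INR; reflexivity).
    replace (m + 1)%nat with (S m) in IH by lia. rewrite E.
    pose proof (ln_le_sub1 ((INR (S m) + 1) / INR (S m)) ltac:(apply Rdiv_lt_0_compat; lra)) as H.
    rewrite ln_div in H by lra.
    replace ((INR (S m) + 1) / INR (S m) - 1) with (/ INR (S m)) in H by (field; lra). lra.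
Qed.

Lemma harm_unbounded (X : R) : exists m, X <= sum_n harm m /\ 0 < sum_n harm m.
Proof.
  destruct (archimed_cor1 (exp (- (Rabs X + 1)))) as [N [HN HN0]]; [apply exp_pos|].
  exists N. assert (HI : 0 < INR N) by (apply lt_0_INR; lia).
  assert (H : Rabs X + 1 <= sum_n harm N).
  { eapply Rle_trans; [|apply harm_sum_lower].
    rewrite <- (ln_exp (Rabs X + 1)). apply Rcomplements.ln_le; [apply exp_pos|].
    rewrite exp_Ropp in HN. apply Rinv_lt_cancel in HN; [|exact HI]. rewrite plus_INR. simpl. lra. }
  pose proof (Rle_abs X). pose proof (Rabs_pos X). lra.
Qed.

(** The functions [e = (1/H) * sum_(1 <= k <= m) (q z)^k / k], with [H] the [m]-th harmonic
    number, have [S_nu]-norm tending to 0 although [1 - e] vanishes where [q z = 1]. *)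
Lemma harmonic_polyn_norm (nu : R) (q : C) (m : nat) :
  nu <= 1 / 2 -> Cmod q <= 1 ->
  S_norm2_le nu (polyn (fun k => RtoC (harm k) * q ^ k)%C m) (2 * sum_n harm m).
Proof.
  intros Hnu Hq.
  apply (S_norm2_le_of_partial_sums nu _ _ (fun k => if Nat.leb k m then 2 * harm k else 0) _ (taylor_polyn _ m)).
  - intros k. unfold dirichlet_term. destruct (Nat.leb k m); [|rewrite Cmod_0; apply Req_le; ring].
    rewrite Cmod_mult, Cmod_R, Rabs_pos_eq by apply harm_pos.
    assert (Hqk : Cmod (q ^ k) <= 1).
    { rewrite Cmod_pow, <- (pow1 k). apply pow_incr. split; [apply Cmod_ge_0|exact Hq]. }
    pose proof (Cmod_ge_0 (q ^ k)). pose proof (harm_pos k) as Hh.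
    (* The weight is at most [k + 1] because [2 nu <= 1], so the [k]-th term is at most
       [(k + 1) / k^2 <= 2 / k]. The squared norm thus grows no faster than [H], against the
       normalisation [H^2]. *)
    assert (Hp : Rpower (INR (k + 1)) (2 * nu) <= INR (k + 1)).
    { rewrite <- (Rpower_1 (INR (k + 1))) at 2 by apply INR_S_pos.
      destruct k as [|k]; [simpl; rewrite !Rpower_base1; lra|].
      apply Rle_Rpower; [|lra]. change 1 with (INR 1). apply le_INR. lia. }
    assert (Hhk : harm k * INR (k + 1) <= 2).
    { destruct k as [|k]; cbv beta iota delta [harm]; [lra|].
      assert (1 <= INR (S k)) by (change 1 with (INR 1); apply le_INR; lia).
      rewrite plus_INR. change (INR 1) with 1. apply Rmult_le_reg_l with (INR (S k)); [lra|]. rewrite <- Rmult_assoc, Rinv_r by lra. lra. }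
    pose proof (Rpower_pos (INR (k + 1)) (2 * nu)).
    apply Rle_trans with ((harm k * 1) ^ 2 * INR (k + 1)).
    + apply Rmult_le_compat; [apply pow2_ge_0|lra| |exact Hp].
      apply pow_incr. split; [apply Rmult_le_pos; assumption|apply Rmult_le_compat_l; assumption].
    + replace ((harm k * 1) ^ 2 * INR (k + 1)) with (harm k * (harm k * INR (k + 1))) by ring.
      rewrite (Rmult_comm 2). apply Rmult_le_compat_l; assumption.
  - intros n. rewrite (sum_n_trunc (fun k => 2 * harm k)).
    assert (E : forall j, sum_n (fun k => 2 * harm k) j = 2 * sum_n harm j).
    { intros j. apply (sum_n_scal_l (K := R_AbsRing) (V := R_NormedModule) 2 harm j). }
    rewrite E. apply Rmult_le_compat_l; [lra|]. apply sum_n_mono; [apply harm_pos|lia].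
Qed.

(** With [e] the normalised harmonic polynomial, [1 - e] is a combination of the functions
    [1 - (q z)^j], each divisible by [1 - q z]. Hence [(1 - q z)^i z^k (1 - e)] lies in [P], and it
    tends to [(1 - q z)^i z^k] as the norm of [e] tends to 0. *)
Lemma remove_one_factor (nu : R) (P : (C -> C) -> Prop) (q : C) (i : nat) :
  nu <= 1 / 2 -> Cmod q <= 1 -> closed_subspace nu P ->
  (forall k, P (fun z => (1 + - q * z) ^ S i * z ^ k)%C) ->
  forall k, P (fun z => (1 + - q * z) ^ i * z ^ k)%C.
Proof.
  intros Hnu Hq HP H k.
  pose proof (closed_subspace_zero _ _ _ HP (H O)) as H0.
  destruct HP as [Hext [Hadd [Hsc Hcl]]].
  assert (H1 : forall j, P (fun z => (1 + - q * z) ^ i * z ^ k * (1 - (q * z) ^ j))%C).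
  { induction j as [|j IH].
    - eapply Hext; [|exact H0]. intros z _. simpl. ring.
    - eapply Hext; [|apply (Hadd _ _ IH (Hsc (q ^ j)%C _ (H (k + j)%nat)))].
      intros z _. cbv beta. rewrite !Cpow_S, Cpow_add_r, Cpow_mult_l. ring. }
  assert (H2 : forall m, P (fun z => (1 + - q * z) ^ i * z ^ k * (RtoC (sum_n harm m) - polyn (fun k => RtoC (harm k) * q ^ k) m z))%C).
  { induction m as [|m IH].
    - eapply Hext; [|exact H0]. intros z _. rewrite sum_O. simpl. ring.
    - eapply Hext; [|apply (Hadd _ _ IH (Hsc (RtoC (harm (S m))) _ (H1 (S m))))].
      intros z _. cbv beta. rewrite sum_Sn. change (@plus _ ?x ?y) with (x + y). rewrite RtoC_plus.
      cbn [polyn]. rewrite (Cpow_mult_l q z (S m)). ring. }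
  apply Hcl. intros d Hd.
  destruct (S_norm2_le_affine_pow nu 1 (- q)%C i Hnu) as [K1 [HK1 HK1f]].
  destruct (S_norm2_le_affine_pow nu 0 1 k Hnu) as [K2 [HK2 HK2f]].
  (* The squared error below is [H^-2 K1 K2 (2 H) = 2 K1 K2 / H]. *)
  destruct (harm_unbounded (2 * K1 * K2 / d)) as [m [Hm Hm0]].
  pose (Hs := sum_n harm m : R). change (sum_n harm m) with Hs in Hm, Hm0.
  specialize (H2 m). change (sum_n harm m) with Hs in H2.
  exists (fun z => RtoC (/ Hs) * ((1 + - q * z) ^ i * z ^ k * (RtoC Hs - polyn (fun k => RtoC (harm k) * q ^ k) m z)))%C.
  split; [apply Hsc; exact H2|].
  pose proof (S_norm2_le_scal nu (RtoC (- / Hs)) _ _ (HK1f _ _ (HK2f _ _ (harmonic_polyn_norm nu q m Hnu Hq)))) as HS.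
  change (sum_n harm m) with Hs in HS.
  eapply S_norm2_le_mono; [|eapply S_norm2_le_ext; [|exact HS]].
  - rewrite Cmod_R, Rabs_Ropp, Rabs_pos_eq by (left; apply Rinv_0_lt_compat; exact Hm0).
    apply Rmult_le_reg_r with (Hs / d); [apply Rdiv_lt_0_compat; lra|].
    replace (d * (Hs / d)) with Hs by (field; lra). eapply Rle_trans; [|exact Hm]. right. field. lra.
  - intros z _. cbv beta. rewrite RtoC_opp, RtoC_inv by lra.
    replace (0 + 1 * z)%C with z by ring. field. intros E. apply RtoC_inj in E. lra.
Qed.

Lemma remove_factors (nu : R) (P : (C -> C) -> Prop) (q : C) (N : nat) :
  nu <= 1 / 2 -> Cmod q <= 1 -> closed_subspace nu P ->
  (forall k, P (fun z => (1 + - q * z) ^ N * z ^ k)%C) -> forall k, P (fun z => z ^ k)%C.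
Proof.
  intros Hnu Hq HP. induction N as [|N IH]; intros H k.
  - eapply (proj1 HP); [|apply (H k)]. intros z _. simpl. ring.
  - apply IH. apply remove_one_factor with nu; assumption.
Qed.

(** * Resolvents [1 / (1 - q z)] and coefficient bounds *)

Fixpoint resolvent_coef (q : C) (a : nat -> C) (k : nat) : C :=
  match k with O => a O | S j => a (S j) + q * resolvent_coef q a j end%C.

Lemma one_sub_ne0 (q z : C) : Cmod q <= 1 -> in_disk z -> (1 - q * z)%C <> 0%C.
Proof.
  intros Hq Hz E. unfold in_disk in Hz.
  assert (E1 : (q * z)%C = 1%C) by (replace (q * z)%C with (1 - (1 - q * z))%C by ring; rewrite E; ring).
  apply (f_equal Cmod) in E1. rewrite Cmod_mult, Cmod_1 in E1.
  pose proof (Cmod_ge_0 q). pose proof (Cmod_ge_0 z). nra.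
Qed.

(** The recursion for [resolvent_coef] says that multiplying the series by [1 - q z] gives back that
    of [f]. Polynomial growth of the coefficients is assumed only to make the series converge on the
    disk. *)
Lemma taylor_resolvent (f : C -> C) (a : nat -> C) (q : C) (X : R) (m : nat) :
  taylor_on_disk f a -> Cmod q <= 1 ->
  (forall k, Cmod (resolvent_coef q a k) <= X * INR (k + 1) ^ m) ->
  taylor_on_disk (fun z => f z / (1 - q * z))%C (resolvent_coef q a).
Proof.
  intros Hf Hq Hb. rewrite taylor_series. intros z Hz.
  assert (Hex : exists l, Cseries (fun k => resolvent_coef q a k * z ^ k)%C l).
  (* The square root is taken because [power_geom_series] is stated for [r^(2k)]. *)
  { set (rho := (1 + Cmod z) / 2). pose proof (Cmod_ge_0 z). unfold in_disk in Hz.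
    assert (Hrho : 0 < rho < 1) by (unfold rho; lra).
    assert (Hsq : 0 < sqrt rho < 1).
    { split; [apply sqrt_lt_R0; lra|]. rewrite <- sqrt_1. apply sqrt_lt_1; lra. }
    destruct (power_geom_series (INR m) (pos_INR m)) as [K [_ HK]].
    destruct (HK (sqrt rho) Hsq) as [Hexs _].
    apply (ex_Cseries_le _ (fun k => X * (Rpower (INR (k + 1)) (INR m) * sqrt rho ^ (2 * k)))); [|apply ex_series_scalR; exact Hexs].
    intros k. rewrite Cmod_mult, Cmod_pow, Rpower_pow by apply INR_S_pos.
    rewrite pow_mult. replace (sqrt rho ^ 2) with rho by (simpl; rewrite Rmult_1_r, sqrt_sqrt; lra).
    rewrite <- Rmult_assoc.
    apply Rmult_le_compat; [apply Cmod_ge_0|apply pow_le; lra|apply Hb|]. apply pow_incr. unfold rho. lra. }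
  destruct Hex as [l Hl].
  pose proof (Cseries_scal (- q)%C _ _ (Cseries_shift _ _ (Cseries_scal z _ _ Hl))) as H2.
  pose proof (Cseries_plus _ _ _ _ Hl H2) as H3.
  assert (E : (l + - q * (z * l))%C = f z).
  { eapply Cseries_unique; [exact H3|]. rewrite taylor_series in Hf. eapply Cseries_ext; [|exact (Hf z Hz)].
    intros [|k]; cbn [resolvent_coef]; [ring|]. rewrite Cpow_S. ring. }
  replace (f z / (1 - q * z))%C with l; [exact Hl|].
  rewrite <- E. field. apply one_sub_ne0; assumption.
Qed.

(** A coefficientwise substitute for the norm: it survives multiplication by affine functions and
    resolvents with explicit constants, and for [r < 1] it controls the [S_nu] norm whenever
    [nu <= 1/2]. *)
Definition geometric_coef (f : C -> C) (M r : R) : Prop :=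
  exists a, taylor_on_disk f a /\ forall k, Cmod (a k) <= M * r ^ k.

Lemma geometric_coef_ext (f g : C -> C) (M r : R) :
  (forall z, in_disk z -> f z = g z) -> geometric_coef f M r -> geometric_coef g M r.
Proof. intros H [a [H1 H2]]. exists a. split; [eapply taylor_ext; eauto|exact H2]. Qed.

Lemma geometric_coef_mono (f : C -> C) (M M' r : R) :
  0 <= r -> M <= M' -> geometric_coef f M r -> geometric_coef f M' r.
Proof.
  intros Hr H [a [H1 H2]]. exists a. split; [exact H1|]. intros k. eapply Rle_trans; [apply H2|].
  apply Rmult_le_compat_r; [apply pow_le; exact Hr|exact H].
Qed.

Lemma geometric_coef_pos (f : C -> C) (M r : R) : geometric_coef f M r -> 0 <= M.
Proof.
  intros [a [_ H]]. specialize (H O). simpl in H. pose proof (Cmod_ge_0 (a O)). lra.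
Qed.

Lemma geometric_coef_1 (r : R) : 0 <= r -> geometric_coef (fun _ => 1%C) 1 r.
Proof.
  intros Hr. eexists. split; [exact taylor_1|].
  intros [|k]; [rewrite Cmod_1; simpl; lra|]. rewrite Cmod_0.
  rewrite Rmult_1_l. apply pow_le; exact Hr.
Qed.

Lemma geometric_coef_affine (f : C -> C) (M r : R) (al be : C) :
  0 < r -> geometric_coef f M r ->
  geometric_coef (fun z => (al + be * z) * f z)%C (M * (Cmod al + Cmod be / r)) r.
Proof.
  intros Hr Hg. pose proof (geometric_coef_pos _ _ _ Hg) as HM. destruct Hg as [a [H1 H2]].
  exists (fun k => al * a k + be * shift a k)%C. split.
  - eapply taylor_ext; [|apply (taylor_plus _ _ _ _ (taylor_scal al _ _ H1) (taylor_scal be _ _ (taylor_mulz _ _ H1)))].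
    intros z _. cbv beta. ring.
  - intros k. eapply Rle_trans; [apply Cmod_triangle|]. rewrite !Cmod_mult.
    pose proof (Cmod_ge_0 al). pose proof (Cmod_ge_0 be).
    assert (Hs : Cmod (shift a k) <= M * r ^ k / r).
    { destruct k as [|k]; simpl shift.
      - rewrite Cmod_0. apply Rmult_le_pos; [|left; apply Rinv_0_lt_compat; exact Hr]. simpl. lra.
      - eapply Rle_trans; [apply H2|]. right. simpl. field. lra. }
    pose proof (Rmult_le_compat_l _ _ _ H (H2 k)). pose proof (Rmult_le_compat_l _ _ _ H0 Hs).
    replace (M * (Cmod al + Cmod be / r) * r ^ k) with (Cmod al * (M * r ^ k) + Cmod be * (M * r ^ k / r)) by (field; lra).
    lra.
Qed.

(** The constant [c = r / (r - |q|)] solves [c = 1 + |q| c / r], which is what the recursion for the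
    coefficients reproduces. *)
Lemma geometric_coef_resolvent (f : C -> C) (M r : R) (q : C) :
  Cmod q < r -> r <= 1 -> geometric_coef f M r ->
  geometric_coef (fun z => f z / (1 - q * z))%C (M * (r / (r - Cmod q))) r.
Proof.
  intros Hq Hr Hg. pose proof (geometric_coef_pos _ _ _ Hg) as HM. destruct Hg as [a [H1 H2]].
  pose proof (Cmod_ge_0 q) as Hq0.
  assert (Hc : 1 <= r / (r - Cmod q)).
  { apply Rmult_le_reg_r with (r - Cmod q); [lra|]. field_simplify; lra. }
  assert (Hb : forall k, Cmod (resolvent_coef q a k) <= M * (r / (r - Cmod q)) * r ^ k).
  { induction k as [|k IH]; cbn [resolvent_coef].
    - eapply Rle_trans; [apply H2|]. simpl. nra.
    - eapply Rle_trans; [apply Cmod_triangle|]. rewrite Cmod_mult.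
      pose proof (Rmult_le_compat_l _ _ _ Hq0 IH). specialize (H2 (S k)).
      replace (M * (r / (r - Cmod q)) * r ^ S k) with (M * r ^ S k + Cmod q * (M * (r / (r - Cmod q)) * r ^ k)) by (simpl; field; lra).
      lra. }
  exists (resolvent_coef q a). split; [|exact Hb].
  apply (taylor_resolvent f a q (M * (r / (r - Cmod q))) 0 H1); [lra|].
  intros k. eapply Rle_trans; [apply Hb|]. simpl.
  apply Rmult_le_compat_l; [apply Rmult_le_pos; lra|]. rewrite <- (pow1 k). apply pow_incr. lra.
Qed.

Lemma geometric_coef_S_norm2_le (nu r : R) :
  nu <= 1 / 2 -> 0 < r < 1 ->
  exists K, 0 < K /\ forall f M, geometric_coef f M r -> S_norm2_le nu f (K * M ^ 2).
Proof.
  intros Hnu Hr. destruct (power_geom_series 1 ltac:(lra)) as [K [HK HKs]].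
  destruct (HKs r Hr) as [Hex Hs]. exists (K * Rpower (1 - r) (- (1 + 1))).
  split; [apply Rmult_lt_0_compat; [exact HK|apply Rpower_pos]|].
  intros f M Hg. pose proof (geometric_coef_pos _ _ _ Hg) as HM. destruct Hg as [a [H1 H2]].
  eapply S_norm2_le_mono; [|apply (S_norm2_le_of_coef_le nu f a (fun k => M ^ 2 * (Rpower (INR (k + 1)) 1 * r ^ (2 * k))) H1)].
  - rewrite Series_scal_l, Rmult_comm. apply Rmult_le_compat_r; [apply pow2_ge_0|exact Hs].
  - intros k. unfold dirichlet_term. replace (r ^ (2 * k)) with ((r ^ k) ^ 2) by (rewrite <- pow_mult; f_equal; lia).
    replace (M ^ 2 * (Rpower (INR (k + 1)) 1 * (r ^ k) ^ 2)) with ((M * r ^ k) ^ 2 * Rpower (INR (k + 1)) 1) by ring.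
    apply Rmult_le_compat; [apply pow2_ge_0|left; apply Rpower_pos| |].
    + apply pow_incr. split; [apply Cmod_ge_0|apply H2].
    + destruct k as [|k]; [simpl; rewrite !Rpower_base1; lra|].
      apply Rle_Rpower; [|lra]. change 1 with (INR 1). apply le_INR. lia.
  - apply ex_series_scalR. exact Hex.
Qed.

Definition resolvent (q z : C) : C := (/ (1 - q * z))%C.

Lemma geometric_coef_resolvent_pow (q : C) (r : R) (i m : nat) :
  Cmod q < r -> r <= 1 -> exists M, forall f M0, geometric_coef f M0 r ->
    geometric_coef (fun z => z ^ i * resolvent q z ^ m * f z)%C (M0 * M) r.
Proof.
  intros Hq Hr. pose proof (Cmod_ge_0 q).
  assert (Hi : exists M, forall f M0, geometric_coef f M0 r -> geometric_coef (fun z => z ^ i * f z)%C (M0 * M) r).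
  { induction i as [|i [M IH]].
    - exists 1. intros f M0 H0. rewrite Rmult_1_r. eapply geometric_coef_ext; [|exact H0]. intros z _. simpl. ring.
    - exists (M * (Cmod 0 + Cmod 1 / r)). intros f M0 H0. rewrite <- Rmult_assoc.
      eapply geometric_coef_ext; [|apply geometric_coef_affine; [lra|apply (IH f M0 H0)]].
      intros z _. simpl. ring. }
  destruct Hi as [M HM].
  induction m as [|m [M' IH]].
  - exists M. intros f M0 H0. eapply geometric_coef_ext; [|apply (HM f M0 H0)]. intros z _. simpl. ring.
  - exists (M' * (r / (r - Cmod q))). intros f M0 H0. rewrite <- Rmult_assoc.
    eapply geometric_coef_ext; [|apply geometric_coef_resolvent; [exact Hq|exact Hr|apply (IH f M0 H0)]].
    intros z _. unfold resolvent, Cdiv. simpl. ring.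
Qed.

(** Moves the pole of [1/(1 - q z)] by the Neumann series in [(q' - q) z / (1 - q z)]. *)
Lemma resolvent_step (nu r : R) (P : (C -> C) -> Prop) (q q' : C) (J : nat) :
  nu <= 1 / 2 -> r < 1 -> closed_subspace nu P ->
  Cmod (q' - q) < r - Cmod q -> Cmod q' < r ->
  (forall i m, (J + i <= m)%nat -> P (fun z => z ^ i * resolvent q z ^ m)%C) ->
  forall i m, (J + i <= m)%nat -> P (fun z => z ^ i * resolvent q' z ^ m)%C.
Proof.
  intros Hnu Hr HP Hd Hq' H.
  pose proof (Cmod_ge_0 q) as Hq0. pose proof (Cmod_ge_0 (q' - q)) as Hd0.
  pose proof HP as [Hext [Hadd [Hsc Hcl]]].
  assert (Hz0 : P (fun _ => 0%C)).
  { apply (closed_subspace_zero nu P _ HP (H O J ltac:(lia))). }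
  (* Factors with the new pole are introduced one at a time; [p] counts them, and [m + p] keeps the
     total pole order. *)
  assert (Hmain : forall p i m, (J + i <= m + p)%nat -> P (fun z => z ^ i * resolvent q z ^ m * resolvent q' z ^ p)%C).
  { induction p as [|p IH]; intros i m Him.
    { eapply Hext; [|apply (H i m); lia]. intros z _. simpl. ring. }
    set (f := fun z => (z ^ i * resolvent q z ^ m * resolvent q' z ^ S p)%C).
    set (w := fun z => ((q' - q) * z * resolvent q z)%C).
    (* Since [resolvent q' = resolvent q / (1 - w)], the increment [w^L (1 - w) f] equals
       [(q' - q)^L z^(i+L)] times [m + 1 + L] old and [p] new resolvents, which the induction
       hypothesis covers. *)
    assert (HL : forall L, P (fun z => f z - w z ^ L * f z)%C).
    { induction L as [|L IHL].
      - eapply Hext; [|exact Hz0]. intros z _. simpl. ring.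
      - eapply Hext; [|apply (Hadd _ _ IHL (Hsc ((q' - q) ^ L)%C _ (IH (i + L)%nat (S (m + L)) ltac:(lia))))].
        intros z Hz. cbv beta. unfold f, w, resolvent. rewrite !Cpow_S, !Cpow_add_r, !Cpow_mult_l.
        field. split; apply one_sub_ne0; auto; lra. }
    apply Hcl. intros d Hdp.
    destruct (geometric_coef_S_norm2_le nu r Hnu ltac:(lra)) as [K [HK HKs]].
    destruct (geometric_coef_resolvent_pow q r i m ltac:(lra) ltac:(lra)) as [M1 HM1].
    destruct (geometric_coef_resolvent_pow q' r 0 (S p) Hq' ltac:(lra)) as [M2 HM2].
    pose proof (HM1 _ _ (HM2 _ _ (geometric_coef_1 r ltac:(lra)))) as Hf.
    set (M := 1 * M2 * M1) in Hf.
    (* Multiplication by [w] scales geometric bounds by [(|q' - q| / r) (r / (r - |q|)) = th], so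
       [w^L f] tends to 0. *)
    set (th := Cmod (q' - q) / (r - Cmod q)).
    assert (Hth : 0 <= th < 1).
    { split; [apply Rmult_le_pos; [lra|left; apply Rinv_0_lt_compat; lra]|].
      apply Rmult_lt_reg_r with (r - Cmod q); [lra|]. unfold th. field_simplify; lra. }
    assert (HwL : forall L, geometric_coef (fun z => w z ^ L * f z)%C (M * th ^ L) r).
    { induction L as [|L IHL].
      - simpl pow. rewrite Rmult_1_r. eapply geometric_coef_ext; [|exact Hf].
        intros z _. unfold f. simpl. ring.
      - replace (M * th ^ S L) with (M * th ^ L * (Cmod 0 + Cmod (q' - q) / r) * (r / (r - Cmod q))).
        2: { rewrite Cmod_0. unfold th. simpl. field. lra. }
        eapply geometric_coef_ext; [|apply geometric_coef_resolvent; [lra|lra|apply geometric_coef_affine; [lra|exact IHL]]].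
        intros z _. cbv beta. rewrite Cpow_S. unfold w at 2, resolvent, Cdiv. ring. }
    assert (HLd : exists L, K * (M * th ^ L) ^ 2 <= d).
    { destruct (pow_lt_1_zero th ltac:(rewrite Rabs_pos_eq; lra) (d / (K * M ^ 2 + 1))) as [N HN].
      { apply Rdiv_lt_0_compat; [exact Hdp|]. pose proof (Rmult_le_pos K (M ^ 2) ltac:(lra) (pow2_ge_0 M)). lra. }
      exists N. specialize (HN N (Nat.le_refl _)). pose proof (pow_le th N ltac:(lra)) as HthN.
      rewrite Rabs_pos_eq in HN by exact HthN.
      pose proof (Rmult_le_pos K (M ^ 2) ltac:(lra) (pow2_ge_0 M)) as HKM.
      assert (th ^ N <= 1) by (rewrite <- (pow1 N); apply pow_incr; lra).
      assert (th ^ N * (K * M ^ 2 + 1) < d).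
      { apply Rmult_lt_reg_r with (/ (K * M ^ 2 + 1)); [apply Rinv_0_lt_compat; lra|]. field_simplify; [|lra|lra].
        unfold Rdiv in HN. lra. }
      replace (K * (M * th ^ N) ^ 2) with (K * M ^ 2 * (th ^ N * th ^ N)) by ring. nra. }
    destruct HLd as [L HL1]. exists (fun z => f z - w z ^ L * f z)%C. split; [apply HL|].
    apply S_norm2_le_mono with (K * (M * th ^ L) ^ 2); [exact HL1|].
    pose proof (HKs _ _ (HwL L)) as Hs. apply (S_norm2_le_scal nu (-1)%C) in Hs.
    eapply S_norm2_le_mono; [|eapply S_norm2_le_ext; [|exact Hs]].
    - rewrite Cmod_R, Rabs_left by lra. lra.
    - intros z _. cbv beta. ring. }
  intros i m Him. eapply Hext; [|apply (Hmain m i O); lia]. intros z _. simpl. ring.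
Qed.

(** The segment from [q] to 0 is cut into [n] equal steps with [1/n < r - |q|]. The modulus only
    decreases along it, so one [r] serves every step; at [q = 0] the resolvent is 1. *)
Lemma resolvent_path (nu : R) (P : (C -> C) -> Prop) (q : C) (J : nat) :
  nu <= 1 / 2 -> closed_subspace nu P -> Cmod q < 1 ->
  (forall i m, (J + i <= m)%nat -> P (fun z => z ^ i * resolvent q z ^ m)%C) ->
  forall i, P (fun z => z ^ i)%C.
Proof.
  intros Hnu HP Hq H.
  pose proof (Cmod_ge_0 q) as Hq0.
  set (r := (1 + Cmod q) / 2). assert (Hr : Cmod q < r < 1) by (unfold r; lra).
  destruct (archimed_cor1 (r - Cmod q) ltac:(lra)) as [n [Hn Hn0]].
  assert (HnI : 0 < INR n) by (apply lt_0_INR; lia).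
  set (qq := fun j : nat => (RtoC (1 - INR j / INR n) * q)%C).
  assert (Hqq : forall j, (j <= n)%nat -> Cmod (qq j) <= Cmod q).
  { intros j Hj. unfold qq. rewrite Cmod_mult, Cmod_R.
    assert (0 <= INR j / INR n <= 1).
    { split; [apply Rmult_le_pos; [apply pos_INR|left; apply Rinv_0_lt_compat; exact HnI]|].
      apply Rmult_le_reg_r with (INR n); [exact HnI|]. field_simplify; [|lra]. apply le_INR; exact Hj. }
    rewrite Rabs_pos_eq by lra. nra. }
  assert (Hj : forall j, (j <= n)%nat -> forall i m, (J + i <= m)%nat -> P (fun z => z ^ i * resolvent (qq j) z ^ m)%C).
  { induction j as [|j IH]; intros Hjn.
    - intros i m Him. eapply (proj1 HP); [|apply (H i m Him)]. intros z _. cbv beta.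
      replace (qq O) with q; [reflexivity|]. unfold qq. simpl. replace (1 - 0 / INR n) with 1 by (field; lra). ring.
    - apply (resolvent_step nu r P (qq j) (qq (S j)) J Hnu ltac:(lra) HP); [| |apply IH; lia].
      + replace (qq (S j) - qq j)%C with (- (RtoC (/ INR n) * q))%C.
        2: { unfold qq. rewrite S_INR, !RtoC_minus. replace ((INR j + 1) / INR n) with (INR j / INR n + / INR n) by (field; lra).
             rewrite RtoC_plus. ring. }
        rewrite Cmod_opp, Cmod_mult, Cmod_R, Rabs_pos_eq by (left; apply Rinv_0_lt_compat; exact HnI).
        pose proof (Hqq j ltac:(lia)). assert (0 < / INR n) by (apply Rinv_0_lt_compat; exact HnI). nra.
      + pose proof (Hqq (S j) Hjn). lra. }
  intros i. eapply (proj1 HP); [|apply (Hj n (Nat.le_refl _) i (J + i)%nat (Nat.le_refl _))].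
  intros z _. cbv beta. replace (qq n) with (RtoC 0).
  - unfold resolvent. replace (1 - 0 * z)%C with (RtoC 1) by ring.
    replace (/ 1)%C with (RtoC 1) by field. rewrite Cpow_1_l. ring.
  - unfold qq. replace (1 - INR n / INR n) with 0 by (field; lra). ring.
Qed.

(** * Sufficiency *)


Definition iterate_op (lambda : C) (F : C -> C) (n : nat) (h : C -> C) (z : C) : C :=
  (lambda ^ n * h (Nat.iter n F z))%C.

(** Stable under sums and limits in the pair [(f, g)], so that [(f, f)] reduces to [(f, 0)] and
    [(0, f)]. *)
Definition linked (nu : R) (lambda : C) (F : C -> C) (f g : C -> C) : Prop :=
  forall d, 0 < d -> exists n0, forall n, (n0 <= n)%nat -> exists h,
    S_norm2_le nu (fun z => h z - f z)%C d /\ S_norm2_le nu (fun z => iterate_op lambda F n h z - g z)%C d.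

Lemma linked_ext (nu : R) (lambda : C) (F f f' g g' : C -> C) :
  (forall z, in_disk z -> f z = f' z) -> (forall z, in_disk z -> g z = g' z) ->
  linked nu lambda F f g -> linked nu lambda F f' g'.
Proof.
  intros Ef Eg H d Hd. destruct (H d Hd) as [n0 Hn]. exists n0. intros n Hle.
  destruct (Hn n Hle) as [h [H1 H2]]. exists h. split.
  - eapply S_norm2_le_ext; [|exact H1]. intros z Hz. cbv beta. rewrite (Ef z Hz). reflexivity.
  - eapply S_norm2_le_ext; [|exact H2]. intros z Hz. cbv beta. rewrite (Eg z Hz). reflexivity.
Qed.

Lemma linked_plus (nu : R) (lambda : C) (F f f' g g' : C -> C) :
  linked nu lambda F f g -> linked nu lambda F f' g' ->
  linked nu lambda F (fun z => f z + f' z)%C (fun z => g z + g' z)%C.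
Proof.
  intros H H' d Hd. destruct (H (d / 4) ltac:(lra)) as [n0 Hn]. destruct (H' (d / 4) ltac:(lra)) as [n1 Hn'].
  exists (max n0 n1). intros n Hle.
  destruct (Hn n ltac:(lia)) as [h [H1 H2]]. destruct (Hn' n ltac:(lia)) as [h' [H3 H4]].
  exists (fun z => h z + h' z)%C. replace d with (2 * (d / 4) + 2 * (d / 4)) by field. split.
  - eapply S_norm2_le_ext; [|apply (S_norm2_le_plus _ _ _ _ _ H1 H3)]. intros z _. cbv beta. ring.
  - eapply S_norm2_le_ext; [|apply (S_norm2_le_plus _ _ _ _ _ H2 H4)]. intros z _. unfold iterate_op. ring.
Qed.

Lemma linked_scal (nu : R) (lambda : C) (F f g : C -> C) (c : C) :
  linked nu lambda F f g -> linked nu lambda F (fun z => c * f z)%C (fun z => c * g z)%C.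
Proof.
  intros H d Hd. pose proof (pow2_ge_0 (Cmod c)) as Hc.
  assert (Hd' : 0 < d / (Cmod c ^ 2 + 1)) by (apply Rdiv_lt_0_compat; lra).
  assert (Hle : Cmod c ^ 2 * (d / (Cmod c ^ 2 + 1)) <= d).
  { apply Rmult_le_reg_r with (Cmod c ^ 2 + 1); [lra|]. field_simplify; [nra|lra]. }
  destruct (H _ Hd') as [n0 Hn]. exists n0. intros n Hn0. destruct (Hn n Hn0) as [h [H1 H2]].
  exists (fun z => c * h z)%C. split; (eapply S_norm2_le_mono; [exact Hle|]).
  - eapply S_norm2_le_ext; [|apply (S_norm2_le_scal _ c _ _ H1)]. intros z _. cbv beta. ring.
  - eapply S_norm2_le_ext; [|apply (S_norm2_le_scal _ c _ _ H2)]. intros z _. unfold iterate_op. ring.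
Qed.

Lemma linked_closure (nu : R) (lambda : C) (F f g : C -> C) :
  (forall d, 0 < d -> exists f' g', linked nu lambda F f' g' /\
     S_norm2_le nu (fun z => f' z - f z)%C d /\ S_norm2_le nu (fun z => g' z - g z)%C d) ->
  linked nu lambda F f g.
Proof.
  intros H d Hd. destruct (H (d / 4) ltac:(lra)) as [f' [g' [Hl [Hf Hg]]]].
  destruct (Hl (d / 4) ltac:(lra)) as [n0 Hn]. exists n0. intros n Hle.
  destruct (Hn n Hle) as [h [H1 H2]]. exists h. replace d with (2 * (d / 4) + 2 * (d / 4)) by field. split.
  - eapply S_norm2_le_ext; [|apply (S_norm2_le_plus _ _ _ _ _ H1 Hf)]. intros z _. cbv beta. ring.
  - eapply S_norm2_le_ext; [|apply (S_norm2_le_plus _ _ _ _ _ H2 Hg)]. intros z _. cbv beta. ring.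
Qed.

Lemma linked_left_closed (nu : R) (lambda : C) (F : C -> C) :
  closed_subspace nu (fun f => linked nu lambda F f (fun _ => 0%C)).
Proof.
  split; [|split; [|split]].
  - intros f g E. apply linked_ext; auto.
  - intros f g Hf Hg. eapply linked_ext; [| |apply (linked_plus _ _ _ _ _ _ _ Hf Hg)]; intros z _; cbv beta; ring.
  - intros c f Hf. eapply linked_ext; [| |apply (linked_scal _ _ _ _ _ c Hf)]; intros z _; cbv beta; ring.
  - intros f H. apply linked_closure. intros d Hd. destruct (H d Hd) as [g [H1 H2]].
    exists g, (fun _ => 0%C). split; [exact H1|split; [exact H2|]].
    apply S_norm2_le_zero; [intros z _; ring|lra].
Qed.

Lemma linked_right_closed (nu : R) (lambda : C) (F : C -> C) :
  closed_subspace nu (fun g => linked nu lambda F (fun _ => 0%C) g).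
Proof.
  split; [|split; [|split]].
  - intros f g E. apply linked_ext; auto.
  - intros f g Hf Hg. eapply linked_ext; [| |apply (linked_plus _ _ _ _ _ _ _ Hf Hg)]; intros z _; cbv beta; ring.
  - intros c f Hf. eapply linked_ext; [| |apply (linked_scal _ _ _ _ _ c Hf)]; intros z _; cbv beta; ring.
  - intros f H. apply linked_closure. intros d Hd. destruct (H d Hd) as [g [H1 H2]].
    exists (fun _ => 0%C), g. split; [exact H1|split; [|exact H2]].
    apply S_norm2_le_zero; [intros z _; ring|lra].
Qed.

Lemma recurrent_of_linked (nu : R) (lambda : C) (phi : lfm) :
  (forall f, in_S nu f -> linked nu lambda (lfm_fun phi) f f) ->
  recurrent_on_S nu (scaled_composition_op lambda phi).
Proof.
  intros H U HU [f Uf]. destruct (HU f Uf) as [Hf [eps [He Hball]]].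
  (* Half of [eps^2] leaves room for the strict inequality in the definition of a ball; [S n0] below
     ensures a positive exponent. *)
  assert (He2 : 0 < eps ^ 2 / 2) by (pose proof (pow_lt eps 2 He); lra).
  destruct (H f Hf _ He2) as [n0 Hn]. exists (S n0). split; [lia|].
  destruct (Hn (S n0) ltac:(lia)) as [h [H1 H2]]. exists h.
  assert (Hin : forall g, S_norm2_le nu (fun z => g z - f z)%C (eps ^ 2 / 2) -> U g).
  { intros g Hg. apply Hball.
    - destruct (in_S_norm2_le _ _ Hf) as [d Hd]. eapply S_norm2_le_in_S.
      eapply S_norm2_le_ext; [|apply (S_norm2_le_plus _ _ _ _ _ Hg Hd)]. intros z _. cbv beta. ring.
    - apply (S_norm_lt _ _ _ _ Hg He). lra. }
  split; [apply Hin; exact H1|]. apply Hin.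
  eapply S_norm2_le_ext; [|exact H2]. intros z _. cbv beta. rewrite iter_composition. reflexivity.
Qed.

(** * Uniform bounds for the iterates and the two families of linked pairs *)

Definition pole_coef (eta k : C) : C := (- k / (1 - k * eta))%C.

(** For [k <> 0], [pole_coef eta k] is the reciprocal of the zero of [1 + k (z - eta)]; working with
    reciprocals makes [k = 0] unexceptional. *)
Lemma pole_coef_factor (eta k : C) :
  Cmod eta = 1 -> Re (k * eta)%C < 1 / 2 ->
  (1 - k * eta)%C <> 0%C /\ Cmod (pole_coef eta k) < 1 /\
  (forall z, 1 + k * (z - eta) = (1 - k * eta) * (1 - pole_coef eta k * z))%C.
Proof.
  intros He Hk. pose proof (Cmod_lt_one_minus eta k He Hk) as H. pose proof (Cmod_ge_0 k) as Hk0.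
  assert (H0 : (1 - k * eta)%C <> 0%C) by (intros E; rewrite E, Cmod_0 in H; lra).
  split; [exact H0|]. split.
  - unfold pole_coef. rewrite Cmod_div, Cmod_opp by exact H0.
    apply Rmult_lt_reg_r with (Cmod (1 - k * eta)); [lra|]. field_simplify; lra.
  - intros z. unfold pole_coef. field. exact H0.
Qed.

(** With [Y = |1 - k eta|], the squared modulus of [pole_coef] is [1 - (1 - 2 Re (k eta)) / Y^2 <= 1
    - m / X^2]; taking the root halves the gap. *)
Lemma pole_coef_bound (eta k : C) (m X : R) :
  Cmod eta = 1 -> 0 < m -> m <= 1 - 2 * Re (k * eta)%C -> Cmod (1 - k * eta) <= X ->
  Cmod (pole_coef eta k) <= 1 - m / (2 * X ^ 2).
Proof.
  intros He Hm Hk HX. destruct (pole_coef_factor eta k He ltac:(lra)) as [H0 _].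
  pose proof (Cmod_one_minus_sqr eta k He) as Hsq.
  assert (HY : 0 < Cmod (1 - k * eta)) by (apply Cmod_gt_0; exact H0).
  set (Y := Cmod (1 - k * eta)) in *.
  unfold pole_coef. rewrite Cmod_div, Cmod_opp by exact H0. fold Y.
  set (y := m / (2 * X ^ 2)).
  assert (Hy : 0 < y) by (apply Rdiv_lt_0_compat; [exact Hm|pose proof (pow_lt X 2 ltac:(lra)); lra]).
  assert (Hyy : 2 * y * Y ^ 2 <= m).
  { apply Rle_trans with (2 * y * X ^ 2).
    - apply Rmult_le_compat_l; [lra|]. apply pow_incr. lra.
    - right. unfold y. field. lra. }
  pose proof (Cmod_ge_0 k). pose proof (pow2_ge_0 (Cmod k)).
  assert (Hy1 : y <= 1 / 2).
  { apply Rmult_le_reg_r with (Y ^ 2); [apply pow_lt; exact HY|]. lra. }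
  apply Rmult_le_reg_r with Y; [exact HY|]. replace (Cmod k / Y * Y) with (Cmod k) by (field; lra).
  apply Rsqr_incr_0_var; [|nra]. unfold Rsqr.
  replace ((1 - y) * Y * ((1 - y) * Y)) with (Y ^ 2 - 2 * y * Y ^ 2 + y ^ 2 * Y ^ 2) by ring.
  pose proof (Rmult_le_pos _ _ (pow2_ge_0 y) (pow2_ge_0 Y)). lra.
Qed.

(** The parameter [t = 1 - s^n] covers all iterates at once: [r] and [G] do not depend on [t],
    because the poles stay uniformly away from the closed disk. *)
Lemma moebius_multiplier (eta k0 : C) :
  Cmod eta = 1 -> Re (k0 * eta)%C < 1 / 2 ->
  exists r G, 0 < r < 1 /\ 0 < G /\ forall t al be, 0 <= t <= 1 ->
    Cmod al <= Cmod k0 + 2 -> Cmod be <= Cmod k0 + 2 -> forall f X, geometric_coef f X r ->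
    geometric_coef (fun z => (al + be * z) / (1 + k0 * RtoC t * (z - eta)) * f z)%C (X * G) r.
Proof.
  intros He Hk. set (M := Cmod k0). assert (HM : 0 <= M) by apply Cmod_ge_0.
  (* A lower bound for [1 - 2 t Re (k0 eta)] over all [t] in [[0, 1]], whatever the sign of the real
     part. *)
  set (m := Rmin 1 (1 - 2 * Re (k0 * eta)%C)).
  assert (Hm : 0 < m) by (apply Rmin_glb_lt; lra).
  assert (Hm1 : m <= 1) by apply Rmin_l. assert (Hm2 : m <= 1 - 2 * Re (k0 * eta)%C) by apply Rmin_r.
  set (r' := 1 - m / (2 * (1 + M) ^ 2)).
  assert (Hr' : 1 / 2 <= r' < 1).
  { assert (1 <= (1 + M) ^ 2) by (rewrite <- (pow1 2) at 1; apply pow_incr; lra).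
    assert (0 < m / (2 * (1 + M) ^ 2) <= 1 / 2).
    { split; [apply Rdiv_lt_0_compat; lra|]. apply Rmult_le_reg_r with (2 * (1 + M) ^ 2); [lra|].
      field_simplify; lra. }
    unfold r'. lra. }
  set (r := (1 + r') / 2). assert (Hr : r' < r < 1) by (unfold r; lra).
  exists r, ((2 * (M + 2) + 2 * (M + 2) / r) * (r / (r - r'))).
  split; [lra|]. split.
  { apply Rmult_lt_0_compat; [|apply Rdiv_lt_0_compat; lra].
    assert (0 < 2 * (M + 2) / r) by (apply Rdiv_lt_0_compat; lra). lra. }
  intros t al be Ht Hal Hbe f X Hf.
  pose proof (geometric_coef_pos _ _ _ Hf) as HX.
  set (k := (k0 * RtoC t)%C).
  assert (Hre : Re (k * eta)%C = t * Re (k0 * eta)%C).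
  { unfold k. rewrite <- Re_RtoC_mult. f_equal. ring. }
  assert (Hmk : m <= 1 - 2 * Re (k * eta)%C).
  { rewrite Hre. destruct (Rle_lt_dec (Re (k0 * eta)%C) 0); nra. }
  assert (Hkeh : Re (k * eta)%C < 1 / 2) by lra.
  destruct (pole_coef_factor eta k He Hkeh) as [Hb0 [Hq1 Hfac]].
  set (b := (1 - k * eta)%C) in *. set (q := pole_coef eta k) in *.
  assert (HbX : Cmod b <= 1 + M).
  { unfold b, k. eapply Rle_trans; [apply Cmod_triangle|].
    rewrite Cmod_opp, Cmod_1, !Cmod_mult, He, Cmod_R, Rabs_pos_eq by lra. fold M. nra. }
  assert (Hq : Cmod q <= r') by (apply pole_coef_bound; auto).
  assert (Hbl : 1 / 2 <= Cmod b).
  { pose proof (re_le_Cmod b) as H. apply Rabs_le_between in H.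
    assert (Re b = 1 - Re (k * eta)%C) by (unfold b; unfold Cminus; rewrite Re_plus, Re_opp; reflexivity). lra. }
  assert (Hinv : / Cmod b <= 2) by (rewrite <- (Rinv_inv 2); apply Rinv_le_contravar; lra).
  assert (Hinv0 : 0 < / Cmod b) by (apply Rinv_0_lt_compat; lra).
  apply (geometric_coef_ext (fun z => ((al / b + be / b * z) * f z) / (1 - q * z))%C).
  { intros z Hz. cbv beta. fold k. rewrite Hfac. fold b. field. split; [|exact Hb0].
    apply one_sub_ne0; [lra|exact Hz]. }
  eapply geometric_coef_mono; [lra| |apply geometric_coef_resolvent; [lra|lra|apply geometric_coef_affine; [lra|exact Hf]]].
  rewrite Rmult_assoc. apply Rmult_le_compat_l; [exact HX|].
  rewrite !Cmod_div by exact Hb0.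
  pose proof (Cmod_ge_0 al). pose proof (Cmod_ge_0 be). pose proof (Cmod_ge_0 q).
  assert (Ha1 : Cmod al / Cmod b <= 2 * (M + 2)) by (unfold Rdiv; nra).
  assert (Hb1 : Cmod be / Cmod b <= 2 * (M + 2)) by (unfold Rdiv; nra).
  assert (Hb2 : 0 <= Cmod be / Cmod b) by (unfold Rdiv; nra).
  assert (Ha2 : 0 <= Cmod al / Cmod b) by (unfold Rdiv; nra).
  assert (Hir : 0 < / r) by (apply Rinv_0_lt_compat; lra).
  apply Rmult_le_compat.
  - unfold Rdiv in *. nra.
  - left. apply Rdiv_lt_0_compat; lra.
  - apply Rplus_le_compat; [exact Ha1|]. unfold Rdiv at 1 3. apply Rmult_le_compat_r; lra.
  - unfold Rdiv. apply Rmult_le_compat_l; [lra|]. apply Rinv_le_contravar; lra.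
Qed.

Lemma geometric_eventually_small (y X d : R) :
  0 <= y < 1 -> 0 <= X -> 0 < d -> exists n0, forall n, (n0 <= n)%nat -> X * y ^ n <= d.
Proof.
  intros Hy HX Hd.
  destruct (pow_lt_1_zero y ltac:(rewrite Rabs_pos_eq; lra) (d / (X + 1)) ltac:(apply Rdiv_lt_0_compat; lra)) as [N HN].
  exists N. intros n Hn. specialize (HN n Hn). rewrite Rabs_pos_eq in HN by (apply pow_le; lra).
  assert (y ^ n * (X + 1) <= d).
  { apply Rmult_le_reg_r with (/ (X + 1)); [apply Rinv_0_lt_compat; lra|]. field_simplify; [|lra|lra]. lra. }
  pose proof (pow_le y n ltac:(lra)). nra.
Qed.

(** Composition with the [n]-th iterate turns [1 - z/eta] into [s^n] times a Moebius function
    bounded uniformly in [n]. So [T^n] of the function decays like [(|lambda| s^N)^n], and [h] can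
    be the function itself. *)
Lemma linked_vanishing (nu s : R) (eta k0 lambda : C) (F : C -> C) (N k : nat) :
  nu <= 1 / 2 -> attracting_model eta s k0 F -> Cmod lambda * s ^ N < 1 ->
  linked nu lambda F (fun z => (1 + - / eta * z) ^ N * z ^ k)%C (fun _ => 0%C).
Proof.
  intros Hnu Hm HN. pose proof Hm as [He [Hs [Hk [HF _]]]].
  assert (Heta : eta <> 0%C) by (intros E; rewrite E, Cmod_0 in He; lra).
  destruct (moebius_multiplier eta k0 He Hk) as [r [G [Hr [HG HGm]]]].
  destruct (geometric_coef_S_norm2_le nu r Hnu Hr) as [K [HK HKs]].
  set (y := Cmod lambda * s ^ N). pose proof (Cmod_ge_0 lambda).
  assert (Hy : 0 <= y < 1) by (split; [apply Rmult_le_pos; [assumption|apply pow_le; lra]|exact HN]).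
  intros d Hd.
  destruct (geometric_eventually_small y (K * (G ^ (N + k)) ^ 2) d Hy) as [n0 Hn0]; auto.
  { apply Rmult_le_pos; [lra|apply pow2_ge_0]. }
  exists n0. intros n Hn. exists (fun z => (1 + - / eta * z) ^ N * z ^ k)%C.
  split; [apply S_norm2_le_zero; [intros z _; ring|lra]|].
  pose proof (pow_s_bounds s n Hs) as Hsn. set (t := s ^ n) in *.
  set (kn := (k0 * RtoC (1 - t))%C).
  assert (Hkn : Cmod kn <= Cmod k0).
  { unfold kn. rewrite Cmod_mult, Cmod_R, Rabs_pos_eq by lra. pose proof (Cmod_ge_0 k0). nra. }
  assert (Hdn : forall z, in_disk z -> (1 + kn * (z - eta))%C <> 0%C).
  { intros z Hz. apply den_ne0; auto. apply Re_scaled_lt; auto. lra. }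
  (* [m2] is the [n]-th iterate over a single denominator, and [1 - m2/eta = t m1]. *)
  set (m1 := fun z => ((1 + - / eta * z) / (1 + kn * (z - eta)))%C).
  set (m2 := fun z => (((eta - kn * eta * eta - t * eta) + (eta * kn + t) * z) / (1 + kn * (z - eta)))%C).
  assert (Hg1 : forall f X, geometric_coef f X r -> geometric_coef (fun z => m1 z * f z)%C (X * G) r).
  { intros f X. apply HGm; [lra| |].
    - rewrite Cmod_1. pose proof (Cmod_ge_0 k0). lra.
    - rewrite Cmod_opp, Cmod_inv, He, Rinv_1 by exact Heta. pose proof (Cmod_ge_0 k0). lra. }
  assert (Hg2 : forall f X, geometric_coef f X r -> geometric_coef (fun z => m2 z * f z)%C (X * G) r).
  { intros f X. apply HGm; [lra| |].
    - unfold Cminus. eapply Rle_trans; [apply Cmod_triangle|].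
      pose proof (Cmod_triangle eta (- (kn * eta * eta))) as H1.
      rewrite Cmod_opp, !Cmod_mult, He in H1. rewrite Cmod_opp, Cmod_mult, Cmod_R, He, Rabs_pos_eq by lra. lra.
    - eapply Rle_trans; [apply Cmod_triangle|]. rewrite Cmod_mult, He, Cmod_R, Rabs_pos_eq by lra. lra. }
  assert (Hp2 : geometric_coef (fun z => m2 z ^ k)%C (G ^ k) r).
  { clear Hn0 HN. induction k as [|j IH].
    - eapply geometric_coef_ext; [|apply geometric_coef_1; lra]. reflexivity.
    - simpl pow. rewrite Rmult_comm. eapply geometric_coef_ext; [|apply (Hg2 _ _ IH)].
      intros z _. cbv beta. rewrite Cpow_S. reflexivity. }
  assert (Hp1 : geometric_coef (fun z => m1 z ^ N * m2 z ^ k)%C (G ^ (N + k)) r).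
  { clear Hn0 HN y Hy. induction N as [|j IH].
    - eapply geometric_coef_ext; [|exact Hp2]. intros z _. simpl. ring.
    - simpl pow. rewrite Rmult_comm. eapply geometric_coef_ext; [|apply (Hg1 _ _ IH)].
      intros z _. cbv beta. rewrite Cpow_S. ring. }
  pose proof (S_norm2_le_scal nu ((lambda * RtoC (s ^ N)) ^ n)%C _ _ (HKs _ _ Hp1)) as HS.
  eapply S_norm2_le_mono; [|eapply S_norm2_le_ext; [|exact HS]].
  - rewrite Cmod_pow, Cmod_mult, Cmod_R, Rabs_pos_eq by (apply pow_le; lra). fold y.
    eapply Rle_trans; [|apply (Hn0 n Hn)].
    pose proof (pow_le y n ltac:(lra)). assert (y ^ n <= 1) by (rewrite <- (pow1 n); apply pow_incr; lra).
    pose proof (Rmult_le_pos K ((G ^ (N + k)) ^ 2) ltac:(lra) (pow2_ge_0 _)).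
    rewrite Rmult_comm. apply Rmult_le_compat_l; [assumption|]. nra.
  - intros z Hz. cbv beta. unfold iterate_op. rewrite (model_iter _ _ _ _ n z Hm Hz). fold t kn.
    specialize (Hdn z Hz).
    replace (eta + t * (z - eta) / (1 + kn * (z - eta)))%C with (m2 z) by (unfold m2; field; exact Hdn).
    replace (1 + - / eta * m2 z)%C with (RtoC t * m1 z)%C.
    2: { unfold m1, m2. field. split; assumption. }
    rewrite !Cpow_mult_l.
    replace (RtoC (s ^ N) ^ n)%C with (RtoC t ^ N)%C; [ring|].
    unfold t. rewrite <- !RtoC_pow, <- !pow_mult. f_equal. f_equal. lia.
Qed.

(** The coefficients are [q^k] times binomials [k + i] over [i], which are at most [(k + 1)^i]; the
    recursion gives this bound without binomials. *)
Lemma resolvent_pow_coef (q : C) (r : R) (i : nat) :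
  Cmod q <= r -> r < 1 ->
  exists a, taylor_on_disk (fun z => resolvent q z ^ S i)%C a /\
    forall k, Cmod (a k) <= INR (k + 1) ^ i * r ^ k.
Proof.
  intros Hq Hr. pose proof (Cmod_ge_0 q) as Hq0.
  assert (Hrk : forall k, 0 <= r ^ k <= 1).
  { intros k. split; [apply pow_le; lra|]. rewrite <- (pow1 k). apply pow_incr. lra. }
  assert (Hbd : forall b j, (forall k, Cmod (b k) <= INR (k + 1) ^ j * r ^ k) -> forall k, Cmod (b k) <= 1 * INR (k + 1) ^ j).
  { intros b j Hb k. eapply Rle_trans; [apply Hb|]. rewrite Rmult_1_l. specialize (Hrk k).
    pose proof (pow_le (INR (k + 1)) j (pos_INR _)). nra. }
  induction i as [|i [a [Ha Hak]]].
  - set (a0 := fun k : nat => match k with O => RtoC 1 | S _ => RtoC 0 end).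
    assert (Hb : forall k, Cmod (resolvent_coef q a0 k) <= INR (k + 1) ^ 0 * r ^ k).
    { induction k as [|k IH]; cbn [resolvent_coef a0].
      - simpl. rewrite Cmod_1. lra.
      - rewrite Cplus_0_l, Cmod_mult. simpl pow in *. rewrite Rmult_1_l in *.
        apply Rmult_le_compat; auto using Cmod_ge_0. }
    exists (resolvent_coef q a0). split; [|exact Hb].
    eapply taylor_ext; [|apply (taylor_resolvent _ a0 q 1 0 taylor_1); [lra|apply Hbd, Hb]].
    intros z Hz. unfold resolvent. simpl. field. apply one_sub_ne0; [lra|exact Hz].
  - assert (Hb : forall k, Cmod (resolvent_coef q a k) <= INR (k + 1) ^ S i * r ^ k).
    { induction k as [|k IH]; cbn [resolvent_coef].
      - eapply Rle_trans; [apply Hak|]. simpl. rewrite pow1. lra.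
      - eapply Rle_trans; [apply Cmod_triangle|]. rewrite Cmod_mult. specialize (Hak (S k)).
        assert (E : INR (S k + 1) = INR (k + 1) + 1) by (rewrite !plus_INR, S_INR; simpl; ring).
        rewrite E in *. pose proof (INR_S_pos k) as Hx. set (x := INR (k + 1)) in *.
        assert (H1 : Cmod q * Cmod (resolvent_coef q a k) <= r * (x ^ S i * r ^ k)).
        { apply Rmult_le_compat; auto using Cmod_ge_0. }
        assert (H2 : x ^ i <= (x + 1) ^ i) by (apply pow_incr; lra).
        pose proof (Hrk (S k)) as H3.
        apply Rle_trans with ((x + 1) ^ i * r ^ S k + x * x ^ i * r ^ S k); [simpl in *; lra|].
        assert (x * x ^ i <= x * (x + 1) ^ i) by (apply Rmult_le_compat_l; lra).
        replace ((x + 1) ^ S i * r ^ S k) with ((x + 1) ^ i * r ^ S k + x * (x + 1) ^ i * r ^ S k) by (simpl; ring).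
        apply Rplus_le_compat_l. apply Rmult_le_compat_r; lra. }
    exists (resolvent_coef q a). split; [|exact Hb].
    eapply taylor_ext; [|apply (taylor_resolvent _ a q 1 (S i) Ha); [lra|apply Hbd, Hb]].
    intros z Hz. unfold resolvent, Cdiv. rewrite (Cpow_S _ (S i)). ring.
Qed.

(** The exponent of [1 - r] matters: in [linked_moebius_pow] it produces exactly the threshold for
    [|lambda|]. *)
Lemma resolvent_pow_S_norm2_le (nu : R) (i : nat) :
  0 <= 2 * INR i + 2 * nu ->
  exists K, 0 < K /\ forall q r, Cmod q <= r -> 0 < r < 1 ->
    S_norm2_le nu (fun z => resolvent q z ^ S i)%C (K * Rpower (1 - r) (- (2 * INR i + 2 * nu + 1))).
Proof.
  intros Hi. destruct (power_geom_series (2 * INR i + 2 * nu) Hi) as [K [HK HKs]].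
  exists K. split; [exact HK|]. intros q r Hq Hr. destruct (HKs r Hr) as [Hex Hs].
  destruct (resolvent_pow_coef q r i Hq ltac:(lra)) as [a [Ha Hak]].
  eapply S_norm2_le_mono; [exact Hs|]. apply (S_norm2_le_of_coef_le nu _ a); auto.
  intros k. unfold dirichlet_term. rewrite Rpower_plus.
  replace (Rpower (INR (k + 1)) (2 * INR i)) with ((INR (k + 1) ^ i) ^ 2).
  2: { rewrite <- pow_mult. rewrite <- Rpower_pow by apply INR_S_pos. f_equal. rewrite mult_INR. simpl. ring. }
  replace (r ^ (2 * k)) with ((r ^ k) ^ 2) by (rewrite <- pow_mult; f_equal; lia).
  replace ((INR (k + 1) ^ i) ^ 2 * Rpower (INR (k + 1)) (2 * nu) * (r ^ k) ^ 2)
    with ((INR (k + 1) ^ i * r ^ k) ^ 2 * Rpower (INR (k + 1)) (2 * nu)) by ring.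
  apply Rmult_le_compat_r; [left; apply Rpower_pos|].
  apply pow_incr. split; [apply Cmod_ge_0|apply Hak].
Qed.

Lemma Cdiv_div_cancel (x y w : C) : w <> 0%C -> y <> 0%C -> (x / y = (x / w) / (y / w))%C.
Proof. intros Hw Hy. field. auto. Qed.

(** With [v = (z - eta) / (1 + k0 (z - eta))], so that [v o phi = s v], the function below is
    [(1 - v/eta)^-j]; its preimage under the [n]-th iterate is [lambda^-n (1 - s^-n v/eta)^-j]. *)
Lemma linked_moebius_pow (nu s : R) (eta k0 lambda : C) (F : C -> C) (i : nat) :
  nu <= 1 / 2 -> attracting_model eta s k0 F -> Rpower s ((1 - 2 * nu) / 2) < Cmod lambda ->
  0 <= 2 * INR i + 2 * nu ->
  linked nu lambda F (fun _ => 0%C)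
    (fun z => ((1 + k0 * (z - eta)) / (1 + (k0 - / eta) * (z - eta))) ^ S i)%C.
Proof.
  intros Hnu Hm Hlam Hi. pose proof Hm as [He [Hs [Hk [HF _]]]].
  assert (Heta : eta <> 0%C) by (intros E; rewrite E, Cmod_0 in He; lra).
  set (L := Cmod lambda) in *. pose proof (Rpower_pos s ((1 - 2 * nu) / 2)) as Hp0.
  assert (HL : lambda <> 0%C) by (apply Cmod_gt_0; unfold L in Hlam; lra).
  set (M1 := 2 + Cmod k0). assert (HM1 : 2 <= M1) by (pose proof (Cmod_ge_0 k0); unfold M1; lra).
  destruct (resolvent_pow_S_norm2_le nu i Hi) as [K [HK HKs]].
  destruct (S_norm2_le_affine_pow nu (1 - k0 * eta)%C k0 (S i) Hnu) as [K' [HK' HKs']].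
  set (e := 2 * INR i + 2 * nu + 1) in *.
  (* The square of [s^((1 - 2 nu) / 2) / |lambda|], the decay rate of the squared norm of the
     preimage. *)
  set (y := Rpower s (1 - 2 * nu) * / L ^ 2).
  assert (HL2 : Rpower s (1 - 2 * nu) < L ^ 2).
  { replace (1 - 2 * nu) with ((1 - 2 * nu) / 2 * 2) by field.
    rewrite <- Rpower_mult, Rpower_2 by exact Hp0. nra. }
  pose proof (Rpower_pos s (1 - 2 * nu)) as Hp1.
  assert (Hy : 0 <= y < 1).
  { split; [apply Rmult_le_pos; [lra|left; apply Rinv_0_lt_compat; lra]|].
    apply Rmult_lt_reg_r with (L ^ 2); [lra|]. unfold y. field_simplify; lra. }
  intros d Hd.
  destruct (geometric_eventually_small y (K' * (K * Rpower (M1 ^ 2) e)) d Hy) as [n0 Hn0]; auto.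
  { apply Rmult_le_pos; [exact HK'|]. apply Rmult_le_pos; [lra|left; apply Rpower_pos]. }
  exists n0. intros n Hn. specialize (Hn0 n Hn).
  pose proof (pow_s_bounds s n Hs) as Hsn. set (t := s ^ n) in *.
  set (Ck := / t). assert (HCk : 1 <= Ck) by (rewrite <- Rinv_1; apply Rinv_le_contravar; lra).
  (* With [h = z - eta] and [v = h / (1 + k0 h)], one has
     [1 - Ck v / eta = (1 + kC h) / (1 + k0 h)]. *)
  set (kC := (k0 - RtoC Ck * / eta)%C).
  assert (HkCe : (kC * eta = k0 * eta - RtoC Ck)%C) by (unfold kC; field; exact Heta).
  assert (HRe : Re (kC * eta)%C = Re (k0 * eta)%C - Ck) by (rewrite HkCe; reflexivity).
  destruct (pole_coef_factor eta kC He ltac:(lra)) as [Hb0 [Hq1 Hfac]].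
  set (b := (1 - kC * eta)%C) in *. set (q := pole_coef eta kC) in *.
  assert (HbX : Cmod b <= M1 * Ck).
  { replace b with ((1 - k0 * eta) + RtoC Ck)%C by (unfold b; rewrite HkCe; ring).
    eapply Rle_trans; [apply Cmod_triangle|]. rewrite Cmod_R, Rabs_pos_eq by lra.
    assert (Cmod (1 - k0 * eta) <= 1 + Cmod k0).
    { unfold Cminus. eapply Rle_trans; [apply Cmod_triangle|]. rewrite Cmod_opp, Cmod_mult, He, Cmod_1. lra. }
    unfold M1. pose proof (Cmod_ge_0 k0). nra. }
  assert (Hbl : Ck <= Cmod b).
  { pose proof (re_le_Cmod b) as H. apply Rabs_le_between in H.
    assert (Re b = 1 - Re (kC * eta)%C) by (unfold b, Cminus; rewrite Re_plus, Re_opp; reflexivity). lra. }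
  assert (HX : 4 <= M1 ^ 2 * Ck) by nra.
  (* From [1 - 2 Re (kC eta) >= 2 Ck] and [|b| <= M1 Ck]: the pole approaches the circle no faster
     than a constant times [s^n]. *)
  assert (Hq : Cmod q <= 1 - / (M1 ^ 2 * Ck)).
  { replace (1 - / (M1 ^ 2 * Ck)) with (1 - 2 * Ck / (2 * (M1 * Ck) ^ 2)) by (field; lra).
    apply pole_coef_bound; auto; lra. }
  assert (Hir : 0 < / (M1 ^ 2 * Ck) < 1).
  { split; [apply Rinv_0_lt_compat; lra|]. rewrite <- Rinv_1. apply Rinv_lt_contravar; lra. }
  pose proof (HKs q _ Hq ltac:(lra)) as HS. apply HKs' in HS.
  apply (S_norm2_le_scal nu (/ lambda ^ n * (/ b) ^ S i)%C) in HS.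
  exists (fun z => / lambda ^ n * ((1 + k0 * (z - eta)) / (1 + kC * (z - eta))) ^ S i)%C.
  split.
  - eapply S_norm2_le_mono; [|eapply S_norm2_le_ext; [|exact HS]].
    + eapply Rle_trans; [|exact Hn0].
      rewrite Cmod_mult, Cmod_inv, !Cmod_pow, Cmod_inv by (try apply Cpow_nz; assumption). fold L.
      replace (1 - (1 - / (M1 ^ 2 * Ck))) with (/ (M1 ^ 2 * Ck)) by ring.
      assert (Hrp : Rpower (/ (M1 ^ 2 * Ck)) (- e) = Rpower (M1 ^ 2) e * Rpower Ck e).
      { rewrite Rpower_mult_distr by (try apply pow_lt; lra).
        unfold Rpower. rewrite ln_Rinv by lra. f_equal. ring. }
      rewrite Hrp.
      assert (Hbi : (/ Cmod b) ^ S i <= (/ Ck) ^ S i).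
      { apply pow_incr. split; [left; apply Rinv_0_lt_compat; lra|apply Rinv_le_contravar; lra]. }
      assert (Hbi0 : 0 <= (/ Cmod b) ^ S i) by (apply pow_le; left; apply Rinv_0_lt_compat; lra).
      (* The prefactor [b^-(i+1)] contributes [Ck^-(2i+2)] and the resolvent [Ck^(2i+2 nu+1)]. The
         exponents add up to [2 nu - 1], whatever [i], and [Ck = s^-n]. *)
      assert (Hfin : ((/ Ck) ^ S i) ^ 2 * Rpower Ck e = Rpower s (1 - 2 * nu) ^ n).
      { rewrite Rpower_pow_base by lra. fold t. unfold Ck at 1. rewrite Rinv_inv.
        rewrite <- pow_mult, <- Rpower_pow by lra.
        replace (Rpower Ck e) with (Rpower t (- e)).
        - rewrite <- Rpower_plus. f_equal. unfold e. rewrite mult_INR, S_INR. simpl. ring.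
        - unfold Ck, Rpower. rewrite ln_Rinv by lra. f_equal. ring. }
      assert (Hyn : y ^ n = Rpower s (1 - 2 * nu) ^ n * (/ L ^ n) ^ 2).
      { unfold y. rewrite Rpow_mult_distr. f_equal. rewrite <- !pow_inv, <- !pow_mult. f_equal. lia. }
      rewrite Hyn, <- Hfin.
      assert (HLn : 0 <= / L ^ n) by (left; apply Rinv_0_lt_compat, pow_lt; lra).
      pose proof (Rpower_pos (M1 ^ 2) e). pose proof (Rpower_pos Ck e).
      set (A := K' * (K * Rpower (M1 ^ 2) e)).
      assert (HA : 0 <= A) by (unfold A; apply Rmult_le_pos; [exact HK'|apply Rmult_le_pos; lra]).
      replace ((/ L ^ n * (/ Cmod b) ^ S i) ^ 2 * (K' * (K * (Rpower (M1 ^ 2) e * Rpower Ck e))))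
        with (A * (((/ Cmod b) ^ S i) ^ 2 * Rpower Ck e * (/ L ^ n) ^ 2)) by (unfold A; ring).
      apply Rmult_le_compat_l; [exact HA|]. apply Rmult_le_compat_r; [apply pow2_ge_0|].
      apply Rmult_le_compat_r; [lra|]. apply pow_incr. lra.
    + intros z Hz. cbv beta. rewrite Hfac. fold b q. unfold Cdiv.
      replace (1 + k0 * (z - eta))%C with (1 - k0 * eta + k0 * z)%C by ring.
      assert (Hne : (1 - q * z)%C <> 0%C) by (apply one_sub_ne0; [lra|exact Hz]).
      replace (/ (b * (1 - q * z)))%C with (/ b * resolvent q z)%C by (unfold resolvent; field; split; assumption).
      rewrite !Cpow_mult_l. ring.
  - apply S_norm2_le_zero; [|lra]. intros z Hz. unfold iterate_op. rewrite (model_iter _ _ _ _ n z Hm Hz). fold t.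
    assert (Hdn : (1 + k0 * RtoC (1 - t) * (z - eta))%C <> 0%C).
    { apply den_ne0; auto. apply Re_scaled_lt; auto. lra. }
    assert (Hd1 : (1 + (k0 - / eta) * (z - eta))%C <> 0%C).
    { apply den_ne0; auto. replace ((k0 - / eta) * eta)%C with (k0 * eta - 1)%C by (field; exact Heta).
      unfold Cminus. rewrite Re_plus, Re_opp. change (Re (RtoC 1)) with 1. lra. }
    assert (Ht0 : RtoC t <> 0%C) by (intros E; apply RtoC_inj in E; lra).
    set (w := (eta + t * (z - eta) / (1 + k0 * (1 - t)%R * (z - eta)))%C).
    replace ((1 + k0 * (w - eta)) / (1 + kC * (w - eta)))%C with ((1 + k0 * (z - eta)) / (1 + (k0 - / eta) * (z - eta)))%C.
    { assert (Hln : (lambda ^ n)%C <> 0%C) by (apply Cpow_nz; exact HL). field.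
      split; [exact Hln|exact Hd1] || exact Hln. }
    unfold w, kC, Ck. rewrite RtoC_inv by lra. revert Hdn. rewrite RtoC_minus. intros Hdn.
    assert (E1 : (1 + k0 * (eta + t * (z - eta) / (1 + k0 * (1 - t) * (z - eta)) - eta) = (1 + k0 * (z - eta)) / (1 + k0 * (1 - t) * (z - eta)))%C) by (field; exact Hdn).
    assert (E2 : (1 + (k0 - / t * / eta) * (eta + t * (z - eta) / (1 + k0 * (1 - t) * (z - eta)) - eta) = (1 + (k0 - / eta) * (z - eta)) / (1 + k0 * (1 - t) * (z - eta)))%C) by (field; auto).
    rewrite E1, E2. apply Cdiv_div_cancel; assumption.
Qed.


Lemma nat_above (x : R) : exists n, x <= INR n.
Proof.
  destruct (archimed_cor1 (/ (Rabs x + 1))) as [N [HN HN0]].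
  { apply Rinv_0_lt_compat. pose proof (Rabs_pos x). lra. }
  exists N. apply Rinv_lt_cancel in HN; [|apply lt_0_INR; lia]. pose proof (Rle_abs x). lra.
Qed.

Lemma Cinv_neq_0 (z : C) : z <> 0%C -> (/ z)%C <> 0%C.
Proof.
  intros Hz E. pose proof (Cinv_r z Hz) as H. rewrite E, Cmult_0_r in H.
  apply RtoC_inj in H. lra.
Qed.

(** Any order [N] of vanishing at [eta] with [|lambda| s^N < 1] will do, since the factor
    [(1 - z/eta)^N] can be removed afterwards. *)
Lemma linked_monomial_left (nu s : R) (eta k0 lambda : C) (F : C -> C) :
  nu <= 1 / 2 -> attracting_model eta s k0 F ->
  forall k, linked nu lambda F (fun z => z ^ k)%C (fun _ => 0%C).
Proof.
  intros Hnu Hm. pose proof Hm as [He [Hs _]].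
  assert (Heta : eta <> 0%C) by (intros E; rewrite E, Cmod_0 in He; lra).
  destruct (geometric_eventually_small s (Cmod lambda) (1 / 2) ltac:(lra) (Cmod_ge_0 lambda) ltac:(lra)) as [N HN].
  apply (remove_factors nu (fun f => linked nu lambda F f (fun _ => 0%C)) (/ eta)%C N Hnu).
  - rewrite Cmod_inv, He, Rinv_1 by exact Heta. lra.
  - apply linked_left_closed.
  - intros k. apply (linked_vanishing nu s eta k0); auto. specialize (HN N (Nat.le_refl _)). lra.
Qed.

(** Up to a constant, the functions known to be reachable are powers [U^j] with [j > i0], where
    [U = (1 - q0 z) / (1 - q1 z)]. Combining them frees powers of [z] and of the resolvent next to a
    fixed [(1 - q0 z)^(i0+1)]; then the pole goes to infinity and that factor is removed. *)
Lemma linked_monomial_right (nu s : R) (eta k0 lambda : C) (F : C -> C) :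
  nu <= 1 / 2 -> attracting_model eta s k0 F -> Rpower s ((1 - 2 * nu) / 2) < Cmod lambda ->
  forall k, linked nu lambda F (fun _ => 0%C) (fun z => z ^ k)%C.
Proof.
  intros Hnu Hm Hlam. pose proof Hm as [He [Hs [Hk _]]].
  assert (Heta : eta <> 0%C) by (intros E; rewrite E, Cmod_0 in He; lra).
  set (P := fun g => linked nu lambda F (fun _ => 0%C) g).
  assert (HP : closed_subspace nu P) by apply linked_right_closed.
  pose proof HP as [Hext [Hadd [Hsc _]]].
  destruct (nat_above (- nu)) as [i0 Hi0].
  set (k1 := (k0 - / eta)%C).
  assert (Hk1 : Re (k1 * eta)%C < 1 / 2).
  { unfold k1. replace ((k0 - / eta) * eta)%C with (k0 * eta - 1)%C by (field; exact Heta).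
    unfold Cminus. rewrite Re_plus, Re_opp. change (Re (RtoC 1)) with 1. lra. }
  destruct (pole_coef_factor eta k0 He Hk) as [Hb0 [Hq0 Hf0]].
  destruct (pole_coef_factor eta k1 He Hk1) as [Hb1 [Hq1 Hf1]].
  assert (Hne : (pole_coef eta k0 - pole_coef eta k1)%C <> 0%C).
  { assert (E : (pole_coef eta k0 - pole_coef eta k1 = - / eta / ((1 - k0 * eta) * (1 - k1 * eta)))%C).
    { unfold pole_coef. unfold k1 in *. field. repeat split; try assumption. intros E0. apply Hb1. rewrite <- E0. field. exact Heta. }
    rewrite E. unfold Cdiv. apply Cmult_neq_0; [|apply Cinv_neq_0, Cmult_neq_0; assumption].
    intros E0. apply (f_equal Cmod) in E0. rewrite Cmod_opp, Cmod_inv, He, Cmod_0, Rinv_1 in E0 by exact Heta. lra. }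
  set (q0 := pole_coef eta k0) in *. set (q1 := pole_coef eta k1) in *.
  set (b0 := (1 - k0 * eta)%C) in *. set (b1 := (1 - k1 * eta)%C) in *.
  set (U := fun z => ((1 - q0 * z) * resolvent q1 z)%C).
  assert (Hgen : forall j, (S i0 <= j)%nat -> P (fun z => U z ^ j)%C).
  { intros [|i] Hj; [lia|].
    assert (Hi : 0 <= 2 * INR i + 2 * nu).
    { assert (INR i0 <= INR i) by (apply le_INR; lia). lra. }
    eapply Hext; [|apply (Hsc ((b1 / b0) ^ S i)%C _ (linked_moebius_pow nu s eta k0 lambda F i Hnu Hm Hlam Hi))].
    intros z Hz. cbv beta. fold k1. rewrite Hf0, Hf1, <- Cpow_mult_l. f_equal.
    unfold U, resolvent. field. repeat split; try assumption. apply one_sub_ne0; [lra|exact Hz]. }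
  assert (Hmix : forall l j, (S i0 <= j)%nat -> P (fun z => U z ^ j * resolvent q1 z ^ l)%C).
  { induction l as [|l IH]; intros j Hj.
    - eapply Hext; [|apply (Hgen j Hj)]. intros z _. simpl. ring.
    - eapply Hext; [|apply (Hadd _ _ (Hsc (q0 / (q0 - q1))%C _ (IH j Hj)) (Hsc (- q1 / (q0 - q1))%C _ (IH (S j) ltac:(lia))))].
      intros z Hz. cbv beta. rewrite !Cpow_S.
      (* Partial fractions: both the resolvent and, below, [z] times it are affine functions of [U],
         because [q0 <> q1]. *)
      replace (resolvent q1 z) with (q0 / (q0 - q1) + - q1 / (q0 - q1) * U z)%C at 3; [ring|].
      unfold U, resolvent. field. split; [apply one_sub_ne0; [lra|exact Hz]|exact Hne]. }
  assert (Hmix2 : forall i l j, (S i0 <= j)%nat -> P (fun z => U z ^ j * (z * resolvent q1 z) ^ i * resolvent q1 z ^ l)%C).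
  { induction i as [|i IH]; intros l j Hj.
    - eapply Hext; [|apply (Hmix l j Hj)]. intros z _. simpl. ring.
    - eapply Hext; [|apply (Hadd _ _ (Hsc (/ (q0 - q1))%C _ (IH l j Hj)) (Hsc (- / (q0 - q1))%C _ (IH l (S j) ltac:(lia))))].
      intros z Hz. cbv beta. rewrite !Cpow_S.
      replace (z * resolvent q1 z)%C with (/ (q0 - q1) + - / (q0 - q1) * U z)%C at 3; [ring|].
      unfold U, resolvent. field. split; [apply one_sub_ne0; [lra|exact Hz]|exact Hne]. }
  apply (remove_factors nu P q0 (S i0) Hnu ltac:(lra) HP).
  intros k.
  apply (resolvent_path nu (fun f => P (fun z => (1 + - q0 * z) ^ S i0 * f z)%C) q1 (S i0) Hnu); [|exact Hq1|].
  - apply closed_subspace_mult; assumption.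
  (* The pole order splits into [S i0] for [U^(S i0)], [i] to pair with [z^i], and the rest. *)
  - intros i m Him. replace m with (S i0 + (i + (m - S i0 - i)))%nat by lia.
    eapply Hext; [|apply (Hmix2 i (m - S i0 - i)%nat (S i0) (Nat.le_refl _))].
    intros z _. cbv beta. unfold U. rewrite !Cpow_add_r, !Cpow_mult_l.
    replace (1 + - q0 * z)%C with (1 - q0 * z)%C by ring. ring.
Qed.

Lemma recurrent_of_large_scalar (nu s : R) (eta k0 lambda : C) (phi : lfm) :
  nu <= 1 / 2 -> attracting_model eta s k0 (lfm_fun phi) ->
  Rpower s ((1 - 2 * nu) / 2) < Cmod lambda ->
  recurrent_on_S nu (scaled_composition_op lambda phi).
Proof.
  intros Hnu Hm Hlam. apply recurrent_of_linked. intros f Hf.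
  pose proof (closed_subspace_full _ _ (linked_left_closed nu lambda (lfm_fun phi))
    (linked_monomial_left nu s eta k0 lambda _ Hnu Hm) f Hf) as H1.
  pose proof (closed_subspace_full _ _ (linked_right_closed nu lambda (lfm_fun phi))
    (linked_monomial_right nu s eta k0 lambda _ Hnu Hm Hlam) f Hf) as H2.
  eapply linked_ext; [| |apply (linked_plus _ _ _ _ _ _ _ H1 H2)]; intros z _; cbv beta; ring.
Qed.

(** * Normal form of the linear fractional map *)


Lemma lfm_app_Some (phi : lfm) (z w : C) :
  lfm_app phi (Some z) = Some w <->
  (lfm_c phi * z + lfm_d phi)%C <> 0%C /\ lfm_fun phi z = w.
Proof.
  simpl. destruct (Ceq_dec _ _) as [E|E]; split.
  - discriminate.
  - intros [H _]. contradiction.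
  - intros H. injection H. auto.
  - intros [_ H]. rewrite H. reflexivity.
Qed.

(** The difference quotient at [eta + t] is exactly [sg / (1 + kap t)]; real increments [t] suffice
    to identify the limit. *)
Lemma moebius_derivative (f : C -> C) (eta sg kap l : C) :
  (forall z, (1 + kap * (z - eta))%C <> 0%C -> f z = (eta + sg * (z - eta) / (1 + kap * (z - eta)))%C) ->
  @is_derive C_AbsRing C_NormedModule f eta l -> sg = l.
Proof.
  intros Hf [_ Hd].
  specialize (Hd eta (fun P H => H)).
  assert (Hle : forall e, 0 < e -> Cmod (sg - l) <= e).
  { intros e He. destruct (Hd (mkposreal (e / 2) ltac:(lra))) as [[del Hdel] H]. simpl in H.
    pose proof (Cmod_ge_0 sg) as Hs0. pose proof (Cmod_ge_0 kap) as Hk0.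
    set (X := Cmod sg * Cmod kap). assert (HX : 0 <= X) by (apply Rmult_le_pos; assumption).
    (* The three bounds serve, in order, the definition of the derivative, [|1 + kap t| >= 1/2], and
       [|sg kap| t <= e/4]. *)
    set (t := Rmin (del / 2) (Rmin (/ (2 * (Cmod kap + 1))) (e / (4 * (X + 1))))).
    assert (Ht0 : 0 < t).
    { repeat apply Rmin_glb_lt; [lra|apply Rinv_0_lt_compat; lra|apply Rdiv_lt_0_compat; lra]. }
    assert (Ht1 : t < del) by (pose proof (Rmin_l (del / 2) (Rmin (/ (2 * (Cmod kap + 1))) (e / (4 * (X + 1))))); fold t in H0; lra).
    assert (Htm : t <= Rmin (/ (2 * (Cmod kap + 1))) (e / (4 * (X + 1)))) by apply Rmin_r.
    assert (Ht2 : t <= / (2 * (Cmod kap + 1))) by (eapply Rle_trans; [exact Htm|apply Rmin_l]).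
    assert (Ht3 : t <= e / (4 * (X + 1))) by (eapply Rle_trans; [exact Htm|apply Rmin_r]).
    assert (Hkt : Cmod kap * t <= 1 / 2).
    { apply Rle_trans with ((Cmod kap + 1) * / (2 * (Cmod kap + 1))); [apply Rmult_le_compat; lra|].
      right. field. lra. }
    assert (HXt : X * t <= e / 4).
    { apply Rle_trans with ((X + 1) * (e / (4 * (X + 1)))); [apply Rmult_le_compat; lra|]. right. field. lra. }
    assert (Hden : 1 / 2 <= Cmod (1 + kap * t)).
    { pose proof (Cmod_triangle (1 + kap * t) (- (kap * t))) as Htr.
      replace (1 + kap * t + - (kap * t))%C with (RtoC 1) in Htr by ring.
      rewrite Cmod_1, Cmod_opp, Cmod_mult, Cmod_R, Rabs_pos_eq in Htr by lra. lra. }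
    assert (Hden0 : (1 + kap * t)%C <> 0%C) by (intros E; rewrite E, Cmod_0 in Hden; lra).
    specialize (H (eta + t)%C).
    assert (Hb : Cmod (eta + t - eta) < del).
    { replace (eta + t - eta)%C with (RtoC t) by ring. rewrite Cmod_R, Rabs_pos_eq; lra. }
    specialize (H Hb).
    change (Cmod (f (eta + t) - f eta - (eta + t - eta) * l)%C <= e / 2 * Cmod (eta + t - eta)) in H.
    assert (Hfe : f eta = eta).
    { rewrite Hf; replace (eta - eta)%C with (RtoC 0) by ring; replace (1 + kap * 0)%C with (RtoC 1) by ring.
      - field.
      - intros E. apply RtoC_inj in E. lra. }
    rewrite Hfe, Hf in H; replace (eta + t - eta)%C with (RtoC t) in * by ring; [|exact Hden0].
    rewrite Cmod_R, Rabs_pos_eq in H by lra.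
    replace (eta + sg * t / (1 + kap * t) - eta - t * l)%C with (RtoC t * (sg / (1 + kap * t) - l))%C in H by (field; exact Hden0).
    rewrite Cmod_mult, Cmod_R, Rabs_pos_eq in H by lra.
    assert (H' : Cmod (sg / (1 + kap * t) - l) <= e / 2) by (apply Rmult_le_reg_l with t; lra).
    replace (sg - l)%C with ((sg * kap * t) / (1 + kap * t) + (sg / (1 + kap * t) - l))%C by (field; exact Hden0).
    eapply Rle_trans; [apply Cmod_triangle|].
    rewrite Cmod_div, !Cmod_mult, Cmod_R, Rabs_pos_eq by (assumption || lra). fold X.
    assert (X * t / Cmod (1 + kap * t) <= e / 2).
    { apply Rmult_le_reg_r with (Cmod (1 + kap * t)); [lra|]. unfold Rdiv at 1. rewrite Rmult_assoc, Rinv_l by lra. nra. }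
    lra. }
  assert (H0 : Cmod (sg - l) = 0).
  { apply Rle_antisym; [|apply Cmod_ge_0]. apply le_epsilon. intros e He. specialize (Hle e He). lra. }
  apply Cmod_eq_0 in H0. replace sg with (sg - l + l)%C by ring. rewrite H0. ring.
Qed.

(** Dividing by [D = c eta + d] normalises the denominator to 1 at [eta]. The fixed-point equation
    eliminates [b], and the derivative identifies the remaining coefficient as [s]. *)
Lemma lfm_fixed_point_form (phi : lfm) (eta : C) (s : R) :
  attractive_fixed_point phi eta s ->
  exists kap, forall z,
    ((1 + kap * (z - eta))%C <> 0%C <-> (lfm_c phi * z + lfm_d phi)%C <> 0%C) /\
    ((1 + kap * (z - eta))%C <> 0%C -> lfm_fun phi z = (eta + s * (z - eta) / (1 + kap * (z - eta)))%C).
Proof.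
  intros [Hfix [Hder Hs]]. apply lfm_app_Some in Hfix as [HD Hfix].
  destruct phi as [a b c d det]. unfold lfm_fun in *. simpl in *. clear det.
  set (D := (c * eta + d)%C) in *.
  assert (Hb : b = (eta * D - a * eta)%C).
  { rewrite <- Hfix at 1. field. exact HD. }
  assert (Hden : forall z, (c * z + d = D * (1 + c / D * (z - eta)))%C).
  { intros z. replace d with (D - c * eta)%C by (unfold D; ring). field. exact HD. }
  assert (Hiff : forall z, (1 + c / D * (z - eta))%C <> 0%C <-> (c * z + d)%C <> 0%C).
  { intros z. rewrite Hden. split; intros H.
    - apply Cmult_neq_0; assumption.
    - intros E. apply H. rewrite E. ring. }
  assert (Hform : forall z, (1 + c / D * (z - eta))%C <> 0%C ->
    ((a * z + b) / (c * z + d) = eta + ((a - eta * c) / D) * (z - eta) / (1 + c / D * (z - eta)))%C).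
  { intros z Hz. rewrite Hden, Hb. pose proof (proj1 (Hiff z) Hz) as Hz'. rewrite Hden in Hz'.
    revert Hz Hz'. clearbody D. intros Hz Hz'. field. split; [exact HD|].
    intros E. apply Hz'. rewrite <- E. field. exact HD. }
  assert (Hsg : ((a - eta * c) / D)%C = RtoC s).
  { apply (moebius_derivative (fun z => (a * z + b) / (c * z + d))%C eta _ (c / D)%C _ Hform Hder). }
  exists (c / D)%C. intros z. split; [apply Hiff|]. rewrite <- Hsg. apply Hform.
Qed.

Lemma Re_mult_conj_scal (k g eta : C) :
  Re (k * g * (eta * Cconj g))%C = Cmod g ^ 2 * Re (k * eta)%C.
Proof. rewrite Cmod2_alt. destruct k, g, eta; unfold Re, Im; simpl. ring. Qed.

(** In the equality case [disk_identity] reads [(|w|^2 - 1) |1 + kap h|^2 = s (|z|^2 - 1)], so [z]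
    is in the disk exactly when [w] is; the preimage is found by solving for [h = z - eta]. *)
Lemma automorphism_of_extremal (phi : lfm) (eta kap : C) (s : R) :
  Cmod eta = 1 -> 0 < s < 1 ->
  (forall z, ((1 + kap * (z - eta))%C <> 0%C <-> (lfm_c phi * z + lfm_d phi)%C <> 0%C) /\
    ((1 + kap * (z - eta))%C <> 0%C -> lfm_fun phi z = (eta + s * (z - eta) / (1 + kap * (z - eta)))%C)) ->
  disk_self_map phi -> 2 * Re (kap * eta)%C + s = 1 -> disk_automorphism phi.
Proof.
  intros He Hs Hform Hself HT. split; [exact Hself|]. intros w Hw.
  assert (Hs0 : RtoC s <> 0%C) by (intros E; apply RtoC_inj in E; lra).
  assert (Hsq : forall z, Cmod z ^ 2 = 1 + 2 * Re (eta * Cconj (z - eta))%C + Cmod (z - eta) ^ 2).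
  { intros z. replace z with (eta + (z - eta))%C at 1 by ring. rewrite Cmod_plus_sqr, He. ring. }
  set (g := (w - eta)%C).
  (* If [s = kap g], multiplying by [eta] times the conjugate of [g] and taking real parts gives
     [Re (eta conj g) >= 0], hence [|w| >= 1]. *)
  assert (Hg : (s - kap * g)%C <> 0%C).
  { intros E. assert (Es : RtoC s = (kap * g)%C) by (replace (kap * g)%C with (s - (s - kap * g))%C by ring; rewrite E; ring).
    pose proof (Re_mult_conj_scal kap g eta) as HR. rewrite <- Es, Re_RtoC_mult in HR.
    pose proof (Hsq w) as Hw2. fold g in Hw2. unfold in_disk in Hw.
    pose proof (Cmod_ge_0 w). pose proof (pow2_ge_0 (Cmod g)) as Hg2.
    assert (0 <= Re (eta * Cconj g)%C).
    { apply Rmult_le_reg_l with s; [lra|]. rewrite HR, Rmult_0_r. apply Rmult_le_pos; lra. }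
    assert (Cmod w ^ 2 < 1) by nra. lra. }
  set (h := (g / (s - kap * g))%C). set (z := (eta + h)%C).
  assert (Hh : (z - eta)%C = h) by (unfold z; ring).
  assert (Hd : (1 + kap * (z - eta))%C = (s / (s - kap * g))%C) by (rewrite Hh; unfold h; field; exact Hg).
  assert (Hd0 : (1 + kap * (z - eta))%C <> 0%C).
  { rewrite Hd. unfold Cdiv. apply Cmult_neq_0; [exact Hs0|apply Cinv_neq_0; exact Hg]. }
  assert (Hfz : lfm_fun phi z = w).
  { rewrite (proj2 (Hform z) Hd0), Hd, Hh. unfold h.
    replace w with (eta + g)%C by (unfold g; ring). field. split; assumption. }
  exists z. split; [split|].
  - pose proof (disk_identity eta kap (z - eta) s He) as Hid. rewrite HT, Rmult_1_r in Hid.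
    replace (eta * (1 + kap * (z - eta)) + s * (z - eta))%C with (w * (1 + kap * (z - eta)))%C in Hid.
    2: { rewrite <- Hfz, (proj2 (Hform z) Hd0). field. exact Hd0. }
    rewrite Cmod_mult, Rpow_mult_distr in Hid. pose proof (Hsq z) as Hz2.
    assert (HB : 0 < Cmod (1 + kap * (z - eta)) ^ 2) by (apply pow_lt, Cmod_gt_0; exact Hd0).
    unfold in_disk in *. pose proof (Cmod_ge_0 w). pose proof (Cmod_ge_0 z).
    assert (Hlt : s * (Cmod z ^ 2 - 1) < 0).
    { replace (s * (Cmod z ^ 2 - 1)) with ((Cmod w ^ 2 - 1) * Cmod (1 + kap * (z - eta)) ^ 2) by (rewrite Hz2; lra).
      assert (Cmod w ^ 2 < 1) by nra. nra. }
    assert (Cmod z ^ 2 < 1) by nra. nra.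
  - apply lfm_app_Some. split; [apply (Hform z); exact Hd0|exact Hfz].
  - intros z' [Hz' Happ]. apply lfm_app_Some in Happ as [Hc Hf'].
    pose proof (proj2 (proj1 (Hform z')) Hc) as Hd'. rewrite (proj2 (Hform z') Hd') in Hf'.
    assert (E : ((z' - eta) * (s - kap * g) = g)%C).
    { assert (Eg : (g = s * (z' - eta) / (1 + kap * (z' - eta)))%C) by (unfold g; rewrite <- Hf'; ring).
      rewrite Eg. field. exact Hd'. }
    unfold z, h. rewrite <- E at 1. replace z' with (eta + (z' - eta))%C at 2 by ring. field. exact Hg.
Qed.

(** Testing the self-map property on the diameter through [eta] gives [2 Re (kap eta) + s <= 1], and
    equality would make an automorphism. Division of [kap] by [1 - s] turns this into the bound on
    [k0]. *)
Lemma lfm_attracting_model (phi : lfm) (eta : C) (s : R) :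
  disk_self_map phi -> ~ disk_automorphism phi -> attractive_fixed_point phi eta s -> on_circle eta ->
  exists k0, attracting_model eta s k0 (lfm_fun phi).
Proof.
  intros Hself Hnaut Hattr He. pose proof Hattr as [_ [_ Hs]]. unfold on_circle in He.
  destruct (lfm_fixed_point_form phi eta s Hattr) as [kap Hform].
  assert (HF : forall z, in_disk z -> in_disk (lfm_fun phi z) /\ (1 + kap * (z - eta))%C <> 0%C).
  { intros z Hz. destruct (Hself z Hz) as [w [Hw Happ]]. apply lfm_app_Some in Happ as [Hc Hf].
    split; [rewrite Hf; exact Hw|]. apply (Hform z). exact Hc. }
  assert (HT : 2 * Re (kap * eta)%C + s <= 1).
  { set (T := 2 * Re (kap * eta)%C + s).
    (* At [z - eta = - x eta], [disk_identity] gives [-2x + x^2 T < 0]. If [T > 1], then [x = 2 / T]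
       is admissible and contradicts this. *)
    assert (Hx : forall x, 0 < x < 2 -> x * T < 2).
    { intros x Hx. set (z := ((1 - x)%R * eta)%C).
      assert (Hz : in_disk z).
      { unfold in_disk, z. rewrite Cmod_mult, Cmod_R, He, Rmult_1_r. apply Rabs_lt_between. lra. }
      destruct (HF z Hz) as [HFz Hd]. rewrite (proj2 (Hform z) Hd) in HFz.
      pose proof (disk_identity eta kap (z - eta) s He) as Hid. fold T in Hid.
      assert (Hh : (z - eta = (- x)%R * eta)%C) by (unfold z; rewrite RtoC_minus, RtoC_opp; ring).
      assert (Hre : Re (eta * Cconj (z - eta))%C = - x).
      { rewrite Hh, Cmult_conj. replace (Cconj (- x)%R) with (RtoC (- x)) by (unfold Cconj, RtoC; simpl; f_equal; ring).
        replace (eta * ((- x)%R * Cconj eta))%C with ((- x)%R * (eta * Cconj eta))%C by ring.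
        rewrite Re_RtoC_mult, Re_mult_conj, He. ring. }
      assert (Hm : Cmod (z - eta) = x).
      { rewrite Hh, Cmod_mult, Cmod_R, He, Rabs_Ropp, Rabs_pos_eq; lra. }
      rewrite Hre, Hm in Hid.
      replace (eta * (1 + kap * (z - eta)) + s * (z - eta))%C
        with ((eta + s * (z - eta) / (1 + kap * (z - eta))) * (1 + kap * (z - eta)))%C in Hid by (field; exact Hd).
      rewrite Cmod_mult, Rpow_mult_distr in Hid.
      assert (HB : 0 < Cmod (1 + kap * (z - eta)) ^ 2) by (apply pow_lt, Cmod_gt_0; exact Hd).
      unfold in_disk in HFz. set (W := Cmod (eta + s * (z - eta) / (1 + kap * (z - eta)))) in *.
      assert (0 <= W) by apply Cmod_ge_0. assert (W ^ 2 < 1) by nra.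
      assert (s * (2 * - x + x ^ 2 * T) < 0) by nra.
      assert (2 * - x + x ^ 2 * T < 0) by nra. nra. }
    destruct (Rle_lt_dec T 1) as [Hle|Hlt]; [exact Hle|exfalso].
    specialize (Hx (2 / T)). assert (H2 : 0 < 2 / T < 2).
    { split; [apply Rdiv_lt_0_compat; lra|]. apply Rmult_lt_reg_r with T; [lra|]. field_simplify; lra. }
    specialize (Hx H2). replace (2 / T * T) with 2 in Hx by (field; lra). lra. }
  assert (HT1 : 2 * Re (kap * eta)%C + s < 1).
  { destruct (Rle_lt_or_eq_dec _ _ HT) as [H|H]; [exact H|exfalso].
    apply Hnaut. apply (automorphism_of_extremal phi eta kap s); assumption. }
  assert (H1s : (1 - s)%C <> 0%C) by (rewrite <- RtoC_minus; intros E; apply RtoC_inj in E; lra).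
  exists (kap / (1 - s))%C. split; [exact He|]. split; [exact Hs|]. split; [|split].
  - replace (kap / (1 - s) * eta)%C with (RtoC (/ (1 - s)) * (kap * eta))%C.
    2: { rewrite RtoC_inv, RtoC_minus by lra. field. exact H1s. }
    rewrite Re_RtoC_mult. apply Rmult_lt_reg_l with (1 - s); [lra|].
    rewrite <- Rmult_assoc, Rinv_r by lra. lra.
  - intros z Hz. apply HF. exact Hz.
  - intros z Hz. destruct (HF z Hz) as [_ Hd].
    replace (kap / (1 - s) * (1 - s))%C with kap by (field; exact H1s).
    apply (Hform z). exact Hd.
Qed.

Theorem theorem3p2 :
  forall (phi : lfm) (eta : C) (s : R),
    hyperbolic phi ->
    disk_self_map phi ->
    ~ disk_automorphism phi ->
    attractive_fixed_point phi eta s ->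
    on_circle eta ->
    forall lambda : C,
      (forall nu : R,
         recurrent_on_S nu (scaled_composition_op lambda phi) <->
         nu <= 1 / 2 /\ Cmod lambda > Rpower s ((1 - 2 * nu) / 2)) /\
      (recurrent_on_S (1 / 2) (scaled_composition_op lambda phi) <->
       Cmod lambda > 1).
Proof.
  intros phi eta s _ Hself Hnaut Hattr He lambda.
  destruct (lfm_attracting_model phi eta s Hself Hnaut Hattr He) as [k0 Hm].
  assert (Hmain : forall nu, recurrent_on_S nu (scaled_composition_op lambda phi) <->
         nu <= 1 / 2 /\ Cmod lambda > Rpower s ((1 - 2 * nu) / 2)).
  { intros nu. split.
    - intros Hrec. destruct (Rle_lt_dec nu (1 / 2)) as [Hnu|Hnu].
      + split; [exact Hnu|]. apply Rnot_le_gt. intros Hle.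
        exact (not_recurrent_low phi eta s k0 lambda nu Hm Hnu Hle Hrec).
      + exfalso. exact (not_recurrent_high phi eta s k0 lambda nu Hm Hnu Hrec).
    - intros [Hnu Hlam]. exact (recurrent_of_large_scalar nu s eta k0 lambda phi Hnu Hm Hlam). }
  split; [exact Hmain|]. rewrite Hmain.
  pose proof Hm as [_ [Hs _]].
  replace ((1 - 2 * (1 / 2)) / 2) with 0 by field. rewrite Rpower_O by lra.
  split; [intros [_ H]; exact H|intros H; split; [lra|exact H]].
Qed.
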